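(* There exists an isometric lattice isomorphism from $\overline{W}$ into $W$.
   Context: Functions are real-valued. Let $\lambda$ be Lebesgue measure on $[0,1]$. Weak$L^1$ is the space of (a.e.-equivalence classes of) measurable functions $f$ on $[0,1]$ with $q(f)=\sup_{c>0}c\,\lambda\{t:|f(t)|>c\}<\infty$. Let $\rho$ be the gauge functional of the convex hull of $\{f:q(f)\le 1\}$ (the maximal seminorm); it is known (Cwikel–Fefferman) that $\rho(f)=\lim_{n\to\infty}\sup_{p,q>0,\,q/p>n}\frac{1}{\ln(q/p)}\int_{\{p\le|f|\le q\}}|f|\,d\lambda$. Let $N=\{f:\rho(f)=0\}$. The normed envelope is $W=(\text{Weak}L^1/N,\rho)$, a normed vector lattice with the quotient order. The Banach envelope $\overline{W}$ is the completion of $W$, a Banach lattice. An isometric lattice isomorphism from $X$ into $Y$ is a linear, norm preserving map that preserves the lattice operations (not necessarily onto). *)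

(* Defs.v *)
From HB Require Import structures.
From mathcomp Require Import all_boot all_order all_algebra.
From mathcomp Require Import all_classical all_reals all_analysis measurable_realfun.
Set Implicit Arguments.
Unset Strict Implicit.
Unset Printing Implicit Defensive.
Import Order.TTheory GRing.Theory Num.Theory.
Import numFieldNormedType.Exports.
Local Open Scope classical_set_scope.
Local Open Scope ring_scope.
Local Open Scope quotient_scope.

(* The order is a field of the mixin rather than a porderType instance: the   *)
(* hierarchy does not allow a join of ordered types and normed modules below  *)
(* numDomainType.                                                             *)
HB.mixin Record isVectorLattice (R : numDomainType) V of GRing.Lmodule R V := {
  vle : V -> V -> Prop;
  vle_refl : forall x, vle x x;
  vle_anti : forall x y, vle x y -> vle y x -> x = y;
  vle_trans : forall y x z, vle x y -> vle y z -> vle x z;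
  vle_add2r : forall z x y, vle x y -> vle (x + z) (y + z);
  vle_scale : forall (a : R) x y, 0 <= a -> vle x y -> vle (a *: x) (a *: y);
  vjoin : V -> V -> V;
  vmeet : V -> V -> V;
  vjoin_le : forall x y z, vle (vjoin x y) z <-> vle x z /\ vle y z;
  le_vmeet : forall x y z, vle z (vmeet x y) <-> vle z x /\ vle z y
}.

#[short(type="vectLatticeType")]
HB.structure Definition VectorLattice (R : numDomainType) :=
  {V of GRing.Lmodule R V & isVectorLattice R V}.

Arguments vle_trans {R s} y {x z}.
Arguments vle_anti {R s} {x y}.
Arguments vle_add2r {R s} z {x y}.
Arguments vle_scale {R s} {a x y}.
Arguments vle_refl {R s} x.

Definition vabs (R : numDomainType) (V : vectLatticeType R) (x : V) : V :=
  vjoin x (- x).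

HB.mixin Record VectorLattice_isNormed (R : numFieldType) V
    of NormedModule R V & VectorLattice R V := {
  vle_norm : forall x y : V, vle (vabs x) (vabs y) -> `|x| <= `|y|
}.

#[short(type="normedLatticeType")]
HB.structure Definition NormedLattice (R : numFieldType) :=
  {V of NormedModule R V & VectorLattice R V & VectorLattice_isNormed R V}.

#[short(type="banachLatticeType")]
HB.structure Definition BanachLattice (R : numFieldType) :=
  {V of CompleteNormedModule R V & NormedLattice R V}.

(* Not necessarily onto. *)
Definition isometric_lattice_isomorphism_into (R : numFieldType)
    (X Y : normedLatticeType R) (T : X -> Y) : Prop :=
  [/\ linear T,
      forall x, `|T x| = `|x|,
      {morph T : x y / vjoin x y} &
      {morph T : x y / vmeet x y}].

Section VectorLatticeTheory.
Variables (R : realFieldType) (V : vectLatticeType R).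
Implicit Types x y z : V.

Lemma vle_joinl x y : vle x (vjoin x y).
Proof. by have /vjoin_le[] := vle_refl (vjoin x y). Qed.

Lemma vle_joinr x y : vle y (vjoin x y).
Proof. by have /vjoin_le[] := vle_refl (vjoin x y). Qed.

Lemma vle_meetl x y : vle (vmeet x y) x.
Proof. by have /le_vmeet[] := vle_refl (vmeet x y). Qed.

Lemma vle_meetr x y : vle (vmeet x y) y.
Proof. by have /le_vmeet[] := vle_refl (vmeet x y). Qed.

Lemma vjoinC : commutative (@vjoin R V).
Proof.
by move=> x y; apply: vle_anti; apply/vjoin_le; split;
  [exact: vle_joinr|exact: vle_joinl|exact: vle_joinr|exact: vle_joinl].
Qed.

Lemma vmeetC : commutative (@vmeet R V).
Proof.
by move=> x y; apply: vle_anti; apply/le_vmeet; split;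
  [exact: vle_meetr|exact: vle_meetl|exact: vle_meetr|exact: vle_meetl].
Qed.

Lemma vjoinP x y z : vle x z -> vle y z -> vle (vjoin x y) z.
Proof. by move=> xz yz; apply/vjoin_le. Qed.

Lemma vmeetP x y z : vle z x -> vle z y -> vle z (vmeet x y).
Proof. by move=> xz yz; apply/le_vmeet. Qed.

Lemma vjoinA : associative (@vjoin R V).
Proof.
move=> x y z; apply: vle_anti.
- apply: vjoinP; last apply: vjoinP.
  + exact: (vle_trans _ (vle_joinl x y) (vle_joinl _ _)).
  + exact: (vle_trans _ (vle_joinr x y) (vle_joinl _ _)).
  + exact: vle_joinr.
- apply: vjoinP; first apply: vjoinP.
  + exact: vle_joinl.
  + exact: (vle_trans _ (vle_joinl y z) (vle_joinr _ _)).
  + exact: (vle_trans _ (vle_joinr y z) (vle_joinr _ _)).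
Qed.

Lemma vmeetA : associative (@vmeet R V).
Proof.
move=> x y z; apply: vle_anti.
- apply: vmeetP; first apply: vmeetP.
  + exact: vle_meetl.
  + exact: (vle_trans _ (vle_meetr _ _) (vle_meetl y z)).
  + exact: (vle_trans _ (vle_meetr _ _) (vle_meetr y z)).
- apply: vmeetP; last apply: vmeetP.
  + exact: (vle_trans _ (vle_meetl _ _) (vle_meetl x y)).
  + exact: (vle_trans _ (vle_meetl _ _) (vle_meetr x y)).
  + exact: vle_meetr.
Qed.

Lemma vjoinxx x : vjoin x x = x.
Proof. by apply: vle_anti; [apply: vjoinP; exact: vle_refl|exact: vle_joinl]. Qed.

Lemma vmeetxx x : vmeet x x = x.
Proof. by apply: vle_anti; [exact: vle_meetl|apply: vmeetP; exact: vle_refl]. Qed.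

Lemma vjoin_idPl x y : vle x y -> vjoin x y = y.
Proof.
by move=> xy; apply: vle_anti; [apply: vjoinP => //; exact: vle_refl|exact: vle_joinr].
Qed.

Lemma vmeet_idPl x y : vle x y -> vmeet x y = x.
Proof.
by move=> xy; apply: vle_anti; [exact: vle_meetl|apply: vmeetP => //; exact: vle_refl].
Qed.

Lemma vle_opp x y : vle x y -> vle (- y) (- x).
Proof. by move=> /(vle_add2r (- x - y)); rewrite addrA subrr sub0r addrCA subrr addr0. Qed.

Lemma vle_add x y x' y' : vle x y -> vle x' y' -> vle (x + x') (y + y').
Proof.
move=> xy xy'; apply: vle_trans _ (vle_add2r x' xy) _.
by rewrite ![y + _]addrC; exact: vle_add2r.
Qed.

Lemma vmeetE x y : vmeet x y = - vjoin (- x) (- y).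
Proof.
apply: vle_anti; last first.
  apply: vmeetP.
    by rewrite -[leRHS in vle _ leRHS]opprK; apply: vle_opp; exact: vle_joinl.
  by rewrite -[leRHS in vle _ leRHS]opprK; apply: vle_opp; exact: vle_joinr.
rewrite -[vmeet x y]opprK; apply: vle_opp; apply: vjoinP; apply: vle_opp.
  exact: vle_meetl.
exact: vle_meetr.
Qed.

Lemma vabs_ge0 x : vle 0 (vabs x).
Proof.
have h : vle 0 (vabs x + vabs x).
  by rewrite -[0 : V](subrr x); apply: vle_add; [exact: vle_joinl|exact: vle_joinr].
have h2 : (0 : R) <= 2^-1 by rewrite invr_ge0.
have := vle_scale h2 h.
rewrite scaler0 -[vabs x]scale1r -scalerDl scalerA.
by rewrite (_ : 2^-1 * (1 + 1) = 1 :> R) // mulVf // pnatr_eq0.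
Qed.

Lemma vabs_id x : vle 0 x -> vabs x = x.
Proof.
move=> x0; rewrite /vabs vjoinC; apply: vjoin_idPl.
by apply: (vle_trans 0) => //; have := vle_opp x0; rewrite oppr0.
Qed.

Lemma vabs_vabs x : vabs (vabs x) = vabs x.
Proof. by apply: vabs_id; exact: vabs_ge0. Qed.

Lemma vabsN x : vabs (- x) = vabs x.
Proof. by rewrite /vabs opprK vjoinC. Qed.

Lemma vabs0 : vabs (0 : V) = 0.
Proof. by rewrite vabs_id//; exact: vle_refl. Qed.

Lemma vabs_le x y : vle x y -> vle (- x) y -> vle (vabs x) y.
Proof. exact: vjoinP. Qed.

Lemma vabs_scale_le a x : 0 <= a -> vle (vabs (a *: x)) (a *: vabs x).
Proof.
by move=> a0; apply: vabs_le; rewrite -?scalerN; apply: vle_scale => //;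
  [exact: vle_joinl|exact: vle_joinr].
Qed.

Lemma vle_vabs_scale a x y : 0 < a ->
  vle (vabs x) (vabs y) -> vle (vabs (a *: x)) (vabs (a *: y)).
Proof.
move=> a0 xy; apply: (vle_trans _ (vabs_scale_le x (ltW a0))).
apply: (vle_trans _ (vle_scale (ltW a0) xy)).
have a'0 : 0 <= a^-1 by rewrite invr_ge0 ltW.
have aN0 : a != 0 by rewrite gt_eqF.
rewrite -[y in vle (a *: vabs y) _]scale1r -(mulVf aN0) -scalerA.
have := vle_scale (ltW a0) (vabs_scale_le (a *: y) a'0).
by rewrite [X in vle _ X]scalerA divff// scale1r.
Qed.

Lemma vjoin_birkhoff x y z : vle (vabs (vjoin x z - vjoin y z)) (vabs (x - y)).
Proof.
suff h a b : vle (vjoin a z - vjoin b z) (vabs (a - b)).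
  by apply: vabs_le => //; rewrite opprB -(vabsN (x - y)) opprB.
rewrite -(addrK (vjoin b z) (vabs (a - b))); apply: vle_add2r; apply: vjoinP.
  rewrite -[a in vle a _](subrK b); apply: vle_add; exact: vle_joinl.
by rewrite -[z in vle z _]add0r; apply: vle_add; [exact: vabs_ge0|exact: vle_joinr].
Qed.

End VectorLatticeTheory.

Record latticeSeminorm (R : realFieldType) (E : vectLatticeType R) :=
  LatticeSeminorm {
    lseminorm :> E -> R;
    lseminormD : forall x y, lseminorm (x + y) <= lseminorm x + lseminorm y;
    lseminormZ : forall a x, lseminorm (a *: x) = `|a| * lseminorm x;
    lseminorm_solid :
      forall x y, vle (vabs x) (vabs y) -> lseminorm x <= lseminorm y
  }.

Section LatticeSeminormTheory.
Variables (R : realFieldType) (E : vectLatticeType R) (p : latticeSeminorm E).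


Lemma lseminorm0 : p 0 = 0.
Proof. by rewrite -(scale0r (0 : E)) lseminormZ normr0 mul0r. Qed.

Lemma lseminormN x : p (- x) = p x.
Proof. by rewrite -scaleN1r lseminormZ normrN1 mul1r. Qed.

Lemma lseminormBC x y : p (x - y) = p (y - x).
Proof. by rewrite -opprB lseminormN. Qed.

Lemma lseminorm_ge0 x : 0 <= p x.
Proof.
have := lseminormD p x (- x); rewrite subrr lseminorm0 lseminormN.
by rewrite -mulr2n pmulrn_lge0.
Qed.

Lemma lseminorm_vabs x : p (vabs x) = p x.
Proof.
by apply/le_anti/andP; split; apply: lseminorm_solid;
  rewrite vabs_vabs; exact: vle_refl.
Qed.

Lemma lseminorm_join x y z : p (vjoin x z - vjoin y z) <= p (x - y).
Proof. by apply: lseminorm_solid; exact: vjoin_birkhoff. Qed.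

Lemma lseminorm_meet x y z : p (vmeet x z - vmeet y z) <= p (x - y).
Proof.
rewrite !vmeetE -opprD lseminormN (le_trans (lseminorm_join _ _ _))//.
by rewrite -opprD lseminormN.
Qed.

Definition lseminorm_ker : {pred E} := fun x => p x == 0.

Lemma lseminorm_ker_zmod_closed : zmod_closed lseminorm_ker.
Proof.
split=> [|x y]; first by rewrite unfold_in lseminorm0.
rewrite !unfold_in => /eqP x0 /eqP y0; rewrite eq_le lseminorm_ge0 andbT.
by rewrite (le_trans (lseminormD _ _ _))// lseminormN x0 y0 addr0.
Qed.

HB.instance Definition _ :=
  GRing.isZmodClosed.Build E lseminorm_ker lseminorm_ker_zmod_closed.

(* E / {x | p x = 0}, with the norm induced by p, the quotient order and the   *)
(* quotient lattice operations.                                               *)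
Definition seminorm_quot : Type := (Quotient.quot lseminorm_ker).
HB.instance Definition _ := GRing.Zmodule.on seminorm_quot.

Definition qpi (x : E) : seminorm_quot := \pi_(Quotient.quot lseminorm_ker) x.
Definition qrepr (x : seminorm_quot) : E := repr (x : (Quotient.quot lseminorm_ker)).

Lemma qreprK x : qpi (qrepr x) = x.
Proof. exact: reprK. Qed.

Lemma qpiP x y : qpi x = qpi y <-> p (x - y) = 0.
Proof.
have := Quotient.idealrBE lseminorm_ker x y.
rewrite unfold_in => h; split=> [/eqP|/eqP]; rewrite -?h; first by move=> /eqP.
by rewrite h => /eqP.
Qed.

Lemma qpiD x y : qpi (x + y) = qpi x + qpi y.
Proof. exact: (Quotient.pi_add lseminorm_ker). Qed.

Lemma qpiN x : qpi (- x) = - qpi x.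
Proof. exact: (Quotient.pi_opp lseminorm_ker). Qed.

Lemma qpi0 : qpi 0 = 0.
Proof. by rewrite -(subrr (0 : E)) qpiD qpiN subrr. Qed.

Lemma qpi_repr x : p (qrepr (qpi x) - x) = 0.
Proof. by apply/qpiP; rewrite qreprK. Qed.

Definition qscale (a : R) (x : seminorm_quot) := qpi (a *: qrepr x).

Lemma qpiZ a x : qpi (a *: x) = qscale a (qpi x).
Proof.
by apply/qpiP; rewrite -scalerBr lseminormZ lseminormBC qpi_repr mulr0.
Qed.

Lemma qscaleA a b x : qscale a (qscale b x) = qscale (a * b) x.
Proof. by rewrite -(qreprK x) -!qpiZ scalerA. Qed.

Lemma qscale1 : left_id 1 qscale.
Proof. by move=> x; rewrite -(qreprK x) -!qpiZ scale1r. Qed.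

Lemma qscaleDr : right_distributive qscale +%R.
Proof.
by move=> a x y; rewrite -(qreprK x) -(qreprK y) -qpiD -!qpiZ -qpiD scalerDr.
Qed.

Lemma qscaleDl x : {morph qscale^~ x : a b / a + b}.
Proof. by move=> a b; rewrite -(qreprK x) -!qpiZ -qpiD scalerDl. Qed.

HB.instance Definition _ := GRing.Zmodule_isLmodule.Build R seminorm_quot
  qscaleA qscale1 qscaleDr qscaleDl.

Lemma qpi_scale a x : qpi (a *: x) = a *: qpi x.
Proof. exact: qpiZ. Qed.

Definition qnorm (x : seminorm_quot) : R := p (qrepr x).

Lemma qnorm_pi x : qnorm (qpi x) = p x.
Proof.
apply/le_anti/andP; split.
  rewrite /qnorm -(subrK x (qrepr _)) (le_trans (lseminormD _ _ _))//.
  by rewrite qpi_repr add0r.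
rewrite -[in leLHS](subrK (qrepr (qpi x)) x) (le_trans (lseminormD _ _ _))//.
by rewrite lseminormBC qpi_repr add0r.
Qed.

Lemma qnormD x y : qnorm (x + y) <= qnorm x + qnorm y.
Proof.
by rewrite -(qreprK x) -(qreprK y) -qpiD !qnorm_pi; exact: lseminormD.
Qed.

Lemma qnormZ a x : qnorm (a *: x) = `|a| * qnorm x.
Proof. by rewrite -(qreprK x) -qpi_scale !qnorm_pi; exact: lseminormZ. Qed.

Lemma qnorm0_eq0 x : qnorm x = 0 -> x = 0.
Proof.
by rewrite -(qreprK x) qnorm_pi -qpi0 => px; apply/qpiP; rewrite subr0.
Qed.

HB.instance Definition _ := Lmodule_isNormed.Build R seminorm_quot
  qnormD qnormZ qnorm0_eq0.

Lemma norm_qpi x : `|qpi x| = p x.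
Proof. exact: qnorm_pi. Qed.

Definition qle (x y : seminorm_quot) : Prop :=
  exists u v, [/\ qpi u = x, qpi v = y & vle u v].
Definition qjoin (x y : seminorm_quot) := qpi (vjoin (qrepr x) (qrepr y)).
Definition qmeet (x y : seminorm_quot) := qpi (vmeet (qrepr x) (qrepr y)).

Lemma qpi_op (op : E -> E -> E) : commutative op ->
  (forall x y z, p (op x z - op y z) <= p (x - y)) ->
  forall x y, qpi (op x y) = qpi (op (qrepr (qpi x)) (qrepr (qpi y))).
Proof.
move=> opC opP x y; apply/qpiP/le_anti; rewrite lseminorm_ge0 andbT.
rewrite -(subrK (op (qrepr (qpi x)) y) (op x y)) -addrA.
rewrite (le_trans (lseminormD _ _ _))// -(addr0 0) lerD//.
  by rewrite (le_trans (opP _ _ _))// lseminormBC qpi_repr.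
by rewrite ![op (qrepr (qpi x)) _]opC (le_trans (opP _ _ _))// lseminormBC qpi_repr.
Qed.

Lemma qpi_join x y : qpi (vjoin x y) = qjoin (qpi x) (qpi y).
Proof. by apply: qpi_op; [exact: vjoinC|exact: lseminorm_join]. Qed.

Lemma qpi_meet x y : qpi (vmeet x y) = qmeet (qpi x) (qpi y).
Proof. by apply: qpi_op; [exact: vmeetC|exact: lseminorm_meet]. Qed.

Lemma qle_joinE x y : qle x y <-> qjoin x y = y.
Proof.
split=> [[u [v [<- <- uv]]]|<-]; first by rewrite -qpi_join vjoin_idPl.
exists (qrepr x), (vjoin (qrepr x) (qrepr y)); split=> //.
  exact: qreprK.
exact: vle_joinl.
Qed.

Lemma qle_meetE x y : qle x y <-> qmeet x y = x.
Proof.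
split=> [[u [v [<- <- uv]]]|<-]; first by rewrite -qpi_meet vmeet_idPl.
exists (vmeet (qrepr x) (qrepr y)), (qrepr y); split=> //.
  exact: qreprK.
exact: vle_meetr.
Qed.

Lemma qjoinC : commutative qjoin.
Proof. by move=> x y; rewrite /qjoin vjoinC. Qed.

Lemma qmeetC : commutative qmeet.
Proof. by move=> x y; rewrite /qmeet vmeetC. Qed.

Lemma qjoinA : associative qjoin.
Proof.
move=> x y z; rewrite -(qreprK x) -(qreprK y) -(qreprK z).
by rewrite -!qpi_join vjoinA.
Qed.

Lemma qmeetA : associative qmeet.
Proof.
move=> x y z; rewrite -(qreprK x) -(qreprK y) -(qreprK z).
by rewrite -!qpi_meet vmeetA.
Qed.

Lemma qjoinxx x : qjoin x x = x.
Proof. by rewrite /qjoin vjoinxx qreprK. Qed.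

Lemma qmeetxx x : qmeet x x = x.
Proof. by rewrite /qmeet vmeetxx qreprK. Qed.

Lemma qle_refl x : qle x x.
Proof. by apply/qle_joinE; exact: qjoinxx. Qed.

Lemma qle_anti x y : qle x y -> qle y x -> x = y.
Proof. by move=> /qle_joinE xy /qle_joinE <-; rewrite qjoinC. Qed.

Lemma qle_trans y x z : qle x y -> qle y z -> qle x z.
Proof.
move=> /qle_joinE xy /qle_joinE yz; apply/qle_joinE.
by rewrite -yz qjoinA xy.
Qed.

Lemma qle_add2r z x y : qle x y -> qle (x + z) (y + z).
Proof.
move=> [u [v [<- <- uv]]]; exists (u + qrepr z), (v + qrepr z).
by rewrite !qpiD qreprK; split=> //; exact: vle_add2r.
Qed.

Lemma qle_scale a x y : 0 <= a -> qle x y -> qle (a *: x) (a *: y).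
Proof.
move=> a0 [u [v [<- <- uv]]]; exists (a *: u), (a *: v).
by rewrite !qpi_scale; split=> //; exact: vle_scale.
Qed.

Lemma qjoin_le x y z : qle (qjoin x y) z <-> qle x z /\ qle y z.
Proof.
split=> [xyz|[/qle_joinE xz /qle_joinE yz]].
  split; apply: qle_trans xyz; apply/qle_joinE.
    by rewrite qjoinA qjoinxx.
  by rewrite qjoinC -qjoinA qjoinxx.
by apply/qle_joinE; rewrite -qjoinA yz xz.
Qed.

Lemma le_qmeet x y z : qle z (qmeet x y) <-> qle z x /\ qle z y.
Proof.
split=> [zxy|[/qle_meetE zx /qle_meetE zy]].
  split; apply: qle_trans zxy _; apply/qle_meetE.
    by rewrite qmeetC qmeetA qmeetxx.
  by rewrite -qmeetA qmeetxx.
by apply/qle_meetE; rewrite qmeetA zx zy.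
Qed.

HB.instance Definition _ := isVectorLattice.Build R seminorm_quot
  qle_refl qle_anti qle_trans qle_add2r qle_scale qjoin_le le_qmeet.

Lemma qpi_vabs x : qpi (vabs x) = vabs (qpi x).
Proof. by rewrite /vabs qpi_join qpiN. Qed.

Lemma qle_norm (x y : seminorm_quot) : vle (vabs x) (vabs y) -> `|x| <= `|y|.
Proof.
rewrite -(qreprK x) -(qreprK y) -!qpi_vabs => /qle_joinE.
set u := qrepr x; set v := qrepr y; rewrite -qpi_join => /(congr1 qnorm).
rewrite !qnorm_pi !norm_qpi (lseminorm_vabs v) => <-.
rewrite -(lseminorm_vabs u); apply: lseminorm_solid; rewrite vabs_vabs.
rewrite [vabs (vjoin _ _)]vabs_id; first exact: vle_joinl.
exact: (vle_trans _ (vabs_ge0 u) (vle_joinl _ _)).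
Qed.

HB.instance Definition _ := VectorLattice_isNormed.Build R seminorm_quot qle_norm.

End LatticeSeminormTheory.
Section Completion.
Variables (R : realType) (V : normedLatticeType R).

Definition cauchy_pred : {pred nat -> V} := fun u => `[< cauchy (u @ \oo) >].

Lemma cauchy_predP (u : nat -> V) :
  reflect (forall e : R, 0 < e -> exists N, forall m n,
             (N <= m)%N -> (N <= n)%N -> `|u m - u n| < e)
          (u \in cauchy_pred).
Proof.
apply: (iffP (asboolP _)) => [/cauchy_ballP uc e e0|uc].
  have [[A B] /= [[N1 _ AN] [N2 _ BN]] AB] := uc e e0.
  exists (maxn N1 N2) => m n; rewrite !geq_max => /andP[m1 _] /andP[_ n2].
  have := AB (u m, u n) (conj (AN m m1) (BN n n2)).
  by rewrite /= -ball_normE.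
apply/cauchy_ballP => e /uc[N uN].
exists ([set u n | n in [set n | (N <= n)%N]],
        [set u n | n in [set n | (N <= n)%N]]) => /=.
  by split; exists N => // n /= Nn; exists n.
by move=> [x y] /= [[m Nm <-] [n Nn <-]]; rewrite -ball_normE; exact: uN.
Qed.

Lemma cauchy_pred_submod_closed : submod_closed cauchy_pred.
Proof.
split=> [|a u v /cauchy_predP uc /cauchy_predP vc]; apply/cauchy_predP => e e0.
  by exists 0%N => m n _ _; rewrite subrr normr0.
have a0 : 0 < `|a| + 1 by rewrite ltr_wpDl.
have e2 : 0 < e / 2 by rewrite divr_gt0.
have [N1 uN] := uc (e / 2 / (`|a| + 1)) (divr_gt0 e2 a0).
have [N2 vN] := vc (e / 2) e2.
exists (maxn N1 N2) => m n; rewrite !geq_max => /andP[m1 m2] /andP[n1 n2].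
rewrite [X in `|X|](_ : _ = a *: (u m - u n) + (v m - v n)); last first.
  by rewrite !fctE scalerBr opprD addrACA.
rewrite (le_lt_trans (ler_normD _ _))// [ltRHS]splitr ler_ltD// ?vN//.
rewrite normrZ (@le_trans _ _ ((`|a| + 1) * `|u m - u n|))//.
  by rewrite ler_wpM2r// lerDl.
by rewrite mulrC -ler_pdivlMr// ltW// uN.
Qed.

HB.instance Definition _ :=
  GRing.isSubmodClosed.Build R (nat -> V) cauchy_pred cauchy_pred_submod_closed.

Record cauchySeq := CauchySeq {
  cauchySeq_val :> nat -> V;
  _ : cauchySeq_val \in cauchy_pred
}.

HB.instance Definition _ := [isSub for cauchySeq_val].
HB.instance Definition _ := [Choice of cauchySeq by <:].
HB.instance Definition _ := [SubChoice_isSubLmodule of cauchySeq by <:].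

Implicit Types u v w : cauchySeq.

Lemma cauchySeqP u : (u : nat -> V) \in cauchy_pred.
Proof. exact: valP. Qed.

Lemma cauchySeqD u v n : (u + v) n = u n + v n. Proof. by []. Qed.
Lemma cauchySeqN u n : (- u) n = - u n. Proof. by []. Qed.
Lemma cauchySeqZ a u n : (a *: u) n = a *: u n. Proof. by []. Qed.

Lemma cauchySeq_ext u v : u =1 v -> u = v.
Proof. by move=> uv; apply: val_inj; apply/funext. Qed.

Lemma norm_vjoinB (x y x' y' : V) :
  `|vjoin x y - vjoin x' y'| <= `|x - x'| + `|y - y'|.
Proof.
have h (a b c : V) : `|vjoin a c - vjoin b c| <= `|a - b|.
  by apply: vle_norm; exact: vjoin_birkhoff.
rewrite -(subrK (vjoin x' y) (vjoin x y)) -addrA.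
by rewrite (le_trans (ler_normD _ _))// lerD// ![vjoin x' _]vjoinC.
Qed.

Lemma cauchy_join u v : (fun n => vjoin (u n) (v n)) \in cauchy_pred.
Proof.
apply/cauchy_predP => e e0.
have e2 : 0 < e / 2 by rewrite divr_gt0.
have /cauchy_predP/(_ _ e2)[N1 uN] := cauchySeqP u.
have /cauchy_predP/(_ _ e2)[N2 vN] := cauchySeqP v.
exists (maxn N1 N2) => m n; rewrite !geq_max => /andP[m1 m2] /andP[n1 n2].
by rewrite (le_lt_trans (norm_vjoinB _ _ _ _))// [ltRHS]splitr ltrD ?uN ?vN.
Qed.

Definition cjoin u v := CauchySeq (cauchy_join u v).

Lemma cauchy_meet u v : (fun n => vmeet (u n) (v n)) \in cauchy_pred.
Proof.
rewrite (_ : (fun _ => _) = (- cjoin (- u) (- v) : cauchySeq)).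
  exact: cauchySeqP.
by apply/funext => n; rewrite cauchySeqN /= vmeetE.
Qed.

Definition cmeet u v := CauchySeq (cauchy_meet u v).

Definition cle u v : Prop := forall n, vle (u n) (v n).

Lemma cle_refl u : cle u u. Proof. by move=> n; exact: vle_refl. Qed.

Lemma cle_anti u v : cle u v -> cle v u -> u = v.
Proof. by move=> uv vu; apply: cauchySeq_ext => n; exact: vle_anti. Qed.

Lemma cle_trans v u w : cle u v -> cle v w -> cle u w.
Proof. by move=> uv vw n; exact: vle_trans (uv n) (vw n). Qed.

Lemma cle_add2r w u v : cle u v -> cle (u + w) (v + w).
Proof. by move=> uv n; rewrite !cauchySeqD; exact: vle_add2r. Qed.

Lemma cle_scale a u v : 0 <= a -> cle u v -> cle (a *: u) (a *: v).
Proof. by move=> a0 uv n; rewrite !cauchySeqZ; exact: vle_scale. Qed.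

Lemma cjoin_le u v w : cle (cjoin u v) w <-> cle u w /\ cle v w.
Proof.
split=> [h|[uw vw] n]; last exact: vjoinP.
by split=> n; have /vjoin_le[] := h n.
Qed.

Lemma le_cmeet u v w : cle w (cmeet u v) <-> cle w u /\ cle w v.
Proof.
split=> [h|[uw vw] n]; last exact: vmeetP.
by split=> n; have /le_vmeet[] := h n.
Qed.

HB.instance Definition _ := isVectorLattice.Build R cauchySeq
  cle_refl cle_anti cle_trans cle_add2r cle_scale cjoin_le le_cmeet.

Definition limnorm u : R := limn (fun n => `|u n|).

Lemma is_cvg_limnorm u : cvgn (fun n => `|u n|).
Proof.
apply: cauchy_cvg; apply/cauchy_ballP => e e0.
have /cauchy_predP/(_ _ e0)[N uN] := cauchySeqP u.
exists ([set `|u n| | n in [set n | (N <= n)%N]],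
        [set `|u n| | n in [set n | (N <= n)%N]]) => /=.
  by split; exists N => // n /= Nn; exists n.
move=> [x y] /= [[m Nm <-] [n Nn <-]]; rewrite -ball_normE /=.
by rewrite (le_lt_trans (ler_dist_dist _ _))// uN.
Qed.

Lemma limnormD u v : limnorm (u + v) <= limnorm u + limnorm v.
Proof.
rewrite /limnorm -limD; [|exact: is_cvg_limnorm..].
apply: ler_lim; first exact: is_cvg_limnorm.
  by apply: is_cvgD; exact: is_cvg_limnorm.
by near=> n; rewrite cauchySeqD; exact: ler_normD.
Unshelve. all: by end_near. Qed.

Lemma limnormZ a u : limnorm (a *: u) = `|a| * limnorm u.
Proof.
apply/cvg_lim => //.
rewrite (_ : (fun _ => _) = (fun n => `|a| * `|u n|)).
  by apply: cvgMl_tmp; exact: is_cvg_limnorm.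
by apply/funext => n; rewrite cauchySeqZ normrZ.
Qed.

Lemma limnorm_solid u v : vle (vabs u) (vabs v) -> limnorm u <= limnorm v.
Proof.
move=> uv; apply: ler_lim; [exact: is_cvg_limnorm..|].
by near=> n; apply: vle_norm; exact: (uv n).
Unshelve. all: by end_near. Qed.

Definition limnorm_seminorm : latticeSeminorm cauchySeq :=
  LatticeSeminorm limnormD limnormZ limnorm_solid.

(* Cauchy sequences modulo null sequences.                                    *)
(* The lattice operations extend the ones of V by continuity, and the order  *)
(* is the one whose positive cone is the closure of the positive cone of V.  *)
Definition completion : Type := seminorm_quot limnorm_seminorm.
HB.instance Definition _ := NormedLattice.on completion.

Lemma cauchy_cst (x : V) : (fun _ => x) \in cauchy_pred.
Proof. by apply/cauchy_predP => e e0; exists 0%N => *; rewrite subrr normr0. Qed.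

Definition completion_in (x : V) : completion :=
  qpi limnorm_seminorm (CauchySeq (cauchy_cst x)).

Lemma completion_in_isometric :
  isometric_lattice_isomorphism_into completion_in.
Proof.
split=> [a x y|x|x y|x y].
- by rewrite /completion_in -qpi_scale -qpiD; congr qpi; exact: cauchySeq_ext.
- by rewrite norm_qpi /= /limnorm /= lim_cst.
- rewrite /completion_in -[RHS]qpi_join; congr qpi; exact: cauchySeq_ext.
- rewrite /completion_in -[RHS]qpi_meet; congr qpi; exact: cauchySeq_ext.
Qed.

Lemma norm_completion_in x : `|completion_in x| = `|x|.
Proof. by have [_ ->] := completion_in_isometric. Qed.

Lemma completion_inB x y :
  completion_in (x - y) = completion_in x - completion_in y.
Proof.
have [lin _ _ _] := completion_in_isometric.
by rewrite addrC -scaleN1r lin scaleN1r addrC.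
Qed.

Lemma cvg_completion_in u :
  (fun n => completion_in (u n)) @ \oo --> qpi limnorm_seminorm u.
Proof.
apply/cvgrPdist_le => e e0.
have /cauchy_predP/(_ _ e0)[N uN] := cauchySeqP u.
exists N => // n /= Nn; rewrite -qpiN -qpiD norm_qpi.
apply: limr_le; first exact: is_cvg_limnorm.
by exists N => // m /= Nm; exact: ltW (uN m n Nm Nn).
Qed.

Lemma dense_completion_in (y : completion) (e : R) : 0 < e ->
  exists x, `|y - completion_in x| < e.
Proof.
move=> e0; rewrite -(qreprK y).
have /cvgrPdist_lt/(_ _ e0)[N _ /(_ N (leqnn N)) h] :=
  @cvg_completion_in (qrepr y).
by exists (qrepr y N).
Qed.

Lemma completion_complete (F : set_system completion) :
  ProperFilter F -> cauchy F -> cvg F.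
Proof.
move=> FF Fc.
have i0 n : 0 < n.+1%:R^-1 :> R by rewrite invr_gt0 ltr0n.
have /choice[x Fx] : forall n : nat, exists x, F (ball x (n.+1%:R^-1 : R)).
  by move=> n; move/cauchyP : Fc; exact.
have /choice[v xv] : forall n : nat, exists a : V, `|x n - completion_in a| < n.+1%:R^-1.
  by move=> n; exact: dense_completion_in.
have invS (e : R) : 0 < e ->
    exists N, forall n, (N <= n)%N -> n.+1%:R^-1 < e :> R.
  move=> e0; have [N _ h] := near_infty_natSinv_lt (PosNum e0).
  by exists N => n Nn; exact: (h n Nn).
have vc : v \in cauchy_pred.
  apply/cauchy_predP => e e0.
  have e4 : 0 < e / 2 / 2 by rewrite !divr_gt0.
  have [N Ne] := invS _ e4.
  exists N => m n Nm Nn.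
  have [z [/= zm zn]] := filter_ex (filterI (Fx m) (Fx n)).
  rewrite -norm_completion_in completion_inB.
  move: zm zn; rewrite -!ball_normE /= => zm zn.
  rewrite (le_lt_trans (ler_distD z _ _))// [ltRHS]splitr ltrD//.
    rewrite (le_lt_trans (ler_distD (x m) _ _))// [ltRHS]splitr ltrD//.
      by rewrite distrC (lt_trans (xv m))// Ne.
    by rewrite (lt_trans zm)// Ne.
  rewrite (le_lt_trans (ler_distD (x n) _ _))// [ltRHS]splitr ltrD//.
    by rewrite distrC (lt_trans zn)// Ne.
  by rewrite (lt_trans (xv n))// Ne.
apply/cvg_ex; exists (qpi limnorm_seminorm (CauchySeq vc)).
apply/cvgrPdist_lt => e e0.
have e2 : 0 < e / 2 by rewrite divr_gt0.
have e4 : 0 < e / 2 / 2 by rewrite divr_gt0.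
have [N Ne] := invS _ e4.
have /cvgrPdist_lt/(_ _ e2)[M _ vM] := @cvg_completion_in (CauchySeq vc).
pose n := maxn N M.
near=> t.
have : ball (x n) n.+1%:R^-1 t by near: t; exact: Fx.
rewrite -ball_normE /= => xt.
rewrite (le_lt_trans (ler_distD (completion_in (v n)) _ _))// [ltRHS]splitr ltrD//.
  by apply: (vM n); rewrite /= leq_maxr.
rewrite (le_lt_trans (ler_distD (x n) _ _))// [ltRHS]splitr ltrD//.
  by rewrite distrC (lt_trans (xv n))// Ne// leq_maxl.
by rewrite (lt_trans xt)// Ne// leq_maxl.
Unshelve. all: by end_near. Qed.

HB.instance Definition _ := Uniform_isComplete.Build completion completion_complete.

End Completion.

Section Gauge.
Variables (R : realType) (E : lmodType R).

Definition conv_hull (A : set (convex_lmodType E)) : set (convex_lmodType E) :=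
  smallest (@convex_set R E) A.

Definition gauge (A : set E) (x : E) : R :=
  inf [set r : R | 0 < r /\ exists2 y, A y & x = r *: y].

Lemma conv_hull_convex (A : set E) : convex_set (conv_hull A).
Proof.
move=> x y l; rewrite !inE => Ax Ay M [Mc AM]; apply: set_mem.
by apply: (Mc); apply: mem_set; [exact: (Ax M (conj Mc AM))|exact: (Ay M (conj Mc AM))].
Qed.

Lemma sub_conv_hull (A : set E) : A `<=` conv_hull A.
Proof. exact: sub_gen_smallest. Qed.

End Gauge.

Section GaugeLattice.
Variables (R : realType) (E : vectLatticeType R) (A : set E).
Hypothesis A_convex : forall x y (a b : R),
  A x -> A y -> 0 <= a -> 0 <= b -> a + b = 1 -> A (a *: x + b *: y).
Hypothesis A_solid : forall x y, vle (vabs x) (vabs y) -> A y -> A x.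
Hypothesis A_absorb : forall x, exists2 r : R, 0 < r & A (r *: x).

Let S (x : E) := [set r : R | 0 < r /\ exists2 y, A y & x = r *: y].

Let S_nonempty x : S x !=set0.
Proof.
have [r r0 Ar] := A_absorb x; exists r^-1; split; first by rewrite invr_gt0.
by exists (r *: x) => //; rewrite scalerA mulVf ?scale1r// gt_eqF.
Qed.

Let S_inf x : has_inf (S x).
Proof. by split=> //; exists 0 => r [/ltW]. Qed.

Let gaugeE x : gauge A x = inf (S x). Proof. by []. Qed.

Let gauge_le x r : S x r -> gauge A x <= r.
Proof. by move=> Sr; apply: ge_inf => //; case: (S_inf x). Qed.

Let le_gauge x c : (forall r, S x r -> c <= r) -> c <= gauge A x.
Proof. by move=> h; apply: (lb_le_inf (S_nonempty x)) => r /h. Qed.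

Let gauge_ge0 x : 0 <= gauge A x.
Proof. by apply: le_gauge => r [/ltW]. Qed.

Let gauge_D x y : gauge A (x + y) <= gauge A x + gauge A y.
Proof.
rewrite -lerBlDl; apply: le_gauge => s [s0 [v Av yv]].
rewrite lerBlDl -lerBlDr; apply: le_gauge => r [r0 [u Au xu]].
rewrite lerBlDr; apply: gauge_le; have rs0 : 0 < r + s by rewrite addr_gt0.
have rsN0 : r + s != 0 by rewrite gt_eqF.
split=> //; exists ((r / (r + s)) *: u + (s / (r + s)) *: v).
  apply: A_convex => //; [by rewrite divr_ge0// ltW..|].
  by rewrite -mulrDl divff.
rewrite scalerDr !scalerA mulrC divfK// [(r + s) * _]mulrC divfK//.
by rewrite xu yv.
Qed.

Let gauge_solid x y : vle (vabs x) (vabs y) -> gauge A x <= gauge A y.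
Proof.
move=> xy; apply: le_gauge => r [r0 [v Av yv]]; apply: gauge_le; split=> //.
have rN0 : r != 0 by rewrite gt_eqF.
exists (r^-1 *: x); last by rewrite scalerA divff// scale1r.
apply: A_solid Av.
have -> : v = r^-1 *: y by rewrite yv scalerA mulVf// scale1r.
by apply: vle_vabs_scale => //; rewrite invr_gt0.
Qed.

Let A0 : A 0.
Proof.
have [r _ Ar] := A_absorb 0; apply: A_solid Ar.
by rewrite vabs0; exact: vabs_ge0.
Qed.

Let gauge0 : gauge A 0 = 0.
Proof.
apply/le_anti; rewrite gauge_ge0 andbT; apply/ler_addgt0Pl => e e0.
rewrite addr0; apply: gauge_le; split=> //.
by exists 0 => //; rewrite scaler0.
Qed.

Let gauge_Zpos a x : 0 < a -> gauge A (a *: x) <= a * gauge A x.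
Proof.
move=> a0; rewrite -ler_pdivrMl//; apply: le_gauge => r [r0 [v Av ->]].
rewrite ler_pdivrMl//; apply: gauge_le; split; first by rewrite mulr_gt0.
by exists v => //; rewrite scalerA.
Qed.

Let gauge_abs x y : vabs x = vabs y -> gauge A x = gauge A y.
Proof.
by move=> xy; apply/le_anti; rewrite !gauge_solid ?xy//; exact: vle_refl.
Qed.

Let gauge_Z a x : gauge A (a *: x) = `|a| * gauge A x.
Proof.
have [->|aN0] := eqVneq a 0; first by rewrite scale0r normr0 mul0r gauge0.
have -> : gauge A (a *: x) = gauge A (`|a| *: x).
  apply: gauge_abs; have [a0|a0] := leP 0 a; first by rewrite ger0_norm.
  by rewrite ltr0_norm// scaleNr vabsN.
have a0 : 0 < `|a| by rewrite normr_gt0.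
apply/le_anti; rewrite gauge_Zpos//= -ler_pdivlMl//.
rewrite -[x in leLHS](scale1r x) -(mulVf (lt0r_neq0 a0)) -scalerA.
by rewrite gauge_Zpos// invr_gt0.
Qed.

Definition gauge_seminorm : latticeSeminorm E :=
  LatticeSeminorm gauge_D gauge_Z gauge_solid.

End GaugeLattice.

Section WeakL1.
Variable R : realType.
Implicit Types f g : R -> R.

Local Notation I01 := (`[0%R, 1%R]%classic : set R).

(* A function on [0,1] is represented by a function on the whole line whose   *)
(* values outside [0,1] are ignored by the quasinorm; measurable means Borel  *)
(* measurable, which is no loss up to a.e. equality.                          *)
Definition level_set f (c : R) : set R := I01 `&` [set t | c < `|f t|].

Definition weak_quasinorm f : \bar R :=
  ereal_sup [set (c%:E * lebesgue_measure (level_set f c))%E | c in [set c | 0 < c]].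

Definition weakL1_pred : {pred R -> R} := fun f =>
  `[< measurable_fun I01 f /\ (weak_quasinorm f < +oo)%E >].

Let mI : measurable (I01 : set R).
Proof. exact: measurable_itv. Qed.

Lemma measurable_level_set f c : measurable_fun I01 f -> measurable (level_set f c).
Proof.
move=> mf.
have mnf : measurable_fun I01 (fun t => `|f t|).
  exact: (measurableT_comp (@normr_measurable R setT) mf).
have /= := mnf mI _ (measurable_itv `]c, +oo[); rewrite /level_set.
congr measurable; congr setI; apply/seteqP; split=> t /=;
  by rewrite in_itv/= andbT.
Qed.

Lemma weak_quasinorm_ge f c : 0 < c ->
  (c%:E * lebesgue_measure (level_set f c) <= weak_quasinorm f)%E.
Proof. by move=> c0; apply: ereal_sup_ubound; exists c. Qed.

Lemma weak_quasinorm_le f (M : \bar R) :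
  (forall c, 0 < c -> (c%:E * lebesgue_measure (level_set f c) <= M)%E) ->
  (weak_quasinorm f <= M)%E.
Proof. by move=> h; apply: ge_ereal_sup => _ [c /= c0 <-]; exact: h. Qed.

Lemma weak_quasinorm_ge0 f : (0 <= weak_quasinorm f)%E.
Proof.
apply: le_trans (weak_quasinorm_ge f (@ltr01 R)).
by rewrite mul1e measure_ge0.
Qed.

Lemma weak_quasinorm_mono f g : measurable_fun I01 f -> measurable_fun I01 g ->
  (forall t, `|f t| <= `|g t|) -> (weak_quasinorm f <= weak_quasinorm g)%E.
Proof.
move=> mf mg fg; apply: weak_quasinorm_le => c c0.
apply: le_trans (weak_quasinorm_ge g c0).
apply: lee_wpmul2l; first by rewrite lee_fin ltW.
apply: le_measure;
  rewrite ?inE; [exact: measurable_level_set..|].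
by move=> t [It /= cf]; split=> //=; exact: lt_le_trans (fg t).
Qed.

Lemma weak_quasinormD f g : measurable_fun I01 f -> measurable_fun I01 g ->
  (weak_quasinorm (f + g)%R <= 2%:E * (weak_quasinorm f + weak_quasinorm g))%E.
Proof.
move=> mf mg; apply: weak_quasinorm_le => c c0.
have c20 : 0 < c / 2 by rewrite divr_gt0.
have sub : level_set (f + g) c `<=` level_set f (c / 2) `|` level_set g (c / 2).
  move=> t [It /= cfg]; have [cf|cf] := ltP (c / 2) `|f t|; first by left.
  right; split=> //=; rewrite ltNge; apply/negP => cg.
  move: cfg; rewrite ltNge => /negP; apply.
  by rewrite [leRHS]splitr (le_trans (ler_normD _ _))// lerD.
have mfg : measurable (level_set (f + g) c).
  by apply: measurable_level_set; exact: measurable_funD.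
have mtf := measurable_level_set (c / 2) mf; have mtg := measurable_level_set (c / 2) mg.
apply: (@le_trans _ _ (c%:E * (lebesgue_measure (level_set f (c / 2)) +
                               lebesgue_measure (level_set g (c / 2))))%E).
  apply: lee_wpmul2l; first by rewrite lee_fin ltW.
  apply: (@le_trans _ _ (lebesgue_measure (level_set f (c / 2) `|` level_set g (c / 2)))).
    by apply: le_measure; rewrite ?inE//; exact: measurableU.
  exact: measureU2.
have -> : c%:E = (2%:E * (c / 2)%:E)%E :> \bar R.
  by rewrite -EFinM mulrC divfK.
rewrite -muleA lee_wpmul2l ?lee_fin//.
rewrite ge0_muleDr ?measure_ge0//.
by apply: leeD; exact: weak_quasinorm_ge.
Qed.

Lemma weak_quasinormZ_le a f :
  (weak_quasinorm (a *: f)%R <= `|a|%R%:E * weak_quasinorm f)%E.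
Proof.
apply: weak_quasinorm_le => c c0; have [->|aN0] := eqVneq a 0.
  rewrite (_ : level_set _ _ = set0) ?measure0 ?mule0.
    by rewrite mule_ge0 ?lee_fin// weak_quasinorm_ge0.
  by apply/seteqP; split=> // t [_ /=]; rewrite scale0r normr0 ltNge ltW.
have a0 : 0 < `|a| by rewrite normr_gt0.
have -> : level_set (a *: f) c = level_set f (c / `|a|).
  rewrite /level_set; congr (_ `&` _); apply/seteqP; split=> t /=;
    by rewrite ltr_pdivrMr// mulrC -normrM.
have -> : c%:E = (`|a|%:E * (c / `|a|)%:E)%E :> \bar R.
  by rewrite -EFinM mulrC divfK// gt_eqF.
rewrite -muleA lee_wpmul2l ?lee_fin//.
by apply: weak_quasinorm_ge; rewrite divr_gt0.
Qed.

Lemma weakL1_predP f : reflect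
  (measurable_fun I01 f /\ (weak_quasinorm f < +oo)%E) (f \in weakL1_pred).
Proof. exact: asboolP. Qed.

Lemma weakL1_pred_submod_closed : submod_closed weakL1_pred.
Proof.
split=> [|a f g /weakL1_predP[mf qf] /weakL1_predP[mg qg]]; apply/weakL1_predP.
  split; first exact: measurable_cst.
  rewrite -(scale0r (0 : R -> R)) (le_lt_trans (weak_quasinormZ_le _ _))//.
  by rewrite normr0 mul0e.
have maf : measurable_fun I01 (a *: f).
  by apply: measurable_funM => //; exact: measurable_cst.
split; first exact: measurable_funD.
rewrite (le_lt_trans (weak_quasinormD maf mg))// lte_mul_pinfty//.
rewrite lte_add_pinfty// (le_lt_trans (weak_quasinormZ_le _ _))//.
by rewrite lte_mul_pinfty.
Qed.

HB.instance Definition _ :=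
  GRing.isSubmodClosed.Build R (R -> R) weakL1_pred weakL1_pred_submod_closed.

Record weakL1 := WeakL1 {
  weakL1_val :> R -> R;
  _ : weakL1_val \in weakL1_pred
}.

HB.instance Definition _ := [isSub for weakL1_val].
HB.instance Definition _ := [Choice of weakL1 by <:].
HB.instance Definition _ := [SubChoice_isSubLmodule of weakL1 by <:].

End WeakL1.

Section WeakL1Lattice.
Variable R : realType.
Implicit Types x y z : weakL1 R.
Local Notation I01 := (`[0%R, 1%R]%classic : set R).

Lemma weakL1P x : (x : R -> R) \in @weakL1_pred R.
Proof. exact: valP. Qed.

Lemma weakL1_measurable x : measurable_fun I01 x.
Proof. by have /weakL1_predP[] := weakL1P x. Qed.

Lemma weakL1_fin x : (weak_quasinorm x < +oo)%E.
Proof. by have /weakL1_predP[] := weakL1P x. Qed.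

Lemma weakL1_ext x y : x =1 y -> x = y.
Proof. by move=> xy; apply: val_inj; apply/funext. Qed.

Lemma weakL1_dom (f g h : R -> R) : g \in @weakL1_pred R ->
  h \in @weakL1_pred R -> measurable_fun I01 f ->
  (forall t, `|f t| <= `|g t| + `|h t|) -> f \in @weakL1_pred R.
Proof.
move=> /weakL1_predP[mg qg] /weakL1_predP[mh qh] mf fgh; apply/weakL1_predP.
split=> //.
have mn (k : R -> R) : measurable_fun I01 k -> measurable_fun I01 (fun t => `|k t|).
  by move=> mk; exact: (measurableT_comp (@normr_measurable R setT) mk).
have qn (k : R -> R) : weak_quasinorm (fun t => `|k t|) = weak_quasinorm k.
  congr ereal_sup; apply: eq_imagel => c _; congr (_ * _)%E.
  by congr lebesgue_measure; apply/seteqP; split=> t []; rewrite /level_set /= normr_id.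
rewrite (@le_lt_trans _ _ (weak_quasinorm ((fun t => `|g t|) + (fun t => `|h t|))))//.
  apply: weak_quasinorm_mono => //; first by apply: measurable_funD; exact: mn.
  by move=> t; rewrite !fctE [leRHS]ger0_norm// addr_ge0.
rewrite (le_lt_trans (weak_quasinormD (mn _ mg) (mn _ mh)))// !qn.
by rewrite lte_mul_pinfty// lte_add_pinfty.
Qed.

Lemma weakL1_join_subproof x y :
  (fun t => Num.max (x t) (y t)) \in @weakL1_pred R.
Proof.
apply: (weakL1_dom (weakL1P x) (weakL1P y)).
  by apply: measurable_maxr; exact: weakL1_measurable.
by move=> t; case: (leP (x t) (y t)) => _; rewrite ?lerDl ?lerDr.
Qed.

Lemma weakL1_meet_subproof x y :
  (fun t => Num.min (x t) (y t)) \in @weakL1_pred R.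
Proof.
apply: (weakL1_dom (weakL1P x) (weakL1P y)).
  by apply: measurable_minr; exact: weakL1_measurable.
by move=> t; case: (leP (x t) (y t)) => _; rewrite ?lerDl ?lerDr.
Qed.

Definition weakL1_le x y : Prop := forall t, x t <= y t.
Definition weakL1_join x y := WeakL1 (weakL1_join_subproof x y).
Definition weakL1_meet x y := WeakL1 (weakL1_meet_subproof x y).

Lemma weakL1_le_refl x : weakL1_le x x. Proof. by []. Qed.

Lemma weakL1_le_anti x y : weakL1_le x y -> weakL1_le y x -> x = y.
Proof.
by move=> xy yx; apply: weakL1_ext => t; apply/le_anti/andP; split;
  [exact: xy|exact: yx].
Qed.

Lemma weakL1_le_trans y x z : weakL1_le x y -> weakL1_le y z -> weakL1_le x z.
Proof. by move=> xy yz t; exact: le_trans (xy t) (yz t). Qed.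

Lemma weakL1_le_add2r z x y : weakL1_le x y -> weakL1_le (x + z) (y + z).
Proof. by move=> xy t; exact: lerD (xy t) (lexx _). Qed.

Lemma weakL1_le_scale (a : R) x y :
  0 <= a -> weakL1_le x y -> weakL1_le (a *: x) (a *: y).
Proof. by move=> a0 xy t; exact: (ler_wpM2l a0 (xy t)). Qed.

Lemma weakL1_join_le x y z :
  weakL1_le (weakL1_join x y) z <-> weakL1_le x z /\ weakL1_le y z.
Proof.
split=> [h|[xz yz] t]; last by rewrite /= ge_max; apply/andP; split.
by split=> t; have := h t; rewrite /= ge_max => /andP[].
Qed.

Lemma le_weakL1_meet x y z :
  weakL1_le z (weakL1_meet x y) <-> weakL1_le z x /\ weakL1_le z y.
Proof.
split=> [h|[xz yz] t]; last by rewrite /= le_min; apply/andP; split.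
by split=> t; have := h t; rewrite /= le_min => /andP[].
Qed.

HB.instance Definition _ := isVectorLattice.Build R (weakL1 R)
  weakL1_le_refl weakL1_le_anti weakL1_le_trans weakL1_le_add2r weakL1_le_scale
  weakL1_join_le le_weakL1_meet.

Lemma weakL1_absE x t : vabs x t = `|x t|.
Proof.
rewrite -[LHS]/(Num.max (x t) (- x t)); have [x0|/ltW x0] := leP 0 (x t).
  by rewrite ger0_norm//; apply: max_l; rewrite (le_trans _ x0)// oppr_le0.
by rewrite ler0_norm//; apply: max_r; rewrite (le_trans x0)// oppr_ge0.
Qed.

Definition weakL1_unit_ball : set (weakL1 R) :=
  [set x | (weak_quasinorm x <= 1)%E].

(* Functions are not identified a.e. at this stage: rho vanishes on those that *)
(* are a.e. zero on [0,1] (rho_ae0), so the quotient by the kernel of rho makes *)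
(* the identification (normed_envelope_ae).                                    *)
Definition rho : weakL1 R -> R := gauge (conv_hull weakL1_unit_ball).

Lemma inv_measurable : measurable_fun setT (@GRing.inv R).
Proof.
rewrite -(setUv [set 0]); have m0 : measurable [set (0 : R)] by exact: measurable_set1.
apply/measurable_funU => //; first exact: measurableC.
split; first exact: measurable_fun_set1.
apply: subspace_continuous_measurable_fun; first exact: measurableC.
apply: continuous_in_subspaceT => t; rewrite inE/= => t0.
by apply: inv_continuous; apply/eqP.
Qed.

Section Multiplication.
Variable h : R -> R.
Hypotheses (mh : measurable_fun I01 h) (h1 : forall t, `|h t| <= 1).

Lemma weakL1_mul_subproof x : (fun t => h t * x t) \in @weakL1_pred R.
Proof.
apply: (weakL1_dom (weakL1P x) (weakL1P x)).
  by apply: measurable_funM => //; exact: weakL1_measurable.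
by move=> t; rewrite normrM (le_trans (ler_piMl _ (h1 t)))// lerDl.
Qed.

Definition weakL1_mul x := WeakL1 (weakL1_mul_subproof x).

Lemma hull_weakL1_mul x :
  conv_hull weakL1_unit_ball x -> conv_hull weakL1_unit_ball (weakL1_mul x).
Proof.
move=> /(_ [set y | conv_hull weakL1_unit_ball (weakL1_mul y)]); apply; split.
  move=> u v l; rewrite !inE/= => hu hv.
  have := @conv_hull_convex _ _ weakL1_unit_ball _ _ l (mem_set hu) (mem_set hv).
  rewrite inE; congr (conv_hull _ _); apply: weakL1_ext => t.
  rewrite /= -[LHS]/(_ * (h t * u t) + _ * (h t * v t)).
  by rewrite -[RHS]/(h t * (_ * u t + _ * v t)) mulrDr; congr (_ + _);
    rewrite mulrCA.
move=> y qy; apply: sub_conv_hull; apply: le_trans qy.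
apply: weak_quasinorm_mono; [exact: weakL1_measurable..|].
by move=> t /=; rewrite normrM ler_piMl.
Qed.

End Multiplication.

Lemma hull_solid x y : vle (vabs x) (vabs y) ->
  conv_hull weakL1_unit_ball y -> conv_hull weakL1_unit_ball x.
Proof.
move=> xy hy.
have xy' t : `|x t| <= `|y t| by have := xy t; rewrite !weakL1_absE.
have mh : measurable_fun I01 (fun t => x t * (y t)^-1).
  apply: measurable_funM; first exact: weakL1_measurable.
  exact: (measurableT_comp inv_measurable (weakL1_measurable y)).
have h1 t : `|x t * (y t)^-1| <= 1.
  have [y0|yN0] := eqVneq (y t) 0; first by rewrite y0 invr0 mulr0 normr0.
  by rewrite normrM normfV ler_pdivrMr ?normr_gt0// mul1r.
have := hull_weakL1_mul mh h1 hy; congr (conv_hull _ _); apply: weakL1_ext => t /=.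
have [y0|yN0] := eqVneq (y t) 0; last by rewrite divfK.
by have := xy' t; rewrite y0 normr0 normr_le0 => /eqP ->; rewrite !mul0r.
Qed.

Lemma hull_convex x y (a b : R) :
  conv_hull weakL1_unit_ball x -> conv_hull weakL1_unit_ball y ->
  0 <= a -> 0 <= b -> a + b = 1 -> conv_hull weakL1_unit_ball (a *: x + b *: y).
Proof.
move=> hx hy a0 b0 ab; have a1 : a <= 1 by rewrite -ab lerDl.
have := @conv_hull_convex _ _ weakL1_unit_ball _ _ (Itv01 a0 a1)
  (mem_set hx) (mem_set hy).
rewrite inE; congr (conv_hull _ _); apply: weakL1_ext => t /=.
rewrite -[LHS]/(a * x t + (1 - a) * y t) -[RHS]/(a * x t + b * y t).
by rewrite -ab addrAC subrr add0r.
Qed.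

Lemma hull_absorb x : exists2 r : R, 0 < r & conv_hull weakL1_unit_ball (r *: x).
Proof.
have q0 := weak_quasinorm_ge0 x.
have qfin : weak_quasinorm x \is a fin_num by rewrite ge0_fin_numE// weakL1_fin.
have : weak_quasinorm x = (fine (weak_quasinorm x))%:E by rewrite fineK.
have : 0 <= fine (weak_quasinorm x) by exact: fine_ge0.
move: (fine _) => q q_ge0 qE; have q1 : 0 < q + 1 by rewrite ltr_wpDl.
exists (q + 1)^-1; first by rewrite invr_gt0.
apply: sub_conv_hull; rewrite /weakL1_unit_ball /=.
apply: (le_trans (weak_quasinormZ_le _ _)); rewrite qE -EFinM.
rewrite -[1%E]/(1%:E) lee_fin ger0_norm ?invr_ge0 ?(ltW q1)//.
by rewrite mulrC ler_pdivrMr// mul1r lerDl.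
Qed.

Definition rho_seminorm : latticeSeminorm (weakL1 R) :=
  gauge_seminorm hull_convex hull_solid hull_absorb.

Lemma rho_seminormE x : rho_seminorm x = rho x.
Proof. by []. Qed.

Lemma rho_ae0 x :
  {ae lebesgue_measure, forall t, I01 t -> x t = 0} -> rho x = 0.
Proof.
move=> x0; apply/le_anti/andP; split; last exact: (lseminorm_ge0 rho_seminorm).
apply/ler_addgt0Pl => e e0; rewrite addr0; apply: ge_inf.
  by exists 0 => r [/ltW].
split=> //; have eN0 : e != 0 by rewrite gt_eqF.
exists (e^-1 *: x); last by rewrite scalerA divff// scale1r.
apply: sub_conv_hull; rewrite /weakL1_unit_ball /=.
apply: (le_trans (weak_quasinormZ_le _ _)).
suff -> : weak_quasinorm x = 0%E by rewrite mule0 lee01.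
apply/le_anti; rewrite weak_quasinorm_ge0 andbT.
apply: weak_quasinorm_le => c c0.
rewrite measure_negligible ?mule0//.
  by apply: measurable_level_set; exact: weakL1_measurable.
apply: negligibleS x0 => t [It /= ct] xt.
by move: ct; rewrite xt// normr0 ltNge ltW.
Qed.

End WeakL1Lattice.

Definition normed_envelope (R : realType) : Type := seminorm_quot (rho_seminorm R).
HB.instance Definition _ (R : realType) := NormedLattice.on (normed_envelope R).

Lemma normed_envelope_ae (R : realType) (x y : weakL1 R) :
  {ae lebesgue_measure, forall t, `[0%R, 1%R]%classic t -> x t = y t} ->
  qpi (rho_seminorm R) x = qpi (rho_seminorm R) y.
Proof.
move=> xy; apply/qpiP; rewrite rho_seminormE; apply: rho_ae0.
apply: negligibleS xy => t /= h; apply: contra_not h => xy /xy e.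
by apply/eqP; rewrite subr_eq0 e.
Qed.

Definition banach_envelope (R : realType) : Type := completion (normed_envelope R).
HB.instance Definition _ (R : realType) := BanachLattice.on (banach_envelope R).

(* Main.v *)
Require Import Defs.
From mathcomp Require Import all_boot all_order all_algebra.
From mathcomp Require Import all_classical all_reals all_analysis measurable_realfun.
From mathcomp Require Import ring lra.

(* Cwikel and Fefferman's formula expresses rho through the averages of |f| over
   the windows p < |f| <= M p in logarithmic scale: with H_M = 1 + ... + 1/M in
   place of ln M, rho f is the limit for M -> oo of the supremum over p of
     (int_(p < |f| <= M p) |f|) / H_M.
   The upper estimate is the averaging argument of rho_le_levsum, the lower one
   holds on the unit ball and passes to its convex hull (rho_lt_cut).

   Enumerate all windows n < |f| <= m n and map f to the sequence of the functions
   f 1_(n < |f| <= m n) / H_m of L1. Up to terms that vanish as m -> oo this is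
   linear and preserves the lattice operations, and rho f is the upper limit of
   the L1 norms for m -> oo. Conversely, a sequence of bounded L1 functions v_k
   can be packed into a single weak L1 function: v_k is placed on a tiny interval
   after having been spread harmonically, so that the quasinorm of the k-th block
   is the L1 norm of v_k, and the blocks have such different heights that they do
   not interact. Windows of a given level m are spread over a bounded range
   only, hence have no influence on rho. The composition is an isometric
   lattice isomorphism T of W into itself. If (f_n) is a Cauchy sequence in W,
   then T f_n converges in W: its limit is obtained by packing the windows of
   level m of f_(n(m)), where n(m) tends to infinity slowly. Therefore T extends
   to the completion. *)

Set Implicit Arguments.
Unset Strict Implicit.
Unset Printing Implicit Defensive.
Import Order.TTheory GRing.Theory Num.Theory.
Import numFieldNormedType.Exports.
Local Open Scope classical_set_scope.
Local Open Scope ring_scope.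

(** * Level sets and the L1 norm on [0,1] *)

Section UnitInterval.
Variable R : realType.
Implicit Types (f g : R -> R) (A : set R) (c eta : R).
Local Notation I01 := (`[0%R, 1%R]%classic : set R).
Local Notation mu := (@lebesgue_measure R).

Lemma measurable_I01 : measurable I01.
Proof. exact: measurable_itv. Qed.

Lemma measurable_capI01 A : measurable A -> measurable (A `&` I01).
Proof. by move=> mA; exact: (measurableI _ _ mA measurable_I01). Qed.

Lemma lebesgue_measure_I01 : mu I01 = 1%E.
Proof. by rewrite lebesgue_measure_itv/= lte_fin ltr01 oppr0 adde0. Qed.

Lemma lebesgue_measure_subI01 A :
  measurable A -> A `<=` I01 -> (mu A <= 1)%E.
Proof.
move=> mA AI; rewrite -lebesgue_measure_I01.
by apply: le_measure; rewrite ?inE//; exact: measurable_I01.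
Qed.

(** Intersecting with [0,1] keeps the measure finite, so that all estimates of level sets take place
    in [R]. *)
Definition vol A : R := fine (mu (A `&` I01)).

Lemma volE A : measurable A -> mu (A `&` I01) = (vol A)%:E.
Proof.
move=> mA; have mAI := measurableI _ _ mA measurable_I01.
rewrite fineK// ge0_fin_numE ?measure_ge0//.
by apply: le_lt_trans (lebesgue_measure_subI01 mAI _) (ltry 1) => t [].
Qed.

Lemma vol_ge0 A : 0 <= vol A.
Proof. by apply: fine_ge0; exact: measure_ge0. Qed.

Lemma le_vol A B : measurable A -> measurable B -> A `&` I01 `<=` B ->
  vol A <= vol B.
Proof.
move=> mA mB AB; rewrite -lee_fin -!volE//; apply: le_measure.
- by rewrite inE; apply: measurableI => //; exact: measurable_I01.
- by rewrite inE; apply: measurableI => //; exact: measurable_I01.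
- by move=> t [At It]; split => //; exact: AB.
Qed.

Lemma vol_le1 A : measurable A -> vol A <= 1.
Proof.
move=> mA; rewrite -lee_fin -volE//; apply: lebesgue_measure_subI01.
  by apply: measurableI => //; exact: measurable_I01.
by move=> t [].
Qed.

Lemma vol0 : vol set0 = 0.
Proof. by rewrite /vol set0I measure0. Qed.

Lemma sum_vol n (F : nat -> set R) : (forall i, measurable (F i)) ->
  (\sum_(i < n) vol (F i))%:E = (\sum_(i < n) mu (F i `&` I01))%E.
Proof. by move=> mF; rewrite -sumEFin; apply: eq_bigr => i _; rewrite volE. Qed.

Lemma vol_bigsetU_le n (F : nat -> set R) : (forall i, measurable (F i)) ->
  vol (\big[setU/set0]_(i < n) F i) <= \sum_(i < n) vol (F i).
Proof.
move=> mF; rewrite -lee_fin -volE; last exact: bigsetU_measurable.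
rewrite sum_vol// big_distrl/=.
apply: (Boole_inequality mu (A := fun i => F i `&` I01)) => i _.
exact: (measurableI _ _ (mF i) measurable_I01).
Qed.

Lemma vol_bigsetU n (F : nat -> set R) : (forall i, measurable (F i)) ->
  trivIset setT F ->
  vol (\big[setU/set0]_(i < n) F i) = \sum_(i < n) vol (F i).
Proof.
move=> mF tF; apply: EFin_inj; rewrite -volE; last exact: bigsetU_measurable.
rewrite sum_vol// big_distrl/=.
apply: (measure_bigsetU mu (F := fun i => F i `&` I01)).
  by move=> i; exact: (measurableI _ _ (mF i) measurable_I01).
move=> i j _ _ [t [[Fi _] [Fj _]]]; apply: (tF i j) => //.
by exists t.
Qed.

(** The distribution function of [|f|] on [0,1]. *)
Definition lev f c : R := vol (level_set f c).

Lemma levE f c : measurable_fun I01 f -> mu (level_set f c) = (lev f c)%:E.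
Proof.
move=> mf; rewrite -volE ?setIidl//; last exact: measurable_level_set.
by move=> t [].
Qed.

Lemma lev_ge0 f c : 0 <= lev f c. Proof. exact: vol_ge0. Qed.

Lemma lev_le1 f c : measurable_fun I01 f -> lev f c <= 1.
Proof. by move=> mf; apply: vol_le1; exact: measurable_level_set. Qed.

Lemma le_lev f g c d : measurable_fun I01 f -> measurable_fun I01 g ->
  (forall t, I01 t -> c < `|f t| -> d < `|g t|) -> lev f c <= lev g d.
Proof.
move=> mf mg fg; apply: le_vol; [exact: measurable_level_set..|].
by move=> t [[It /= /(fg _ It)]]; split.
Qed.

Lemma lev_eq0 f c : (forall t, I01 t -> `|f t| <= c) -> lev f c = 0.
Proof.
move=> fc; rewrite /lev (_ : level_set f c = set0) ?vol0//.
by apply/seteqP; split=> // t [/fc/= It]; rewrite ltNge It.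
Qed.

Lemma weak_quasinorm_lev f (s : R) : measurable_fun I01 f ->
  (weak_quasinorm f <= s%:E)%E <-> (forall c, 0 < c -> c * lev f c <= s).
Proof.
move=> mf; split=> [fs c c0|fs].
  rewrite -lee_fin EFinM -levE//; apply: le_trans fs.
  exact: weak_quasinorm_ge.
by apply: weak_quasinorm_le => c c0; rewrite levE// -EFinM lee_fin fs.
Qed.

(** Bounded measurable functions have a finite integral over [0,1], so [fine] loses nothing in
    [L1n]; truncations of weak L1 functions are of this kind. *)
Definition bounded_meas f := measurable_fun I01 f /\ exists B, forall t, `|f t| <= B.

Definition L1n f : R := fine (\int[mu]_(t in I01) (`|f t|)%:E).

Lemma measurable_abs f : measurable_fun I01 f ->
  measurable_fun I01 (fun t => (`|f t|)%:E).
Proof.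
move=> mf; apply/measurable_EFinP.
exact: (measurableT_comp (@normr_measurable R setT) mf).
Qed.

Lemma L1nE f : bounded_meas f ->
  (\int[mu]_(t in I01) (`|f t|)%:E = (L1n f)%:E)%E.
Proof.
move=> [mf [B fB]]; rewrite fineK// ge0_fin_numE; last exact: integral_ge0.
apply: (@le_lt_trans _ _ (B%:E * mu I01)%E); last first.
  by rewrite lebesgue_measure_I01 mule1 ltry.
rewrite (_ : integral _ _ _ = (\int[mu]_(t in I01) `|(fun t => (`|f t|)%:E) t|)%E);
  last by apply: eq_integral => t _ /=; rewrite normr_id.
apply: integral_le_bound.
- exact: measurable_I01.
- exact: measurable_abs.
- by rewrite lee_fin (le_trans _ (fB 0)).
- by apply/aeW => t _; rewrite /= normr_id lee_fin.
Qed.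

Lemma L1n_ge0 f : 0 <= L1n f.
Proof. by apply: fine_ge0; exact: integral_ge0. Qed.

Lemma L1n_sum n (c : 'I_n -> R) (g : 'I_n -> R -> R) :
  (forall i, 0 <= c i) -> (forall i, bounded_meas (g i)) ->
  (\int[mu]_(t in I01) (\sum_(i < n) c i * `|g i t|)%:E =
   (\sum_(i < n) c i * L1n (g i))%:E)%E.
Proof.
move=> c0 mg.
under eq_integral => t _ do rewrite -sumEFin.
rewrite ge0_integral_sum; last first.
- by move=> i t _; rewrite lee_fin mulr_ge0.
- move=> i; apply/measurable_EFinP/measurable_funM => //.
  exact: (measurableT_comp (@normr_measurable R setT) (mg i).1).
- exact: measurable_I01.
rewrite -sumEFin; apply: eq_bigr => i _.
under eq_integral => t _ do rewrite EFinM.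
rewrite (ge0_integralZl_EFin mu measurable_I01)//; first by rewrite L1nE.
by apply: measurable_abs; exact: (mg i).1.
Qed.

Lemma measurable_sum_abs n (c : 'I_n -> R) (g : 'I_n -> R -> R) :
  (forall i, bounded_meas (g i)) ->
  measurable_fun I01 (fun t => (\sum_(i < n) c i * `|g i t|)%:E).
Proof.
move=> mg; apply/measurable_EFinP.
rewrite (_ : (fun t => _) = (fun t => \sum_(i <- enum 'I_n) c i * `|g i t|)); last first.
  by apply/funext => t; rewrite big_enum.
apply: measurable_sum => i; apply: measurable_funM => //.
exact: (measurableT_comp (@normr_measurable R setT) (mg i).1).
Qed.

(** With indicators of level sets for the [g i], this turns a pointwise staircase bound into a bound
    by values of the distribution function. *)
Lemma L1n_le_sum f n (c : 'I_n -> R) (g : 'I_n -> R -> R) : bounded_meas f ->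
  (forall i, 0 <= c i) -> (forall i, bounded_meas (g i)) ->
  (forall t, I01 t -> `|f t| <= \sum_(i < n) c i * `|g i t|) ->
  L1n f <= \sum_(i < n) c i * L1n (g i).
Proof.
move=> mf c0 mg fg; rewrite -lee_fin -L1nE// -L1n_sum//.
apply: ge0_le_integral => //.
- by apply: measurable_abs; exact: mf.1.
- exact: measurable_sum_abs.
Qed.

Lemma L1n_ge_sum f n (c : 'I_n -> R) (g : 'I_n -> R -> R) : bounded_meas f ->
  (forall i, 0 <= c i) -> (forall i, bounded_meas (g i)) ->
  (forall t, I01 t -> \sum_(i < n) c i * `|g i t| <= `|f t|) ->
  \sum_(i < n) c i * L1n (g i) <= L1n f.
Proof.
move=> mf c0 mg fg; rewrite -lee_fin -L1nE// -L1n_sum//.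
apply: ge0_le_integral => //.
- by move=> t _; rewrite lee_fin sumr_ge0// => i _; rewrite mulr_ge0.
- exact: measurable_sum_abs.
- by apply: measurable_abs; exact: mf.1.
Qed.

Lemma L1n_le2 f (a b : R) g h : bounded_meas f -> 0 <= a -> 0 <= b ->
  bounded_meas g -> bounded_meas h ->
  (forall t, I01 t -> `|f t| <= a * `|g t| + b * `|h t|) ->
  L1n f <= a * L1n g + b * L1n h.
Proof.
move=> mf a0 b0 mg mh fgh.
have := @L1n_le_sum f 2 (fun i => if i == ord0 then a else b)
  (fun i => if i == ord0 then g else h) mf.
rewrite !big_ord_recl !big_ord0/= !addr0; apply.
- by move=> i; case: ifP.
- by move=> i; case: ifP.
- by move=> t It; rewrite !big_ord_recl !big_ord0/= !addr0; exact: fgh.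
Qed.

Lemma L1n_le3 (f : R -> R) (a b c : R) g h l : bounded_meas f ->
  0 <= a -> 0 <= b -> 0 <= c ->
  bounded_meas g -> bounded_meas h -> bounded_meas l ->
  (forall t, I01 t -> `|f t| <= a * `|g t| + b * `|h t| + c * `|l t|) ->
  L1n f <= a * L1n g + b * L1n h + c * L1n l.
Proof.
move=> mf a0 b0 c0 mg mh ml fgh.
have := @L1n_le_sum f 3 (fun i => nth 0 [:: a; b; c] i)
  (fun i => nth g [:: g; h; l] i) mf.
rewrite !big_ord_recl !big_ord0/= !addr0 !addrA; apply.
- by case=> [[|[|[|]]]].
- by case=> [[|[|[|]]]].
- by move=> t It; rewrite !big_ord_recl !big_ord0/= !addr0 !addrA; exact: fgh.
Qed.

Lemma L1n_leZ f (a : R) g : bounded_meas f -> 0 <= a -> bounded_meas g ->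
  (forall t, I01 t -> `|f t| <= a * `|g t|) -> L1n f <= a * L1n g.
Proof.
move=> mf a0 mg fg.
have := @L1n_le2 f a 0 g g mf a0 (lexx _) mg mg.
by rewrite mul0r addr0; apply => t It; rewrite mul0r addr0; exact: fg.
Qed.

Lemma bounded_meas_indic A : measurable A -> bounded_meas (\1_A).
Proof.
move=> mA; split.
  exact: measurable_indic.
by exists 1 => t; rewrite indicE; case: (_ \in _); rewrite ?normr1 ?normr0.
Qed.

Lemma L1n_indic A : measurable A -> L1n (\1_A) = vol A.
Proof.
move=> mA; apply: EFin_inj; rewrite -L1nE; last exact: bounded_meas_indic.
rewrite -volE// -(integral_indic mu measurable_I01 mA).
apply: eq_integral => t _.
by rewrite indicE; case: (_ \in _); rewrite ?normr1 ?normr0.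
Qed.

Lemma indic_level_set f c t : I01 t ->
  `|\1_(level_set f c) t| = (c < `|f t|)%R%:R :> R.
Proof.
move=> It; rewrite indicE; case: (boolP (_ < _)) => ct.
  by rewrite mem_set ?normr1.
by rewrite memNset ?normr0// => -[_ /=]; apply/negP.
Qed.

Lemma L1n_indic_level_set f c : measurable_fun I01 f ->
  L1n (\1_(level_set f c)) = lev f c.
Proof. by move=> mf; rewrite L1n_indic//; exact: measurable_level_set. Qed.

End UnitInterval.
(** * Level sums and the seminorm rho *)

Section Harmonic.
Variable R : realType.

Definition harm n : R := \sum_(i < n) (i.+1%:R)^-1.

Lemma harmS n : harm n.+1 = harm n + n.+1%:R^-1.
Proof. by rewrite /harm big_ord_recr. Qed.

Lemma harm1 : harm 1 = 1.
Proof. by rewrite harmS /harm big_ord0 add0r invr1. Qed.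

Lemma le_harm m n : (m <= n)%N -> harm m <= harm n.
Proof.
move=> /subnKC <-; elim: (n - m)%N => [|k ih]; first by rewrite addn0.
by rewrite addnS harmS (le_trans ih)// lerDl.
Qed.

Lemma harm_ge0 n : 0 <= harm n.
Proof. by rewrite /harm sumr_ge0. Qed.

Lemma harm_ge1 n : (0 < n)%N -> 1 <= harm n.
Proof. by move=> n0; rewrite -harm1 le_harm. Qed.

Lemma harm_gt0 n : (0 < n)%N -> 0 < harm n.
Proof. by move=> /harm_ge1; exact: lt_le_trans. Qed.

(** Replaces the additivity of the logarithm. Each of the [a] terms that follow the first [a * b.+1]
    is at most [1 / (a * b.+1)], so a block of [a] terms adds at most [1 / b.+1]. *)
Lemma harm_mul a b : (0 < a)%N ->
  harm (a * b.+1) <= harm a + harm b.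
Proof.
move=> a0; elim: b => [|b ih]; first by rewrite muln1 lerDl harm_ge0.
rewrite (harmS b) addrA.
suff h k : (k <= a)%N ->
    harm (a * b.+1 + k) <= harm (a * b.+1) + k%:R / (a%:R * b.+1%:R).
  rewrite mulnS addnC (le_trans (h _ (leqnn _)))// lerD//.
  by rewrite invfM mulrA divff ?mul1r// pnatr_eq0 -lt0n.
elim: k => [|k ihk] ka; first by rewrite addn0 mul0r addr0.
rewrite addnS harmS -[k.+1%:R]natr1 mulrDl mul1r addrA lerD ?ihk ?(ltnW ka)//.
by rewrite lef_pV2 ?posrE -?natrM ?ltr0n ?muln_gt0 ?a0// ler_nat -addnS leq_addr.
Qed.

Lemma harm_mul_le a b : (0 < a)%N -> harm (a * b) <= harm a + harm b.
Proof.
move=> a0; case: b => [|b].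
  by rewrite muln0 {1}/harm big_ord0 addr_ge0 ?harm_ge0.
by rewrite (le_trans (harm_mul _ a0))// lerD2l le_harm.
Qed.

Lemma harm_unbounded (x : R) : exists2 n, (0 < n)%N & x <= harm n.
Proof.
apply: contrapT => h; apply: (@dvg_harmonic R).
apply: nondecreasing_is_cvgn.
  apply/nondecreasing_seqP => n; rewrite !seriesEnat/= big_nat_recr//= lerDl.
  exact: harmonic_ge0.
exists x => _ [n _ <-]; rewrite seriesEnat/= big_mkord.
have -> : \sum_(i < n) harmonic i = harm n by [].
rewrite leNgt; apply/negP => xn; apply: h; exists n.+1 => //.
by rewrite (le_trans (ltW xn))// le_harm.
Qed.

End Harmonic.

(** * Staircase approximation and level sums *)

Section Staircase.
Variable R : realType.
Implicit Types x eta : R.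

(** A discrete layer-cake formula: [eta] times the number of the multiples [eta, ..., M eta] that
    lie below [x]. Integrated over [0,1] with [x = |f t|] it becomes [levsum f M eta]. *)
Definition stair x eta M : R := \sum_(i < M) eta * (i.+1%:R * eta < x)%R%:R.

Lemma stairS x eta M :
  stair x eta M.+1 = stair x eta M + eta * (M.+1%:R * eta < x)%R%:R.
Proof. by rewrite /stair big_ord_recr. Qed.

Lemma stair_le x eta M : 0 <= x -> 0 < eta ->
  stair x eta M <= Num.min x (M%:R * eta).
Proof.
move=> x0 e0; elim: M => [|M ih].
  by rewrite /stair big_ord0 mul0r le_min x0 lexx.
rewrite stairS; case: (boolP (_ < _)) => h; last first.
  rewrite mulr0 addr0 (le_trans ih)// le_min ge_min lexx/= ge_min.
  by rewrite ler_wpM2r ?orbT ?ler_nat// ltW.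
rewrite (min_idPr (ltW h)) mulr1 -natr1 mulrDl mul1r lerD2r (le_trans ih)//.
by rewrite ge_min lexx orbT.
Qed.

Lemma stair_eq0 x eta M : 0 < eta -> x <= eta -> stair x eta M = 0.
Proof.
move=> e0 xe; rewrite /stair big1// => i _; case: (ltP _ _) => h; last by rewrite mulr0.
have := lt_le_trans h xe; rewrite -[ltRHS]mul1r ltr_pM2r//.
by rewrite -[1]/(1%:R) ltr_nat.
Qed.

(** Rounding down loses at most one step, and only where [x] is positive; hence the error in
    [L1n_le_levsum] involves only the support of the function. *)
Lemma le_stair x eta M : 0 <= x -> 0 < eta ->
  Num.min x (M.+1%:R * eta) <= eta * (0 < x)%R%:R + stair x eta M.
Proof.
move=> x0 e0; elim: M => [|M ih].
  rewrite /stair big_ord0 addr0 mul1r; move: x0; rewrite le_eqVlt => /predU1P[<-|x0].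
    by rewrite ltxx mulr0 ge_min lexx.
  by rewrite x0 mulr1 ge_min lexx orbT.
rewrite stairS addrA; case: (ltP (_ * _) x) => h; last first.
  rewrite mulr0 addr0 (le_trans _ ih)// le_min ge_min lexx/=.
  by rewrite ge_min h.
rewrite mulr1 -natr1 mulrDl mul1r (le_trans _ (lerD ih (lexx _)))//.
by rewrite (min_idPr (ltW h)) ge_min lexx orbT.
Qed.

End Staircase.

Section LevelSums.
Variable R : realType.
Implicit Types (f g : R -> R) (A : set R) (c eta : R).
Local Notation I01 := (`[0%R, 1%R]%classic : set R).

(** A Riemann sum for the integral of the distribution function from 0 to [M eta], that is, for the
    integral of [min(|f|, M eta)]. It ignores the values up to [eta] and so measures the window from
    [eta] to [M eta]. *)
Definition levsum f M eta : R := \sum_(i < M) eta * lev f (i.+1%:R * eta).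

Definition cut f q A (t : R) : R := \1_A t * Num.min `|f t| q.

Lemma cut_ge0 f q A t : 0 <= q -> 0 <= cut f q A t.
Proof. by move=> q0; rewrite mulr_ge0// ?indicE// le_min normr_ge0. Qed.

Lemma bounded_meas_cut f q A : measurable_fun I01 f -> measurable A -> 0 <= q ->
  bounded_meas (cut f q A).
Proof.
move=> mf mA q0; split.
  apply: measurable_funM; first exact: measurable_indic.
  apply: measurable_minr => //.
  exact: (measurableT_comp (@normr_measurable R setT) mf).
exists q => t; rewrite ger0_norm ?cut_ge0// /cut indicE.
by case: (_ \in _); rewrite ?mul1r ?mul0r// ge_min lexx orbT.
Qed.

Lemma levsum_stair f g M eta : measurable_fun I01 f -> bounded_meas g ->
  0 < eta -> (forall t, I01 t -> stair `|f t| eta M <= `|g t|) ->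
  levsum f M eta <= L1n g.
Proof.
move=> mf mg e0 fg; rewrite /levsum.
under eq_bigr => i _ do rewrite -L1n_indic_level_set//.
apply: L1n_ge_sum => //.
- by move=> i; exact: ltW.
- by move=> i; apply: bounded_meas_indic; exact: measurable_level_set.
- move=> t It; apply: le_trans (fg t It); rewrite /stair.
  by under eq_bigr => i _ do rewrite indic_level_set//.
Qed.

Lemma levsum_le_L1n f M eta : bounded_meas f -> 0 < eta -> levsum f M eta <= L1n f.
Proof.
move=> mf e0; apply: levsum_stair => //; first exact: mf.1.
by move=> t It; rewrite (le_trans (stair_le _ _ _))// ge_min lexx.
Qed.

Lemma levsum_le_cut f M eta : measurable_fun I01 f -> 0 < eta ->
  levsum f M eta <= L1n (cut f (M%:R * eta) (level_set f eta)).
Proof.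
move=> mf e0; have M0 : 0 <= M%:R * eta by rewrite mulr_ge0// ltW.
have mA := measurable_level_set eta mf.
apply: levsum_stair => //; first exact: bounded_meas_cut.
move=> t It; rewrite [leRHS]ger0_norm ?cut_ge0// /cut indicE.
have [fe|fe] := leP `|f t| eta; first by rewrite stair_eq0// mulr_ge0// le_min normr_ge0.
by rewrite mem_set ?mul1r ?stair_le.
Qed.

Lemma L1n_le_levsum u M eta : bounded_meas u -> 0 < eta ->
  (forall t, `|u t| <= M.+1%:R * eta) -> L1n u <= eta * lev u 0 + levsum u M eta.
Proof.
move=> mu e0 uM.
have mui : measurable_fun I01 u by case: mu.
have := @L1n_le_sum R u M.+1 (fun=> eta)
  (fun i => \1_(level_set u (i%:R * eta))) mu.
rewrite big_ord_recl/= mul0r L1n_indic_level_set// /levsum.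
under eq_bigr => i _ do rewrite L1n_indic_level_set//.
apply; first by move=> _; exact: ltW.
  by move=> i; apply: bounded_meas_indic; exact: measurable_level_set.
move=> t It; rewrite big_ord_recl/= mul0r indic_level_set//.
have := le_stair M (normr_ge0 (u t)) e0; rewrite (min_idPl (uM t)) => h.
apply: (le_trans h); rewrite lerD2l /stair.
by under [leRHS]eq_bigr => i _ do rewrite indic_level_set//.
Qed.

End LevelSums.

(** * Lower estimate of rho: logarithmic growth on the convex hull *)

Section HullEstimate.
Variable R : realType.
Implicit Types (x y : weakL1 R) (A : set R).
Local Notation I01 := (`[0%R, 1%R]%classic : set R).

(* [harm M] plays the role of the logarithm of the ratio [M] of the endpoints of
   [p, M p]; on the unit ball the bound is the integral of [min (1/lambda, M p)].
   Letting [D] come first makes the property stable under convex combinations,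
   which only change the ratio by a bounded factor. *)
Definition log_growth y : Prop := forall D : R, exists C : R,
  forall A (p : R) M, measurable A -> 0 < p -> p * vol A <= D -> (0 < M)%N ->
    L1n (cut y (M%:R * p) A) <= harm R M + C.

(** The bottom step costs [p * vol A <= D]. The step at height [i p] has mass
    [p * lev y (i p) <= 1 / i], and these add up to [harm M]. *)
Lemma log_growth_unit_ball y : weakL1_unit_ball y -> log_growth y.
Proof.
move=> qy D; exists D => A p M mA p0 pA M0.
have my := weakL1_measurable y.
have hl : forall c, 0 < c -> c * lev y c <= 1 by apply/weak_quasinorm_lev.
have Mp0 : 0 <= M%:R * p by rewrite mulr_ge0// ltW.
have := @L1n_le_sum R (cut y (M%:R * p) A) M.+1 (fun=> p)
  (fun i => if i == ord0 then \1_A else \1_(level_set y (i%:R * p)))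
  (bounded_meas_cut my mA Mp0).
rewrite big_ord_recl/= L1n_indic//.
under eq_bigr => i _ do rewrite L1n_indic_level_set//.
move=> h; apply: (le_trans (h _ _ _)) => {h}.
- by move=> _; exact: ltW.
- move=> i; case: ifP => _; first exact: bounded_meas_indic.
  by apply: bounded_meas_indic; exact: measurable_level_set.
- move=> t It; rewrite big_ord_recl/= ger0_norm ?cut_ge0// /cut indicE.
  case: (_ \in A); last first.
    rewrite mul0r normr0 mulr0 add0r sumr_ge0// => i _.
    by rewrite mulr_ge0// ltW.
  rewrite mul1r normr1.
  have := le_stair M (normr_ge0 (y t)) p0.
  under [X in _ -> _ <= _ + X]eq_bigr => i _ do rewrite indic_level_set//.
  move=> h; apply: le_trans (le_trans h _).
    rewrite le_min ge_min lexx/= ge_min ler_wpM2r ?orbT ?ler_nat//.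
    exact: ltW.
  by rewrite lerD2r ler_wpM2l ?(ltW p0)//; case: (0 < _).
rewrite addrC lerD// /harm; apply: ler_sum => i _.
have i0 : (0 : R) < i.+1%:R by rewrite ltr0n.
have := hl (i.+1%:R * p) (mulr_gt0 i0 p0).
rewrite -mulrA [in leRHS]/=  => h.
by rewrite -[leRHS]mulr1 mulrC ler_pdivlMl// mulrC.
Qed.

(** If [a K >= 1] and [b L >= 1], then [min(a |u| + b |v|, M p)] is at most
    [a min(|u|, K M p) + b min(|v|, L M p)]. Enlarging the ratio from [M] to [K M] costs only the
    constant [harm K]. Zero weights are treated apart because [K] and [L] bound the inverses of the
    weights. *)
Lemma log_growth_convex u v (a b : R) : log_growth u -> log_growth v ->
  0 <= a -> 0 <= b -> a + b = 1 -> log_growth (a *: u + b *: v).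
Proof.
move=> hu hv; rewrite le_eqVlt => /predU1P[<- _|a0].
  by rewrite add0r => ->; rewrite scale0r add0r scale1r.
rewrite le_eqVlt => /predU1P[<-|b0].
  by rewrite addr0 => ->; rewrite scale0r addr0 scale1r.
move=> ab D.
have [Cu hCu] := hu D; have [Cv hCv] := hv D.
have bnd (c : R) : 0 < c -> exists2 K, (0 < K)%N & c^-1 <= K%:R.
  move=> c0; exists (Num.truncn c^-1).+1 => //.
  by rewrite ltW// truncnS_gt.
have [K K0 aK] := bnd a a0; have [L L0 bL] := bnd b b0.
exists (harm R K + harm R L + `|Cu| + `|Cv|) => A p M mA p0 pA M0.
have mq N : 0 <= N%:R * p by rewrite mulr_ge0// ltW.
have mw (z : weakL1 R) : measurable_fun I01 z := @weakL1_measurable R z.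
have h := @L1n_le2 R (cut (a *: u + b *: v) (M%:R * p) A) a b
  (cut u ((K * M)%:R * p) A) (cut v ((L * M)%:R * p) A)
  (bounded_meas_cut (mw _) mA (mq _)) (ltW a0) (ltW b0)
  (bounded_meas_cut (mw _) mA (mq _)) (bounded_meas_cut (mw _) mA (mq _)).
apply: (le_trans (h _)) => {h}.
  move=> t It; rewrite !ger0_norm ?cut_ge0// /cut.
  rewrite mulrCA [b * _]mulrCA -mulrDr ler_wpM2l ?indicE//.
  rewrite !minr_pMr ?(ltW a0) ?(ltW b0)//.
  have aM : M%:R * p <= a * ((K * M)%:R * p).
    rewrite natrM !mulrA ler_wpM2r ?(ltW p0)// ler_peMl//.
    by rewrite -ler_pdivrMl// mulr1.
  have bM : M%:R * p <= b * ((L * M)%:R * p).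
    rewrite natrM !mulrA ler_wpM2r ?(ltW p0)// ler_peMl//.
    by rewrite -ler_pdivrMl// mulr1.
  have nf : `|(a *: u + b *: v : weakL1 R) t| <= a * `|u t| + b * `|v t|.
    rewrite -[X in `|X|]/(a * u t + b * v t) (le_trans (ler_normD _ _))//.
    by rewrite !normrM (gtr0_norm a0) (gtr0_norm b0).
  have au0 : 0 <= a * `|u t| by rewrite mulr_ge0// ltW.
  have bv0 : 0 <= b * `|v t| by rewrite mulr_ge0// ltW.
  move: aM bM nf (mq M) au0 bv0; set x := `|_| ; set y := a * `|_|; set z := b * `|_|.
  set q := M%:R * p; set q1 := a * _; set q2 := b * _.
  by move=> *; rewrite /Num.min; do !case: ifP; lra.
have hK := hCu A p (K * M)%N mA p0 pA (ltac:(by rewrite muln_gt0 K0)).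
have hL := hCv A p (L * M)%N mA p0 pA (ltac:(by rewrite muln_gt0 L0)).
have HK := harm_mul_le R M K0; have HL := harm_mul_le R M L0.
have Cu1 := ler_norm Cu; have Cv1 := ler_norm Cv.
have hu0 := harm_ge0 R K; have hv0 := harm_ge0 R L.
have Cu0 := normr_ge0 Cu; have Cv0 := normr_ge0 Cv.
have U : a * L1n (cut u ((K * M)%:R * p) A) <= a * (harm R M) + (harm R K + `|Cu|).
  apply: (@le_trans _ _ (a * (harm R M + (harm R K + `|Cu|)))).
    by rewrite ler_wpM2l ?(ltW a0)//; lra.
  by rewrite mulrDr lerD2l ler_piMl//; lra.
have V : b * L1n (cut v ((L * M)%:R * p) A) <= b * (harm R M) + (harm R L + `|Cv|).
  apply: (@le_trans _ _ (b * (harm R M + (harm R L + `|Cv|)))).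
    by rewrite ler_wpM2l ?(ltW b0)//; lra.
  by rewrite mulrDr lerD2l ler_piMl//; lra.
have E : a * harm R M + b * harm R M = harm R M by rewrite -mulrDl ab mul1r.
lra.
Qed.

Lemma log_growth_hull y : conv_hull (@weakL1_unit_ball R) y -> log_growth y.
Proof.
move=> /(_ log_growth); apply; split; last exact: log_growth_unit_ball.
move=> u v l; rewrite !inE => hu hv.
have l0 : 0 <= l%:num by [].
have l1 : 0 <= 1 - l%:num by rewrite subr_ge0.
exact: (log_growth_convex hu hv l0 l1 (subrKC _ _)).
Qed.

Lemma weak_bound y : exists2 q : R, 0 <= q & forall c, 0 < c -> c * lev y c <= q.
Proof.
have q0 := weak_quasinorm_ge0 y; have qf := weakL1_fin y.
exists (fine (weak_quasinorm y)); first exact: fine_ge0.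
apply/weak_quasinorm_lev; first exact: weakL1_measurable.
by rewrite fineK// ge0_fin_numE.
Qed.

(** By definition of the gauge [y = s z] with [s < r] and [z] in the hull, so the growth bound of
    [z], scaled by [s], holds for [y]. *)
Lemma rho_lt_cut y (r : R) : rho y < r ->
  exists2 C, 0 <= C & forall (p : R) M, 0 < p -> (0 < M)%N ->
    L1n (cut y (M%:R * p) (level_set y p)) <= r * harm R M + C.
Proof.
move=> yr; have my := weakL1_measurable y.
have : exists2 s : R, s < r & 0 < s /\ exists2 z, conv_hull (@weakL1_unit_ball R) z & y = s *: z.
  have := inf_lt _ yr; case; last by move=> s h sr; exists s.
  have [s s0 hs] := hull_absorb y; exists s^-1; split; first by rewrite invr_gt0.
  by exists (s *: y) => //; rewrite scalerA mulVf ?scale1r// gt_eqF.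
move=> [s sr [s0 [z /log_growth_hull hz yz]]].
have [q q0 hq] := weak_bound y.
(* The set used below is the level set of [y] at [p], for which [p * lev y p <= q]; after division
   by [s] this is the constraint with [D = q / s]. *)
have [C hC] := hz (q / s); exists (`|s * C|) => // p M p0 M0.
have mA := measurable_level_set p my.
have ps : 0 < p / s by rewrite divr_gt0.
have h := hC (level_set y p) (p / s) M mA ps.
have Mp0 : 0 <= M%:R * p by rewrite mulr_ge0// ltW.
have Mps0 : 0 <= M%:R * (p / s) by rewrite mulr_ge0// ltW.
have mz := weakL1_measurable z.
apply: (@le_trans _ _ (s * L1n (cut z (M%:R * (p / s)) (level_set y p)))).
  apply: L1n_leZ; [exact: bounded_meas_cut|exact: ltW|exact: bounded_meas_cut|].
  move=> t It; rewrite !ger0_norm ?cut_ge0// /cut mulrCA ler_wpM2l ?indicE//.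
  rewrite minr_pMr ?(ltW s0)// {1}yz -[X in `|X|]/(s * z t) normrM (gtr0_norm s0).
  by rewrite mulrCA [s * (p / s)]mulrC divfK// gt_eqF.
apply: (@le_trans _ _ (s * (harm R M + C))).
  rewrite ler_wpM2l ?(ltW s0)// h// mulrAC ler_wpM2r ?invr_ge0 ?(ltW s0)//.
  exact: hq.
rewrite mulrDr lerD ?ler_norm// ler_wpM2r ?harm_ge0//; exact: ltW.
Qed.

End HullEstimate.

(** * Equidistributed splittings of [0,1] *)

Section Splitting.
Variable R : realType.
Implicit Types (f : R -> R) (A B : set R).
Local Notation I01 := (`[0%R, 1%R]%classic : set R).
Local Notation mu := (@lebesgue_measure R).

Lemma volU A B : measurable A -> measurable B -> A `&` B = set0 ->
  vol (A `|` B) = vol A + vol B.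
Proof.
move=> mA mB AB; apply: EFin_inj; rewrite EFinD -!volE//; last exact: measurableU.
rewrite setIUl measureU//.
- exact: (measurable_capI01 mA).
- exact: (measurable_capI01 mB).
- by rewrite setIACA AB set0I.
Qed.

Lemma volD A B : measurable A -> measurable B -> B `<=` A ->
  vol (A `\` B) = vol A - vol B.
Proof.
move=> mA mB BA; have := volU mB (measurableD mA mB).
rewrite setDE setICA setICr setI0 -setDE => /(_ erefl).
by rewrite setDUK// => -> ; rewrite addrC addKr.
Qed.

Lemma vol_itvoc (s t : R) : s <= t -> vol `]s, t]%classic <= t - s.
Proof.
move=> st; have mst : measurable (`]s, t]%classic : set R) by exact: measurable_itv.
rewrite -lee_fin -volE//.
apply: (@le_trans _ _ (mu `]s, t]%classic)).
  apply: le_measure; rewrite ?inE//; first exact: (measurable_capI01 mst).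
rewrite lebesgue_measure_itv/= lte_fin; case: ifP => _; first by rewrite -EFinB.
by rewrite lee_fin subr_ge0.
Qed.

(** The volume of the part of [A] up to [t] is a Lipschitz function of [t], so the intermediate
    value theorem yields the point at which to cut. *)
Lemma intermediate_vol A (x : R) : measurable A -> 0 <= x <= vol A ->
  exists B, [/\ measurable B, B `<=` A & vol B = x].
Proof.
move=> mA /andP[x0 xA]; pose g t := vol (A `&` `]-oo, t]%classic).
have mg t : measurable (A `&` `]-oo, t]%classic).
  by apply: measurableI => //; exact: measurable_itv.
have gE s t : s <= t -> g t = g s + vol (A `&` `]s, t]%classic).
  move=> st; rewrite -volU//.
  - congr vol; rewrite -setIUr; congr (_ `&` _); apply/seteqP; split => r /=;
      rewrite !in_itv/=.
      by move=> rt; case: (leP r s) => rs; [left|right; rewrite rt].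
    by case=> [rs|/andP[]//]; exact: le_trans st.
  - by apply: measurableI => //; exact: measurable_itv.
  - apply/seteqP; split => // r [[_ /=]]; rewrite !in_itv/= => rs [_].
    by rewrite ltNge rs.
have g_lip s t : `|g t - g s| <= `|t - s|.
  wlog st : s t / s <= t.
    move=> h; have [st|/ltW ts] := leP s t; first exact: h.
    by rewrite distrC [leRHS]distrC; exact: h.
  rewrite (gE _ _ st) addrC addKr ger0_norm ?vol_ge0// ger0_norm ?subr_ge0//.
  apply: le_trans (vol_itvoc st); apply: le_vol.
  - by apply: measurableI => //; exact: measurable_itv.
  - exact: measurable_itv.
  - by move=> r [[]].
have gc : {within `[(-1)%R, 1%R], continuous g}.
  apply: continuous_subspaceT => t; apply/cvgrPdist_le => e e0.
  near=> s; apply: (le_trans (g_lip _ _)).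
  by near: s; exact: cvgr_dist_le.
have gN1 : g (-1) = 0.
  apply/eqP; rewrite eq_le vol_ge0 andbT -(vol0 R); apply: le_vol => //.
  move=> r [[_]]; rewrite /= !in_itv/= => r1 /andP[r0 _].
  by have := le_trans r0 r1; rewrite ler0N1.
have g1 : g 1 = vol A.
  apply/eqP; rewrite eq_le !le_vol//.
    by move=> r [Ar]; rewrite /= !in_itv/= => /andP[].
  by move=> r [[]].
have [||c _ gcx] := @IVT R g (-1) 1 x _ gc.
- by lra.
- by rewrite gN1 g1 ge_min x0 le_max xA orbT.
by exists (A `&` `]-oo, c]%classic); split => // r [].
Unshelve. all: by end_near. Qed.

(** Induction on [N]: split off a set of the right volume, label it 0, and shift the labels found on
    the remainder by one. *)
Lemma equal_labels N A : measurable A -> exists l : R -> nat,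
  [/\ forall t, (l t <= N)%N, forall i, measurable [set t | l t = i] &
      forall i, (i <= N)%N -> vol (A `&` [set t | l t = i]) = vol A / N.+1%:R].
Proof.
elim: N A => [|N ih] A mA.
  exists (fun=> 0%N); split=> // i.
    case: i => [|i].
      by rewrite (_ : [set _ | _] = setT)//; apply/seteqP; split.
    by rewrite (_ : [set _ | _] = set0)//; apply/seteqP; split.
  rewrite leqn0 => /eqP ->; rewrite divr1 (_ : [set _ | _] = setT) ?setIT//.
  by apply/seteqP; split.
have N0 : (0 : R) < N.+2%:R by rewrite ltr0n.
have [|B [mB BA vB]] := @intermediate_vol A (vol A / N.+2%:R) mA.
  rewrite divr_ge0 ?vol_ge0//= ler_pdivrMr// ler_peMr ?vol_ge0//.
  by rewrite -[1]/(1%:R) ler_nat.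
have [l [lN ml vl]] := ih _ (measurableD mA mB).
exists (fun t => if `[< B t >] then 0%N else (l t).+1); split.
- by move=> t; case: ifP => // _; rewrite ltnS.
- case=> [|i].
    rewrite (_ : [set _ | _] = B)//; apply/seteqP; split => t /=.
      by case: ifP => // /asboolP.
    by move=> Bt; rewrite asboolT.
  rewrite (_ : [set _ | _] = [set t | l t = i] `\` B).
    exact: measurableD.
  apply/seteqP; split => t /=.
    by case: ifP => // /asboolP Bt [].
  by move=> [-> Bt]; rewrite asboolF.
- case=> [_|i iN].
    rewrite -vB; congr vol; apply/seteqP; split => t /=.
      by case; case: ifP => // /asboolP.
    by move=> Bt; rewrite asboolT//; split => //; exact: BA.
  rewrite (_ : _ `&` _ = (A `\` B) `&` [set t | l t = i]); last first.
    apply/seteqP; split => t /=.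
      by case; case: ifP => // /asboolP Bt At [].
    by move=> [[At Bt] ->]; rewrite asboolF.
  rewrite vl// volD// vB.
  rewrite -[X in X - _](@mulfK _ N.+2%:R) ?gt_eqF// -mulrBl -{2}[vol A]mulr1.
  by rewrite -mulrBr -[N.+2%:R]natr1 addrK mulrAC mulfK.
Qed.

(* The labels are equidistributed on each band [expR (k a) < |f| <= expR ((k + 1) a)],
   hence on all level sets of [f] up to the factor [expR a]. *)
Lemma spread_labels f N (a : R) : measurable_fun I01 f -> 0 < a ->
  exists l : R -> nat,
  [/\ forall t, (l t <= N)%N, forall i, measurable (I01 `&` [set t | l t = i]) &
      forall i (c : R), (i <= N)%N -> 0 < c ->
        vol (level_set f c `&` [set t | l t = i]) <= lev f (c / expR a) / N.+1%:R].
Proof.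
move=> mf a0.
pose E (k : int) := level_set f (expR (k%:~R * a)) `\` level_set f (expR ((k + 1)%:~R * a)).
have mE k : measurable (E k) by apply: measurableD; exact: measurable_level_set.
have /choice[l hl] k : exists l : R -> nat,
  [/\ forall t, (l t <= N)%N, forall i, measurable [set t | l t = i] &
      forall i, (i <= N)%N -> vol (E k `&` [set t | l t = i]) = vol (E k) / N.+1%:R].
  exact: equal_labels.
(* The index of the band that contains [|f t|]. Bands are open on the left and closed on the right,
   whence the ceiling minus one. *)
pose b t := Num.ceil (ln `|f t| / a) - 1.
have bE t k : I01 t -> E k t <-> (f t != 0 /\ b t = k).
  move=> It; split.
    move=> [[_ /= h1] h2].
    have ft0 : 0 < `|f t| by apply: lt_trans h1; exact: expR_gt0.
    split; first by rewrite -normr_gt0.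
    apply/eqP; rewrite subr_eq eq_le ceil_le_int -ltzD1 ltrD2r real_ceil_gt_int ?num_real//.
    rewrite ler_pdivrMr// ltr_pdivlMr//.
    rewrite -[X in X < _]expRK ltr_ln ?posrE ?expR_gt0// h1 andbT.
    rewrite -[leRHS]expRK ler_ln ?posrE ?expR_gt0// leNgt; apply/negP => h3.
    by apply: h2; split.
  move=> [ft0 <-]; have ft : 0 < `|f t| by rewrite normr_gt0.
  have /andP[h1 h2] := ceil_itv (ln `|f t| / a).
  split; [split => //=|case=> _ /=; apply/negP; rewrite -leNgt].
    by rewrite -[ltRHS]lnK ?posrE// ltr_expR -ltr_pdivlMr.
  by rewrite -[leLHS]lnK ?posrE// ler_expR -ler_pdivrMr// /b subrK.
pose L t := l (b t) t.
have LE i : I01 `&` [set t | f t != 0] `&` [set t | L t = i] =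
    \bigcup_k (E k `&` [set t | l k t = i]).
  apply/seteqP; split=> t.
    move=> [[It ft0] Lt]; exists (b t) => //; split => //.
    by apply/bE.
  move=> [k _ [Ekt lk]]; have It : I01 t by case: Ekt => -[].
  by have /bE := Ekt => /(_ It)[ft0 bk]; split => //; rewrite /L /= bk.
have mf0 : measurable (I01 `&` [set t | f t = 0]).
  exact: (mf (@measurable_I01 R) _ (measurable_set1 0)).
(* The zeros of [f] lie in no band; their label is arbitrary because level sets at [c > 0] do not
   meet them. *)
exists (fun t => if f t == 0 then 0%N else L t); split.
- by move=> t; case: ifP => // _; have [h _ _] := hl (b t); exact: h.
- move=> i.
  rewrite (_ : _ `&` _ = \bigcup_k (E k `&` [set t | l k t = i]) `|`
      (if i == 0%N then I01 `&` [set t | f t = 0] else set0)).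
    apply: measurableU; last by case: ifP.
    apply: countable_bigcupT_measurable => [|k]; first exact: countableP.
    by apply: measurableI => //; have [] := hl k.
  rewrite -LE; apply/seteqP; split => t /=.
    move=> [It]; case: eqP => [ft0 <-|/eqP ft0]; first by right.
    by left.
  case=> [[[It /negPf ->]]//|].
  by case: eqP => // -> [It ->]; rewrite eqxx.
(* Band [k0] contains the value [c]. The level set at [c] is covered by the bands from [k0] on, and
   these lie in the level set at [c / expR a]. *)
- move=> i c iN c0; pose k0 := Num.ceil (ln c / a) - 1.
  have /andP[k1 k2] := ceil_itv (ln c / a).
  pose F (n : nat) := E (k0 + n%:Z).
  have mF n : measurable (F n) by exact: mE.
  have mFi n : measurable (F n `&` [set t | l (k0 + n%:Z) t = i]).
    by apply: measurableI => //; have [] := hl (k0 + n%:Z).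
  have tF : trivIset setT F.
    move=> m n _ _ [t [Em En]]; have It : I01 t by case: Em => -[].
    move: Em En => /(bE _ _ It)[_ bm] /(bE _ _ It)[_].
    by rewrite bm => /addrI[].
  have mUF : measurable (\bigcup_n F n) by exact: bigcup_measurable.
  have mUFi : measurable (\bigcup_n (F n `&` [set t | l (k0 + n%:Z) t = i])).
    by apply: bigcup_measurable => n _; exact: mFi.
  apply: (@le_trans _ _ (vol (\bigcup_n (F n `&` [set t | l (k0 + n%:Z) t = i])))).
    apply: le_vol => //.
      rewrite (_ : _ `&` _ = level_set f c `&` (\bigcup_k (E k `&` [set t | l k t = i]))).
        apply: measurableI; first exact: measurable_level_set.
        apply: countable_bigcupT_measurable => [|k]; first exact: countableP.
        by apply: measurableI => //; have [] := hl k.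
      rewrite -LE; apply/seteqP; split => t /=.
        move=> [[It ct]]; have : f t != 0.
          by rewrite -normr_gt0; exact: lt_trans ct.
        by move=> /[dup] ft0 /negPf ->.
      by move=> [? [[? /negPf ->]]].
    move=> t [[[It /= ct]]]; have ft : 0 < `|f t| by exact: lt_trans ct.
    have ft0 : f t != 0 by rewrite -normr_gt0.
    rewrite (negPf ft0) => Lt _.
    have bk : k0 <= b t.
      rewrite lerD2r le_ceil// ler_pM2r ?invr_gt0// ler_ln ?posrE//.
      exact: ltW.
    have bn : k0 + `|b t - k0|%N%:Z = b t.
      by rewrite gez0_abs ?subr_ge0// subrKC.
    exists `|b t - k0|%N => //; rewrite /F bn; split => //.
    by apply/bE.
  have -> : vol (\bigcup_n (F n `&` [set t | l (k0 + n%:Z) t = i])) =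
      vol (\bigcup_n F n) / N.+1%:R.
    apply: EFin_inj; rewrite mulrC EFinM -!volE// !setI_bigcupl.
    rewrite !measure_bigcup//.
    + rewrite -nneseriesZl//; apply: eq_eseriesr => n _.
      transitivity (vol (F n `&` [set t | l (k0 + n%:Z) t = i]))%:E.
        exact: volE.
      transitivity ((N.+1%:R^-1)%:E * (vol (F n))%:E)%E.
        rewrite -EFinM; congr EFin.
        by have [_ _ ->//] := hl (k0 + n%:Z); rewrite mulrC.
      by congr (_ * _)%E; exact/esym/volE.
    + by move=> n _; exact: (measurable_capI01 (mF n)).
    + by move=> m n _ _ [t [[Em _] [En _]]]; apply: (tF m n) => //; exists t.
    + by move=> n _; exact: (measurable_capI01 (mFi n)).
    + by move=> m n _ _ [t [[[Em _] _] [[En _] _]]]; apply: (tF m n) => //; exists t.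
  rewrite ler_pM2r ?invr_gt0 ?ltr0n//; apply: le_vol => //.
    exact: measurable_level_set.
  move=> t [[n _ Ft] _]; have It : I01 t by case: Ft => -[].
  move: Ft => [[_ /= ft] _]; split => //=.
  apply: le_lt_trans ft; rewrite ler_pdivrMr ?expR_gt0// -expRD.
  rewrite -[leLHS]lnK ?posrE// ler_expR -[X in _ <= _ + X]mul1r -mulrDl -ler_pdivrMr//.
  apply: (le_trans k2); rewrite -[1 in leRHS]/(1%:~R) -intrD ler_int /k0.
  by rewrite addrAC subrK lerDl.
Qed.

End Splitting.

(** * Upper estimate of rho: averaging over rotated weights *)

Section Rotation.
Variable R : realType.
Implicit Types x y : weakL1 R.
Local Notation I01 := (`[0%R, 1%R]%classic : set R).

Lemma rho_ge0 x : 0 <= rho x.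
Proof. exact: (lseminorm_ge0 (rho_seminorm R)). Qed.

Lemma rho_sum n (F : 'I_n -> weakL1 R) :
  rho (\sum_(i < n) F i) <= \sum_(i < n) rho (F i).
Proof.
elim/big_ind2 : _ => //; first by rewrite -rho_seminormE lseminorm0.
move=> x s y r xs yr; apply: le_trans (lerD xs yr).
exact: (lseminormD (rho_seminorm R)).
Qed.

Lemma rhoZ (a : R) x : rho (a *: x) = `|a| * rho x.
Proof. exact: (lseminormZ (rho_seminorm R)). Qed.

Lemma rho_le_quasinorm x (s : R) : 0 < s ->
  (forall c, 0 < c -> c * lev x c <= s) -> rho x <= s.
Proof.
move=> s0 hx; apply: ge_inf; first by exists 0; move=> r /= [/ltW].
have sN0 : s != 0 by rewrite gt_eqF.
split=> //; exists (s^-1 *: x); last by rewrite scalerA divff// scale1r.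
apply: sub_conv_hull; rewrite /weakL1_unit_ball /=.
apply: (le_trans (weak_quasinormZ_le _ _)).
rewrite gtr0_norm ?invr_gt0//.
apply: (@le_trans _ _ ((s^-1)%:E * s%:E)%E).
  rewrite lee_wpmul2l ?lee_fin ?invr_ge0 ?(ltW s0)//.
  exact: (weak_quasinorm_lev s (weakL1_measurable x)).2.
by rewrite -EFinM mulVf.
Qed.

Lemma sum_rot N (G : nat -> R) k :
  \sum_(i < N.+1) G ((i + k) %% N.+1)%N = \sum_(i < N.+1) G i.
Proof.
rewrite [RHS](reindex_inj (addIr (inord (k %% N.+1) : 'I_N.+1))).
apply: eq_bigr => i _; congr G.
by rewrite /= inordK ?ltn_pmod// modnDmr.
Qed.

(* Split [0,1] into [N] parts that are independent of [|x|] and let [y_k] be [x]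
   multiplied on the [i]-th part by [1 / (1 + (i + k) mod N)]. The [y_k] sum up to
   [harm N] times [x], and all of them have the same distribution, for which
   [c * lev c] is a level sum of [x]. *)
Lemma rho_le_levsum x N (s : R) : (0 < N)%N -> 0 <= s ->
  (forall eta, 0 < eta -> levsum x N eta <= s * harm R N) -> rho x <= s.
Proof.
case: N => // N _ s0 hx; have mx := weakL1_measurable x.
(* The factor [expR a] is the loss of [spread_labels]. With [r = s + e / 2] and
   [expR a = 1 + e / (2 r)] the product is [s + e]; passing from [s] to [r] also makes the bound
   positive. *)
suff h (a r : R) : 0 < a -> s < r -> rho x <= expR a * r.
  apply/ler_addgt0Pr => e e0; pose r := s + e / 2.
  have sr : s < r by rewrite ltrDl divr_gt0.
  have r0 : 0 < r by exact: le_lt_trans sr.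
  have er : 0 < e / 2 / r by rewrite !divr_gt0.
  have := h (ln (1 + e / 2 / r)) r _ sr.
  rewrite lnK ?posrE ?addr_gt0// mulrDl mul1r divfK ?gt_eqF//.
  by rewrite /r -addrA -splitr; apply; rewrite ln_gt0// ltrDl.
move=> a0 sr; have r0 : 0 < r by exact: le_lt_trans sr.
have [l [lN ml vl]] := spread_labels N mx a0.
pose u (k : nat) (t : R) : R := (((l t + k) %% N.+1).+1%:R)^-1.
have mu k : measurable_fun I01 (u k).
  rewrite (_ : u k = (fun n : nat => (((n + k) %% N.+1).+1%:R)^-1) \o l)//.
  move=> _ Y mY; rewrite comp_preimage.
  rewrite (_ : _ `&` _ = \bigcup_(i in [set i | Y ((((i + k) %% N.+1).+1%:R)^-1)])
                       (I01 `&` [set t | l t = i])).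
    by apply: bigcup_measurable => i _; exact: ml.
  apply/seteqP; split=> [t [It Yt]|t [i /= Yi [It li]]]; first by exists (l t).
  by split => //=; rewrite li.
have u0 k t : 0 < u k t by rewrite invr_gt0 ltr0n.
have u1 k t : `|u k t| <= 1.
  by rewrite gtr0_norm// invf_le1 ?ltr0n// -[1]/(1%:R) ler_nat.
pose y k := weakL1_mul (mu k) (u1 k) x.
have H0 : 0 < harm R N.+1 by exact: harm_gt0.
(* At a fixed [t] the weights [u k t] run, as [k] varies, through [1, 1/2, ..., 1/N.+1] in rotated
   order. *)
have yx : \sum_(k < N.+1) y k = harm R N.+1 *: x.
  apply: weakL1_ext => t.
  have -> : (\sum_(k < N.+1) y k : weakL1 R) t = \sum_(k < N.+1) y k t.
    by elim/big_ind2 : _ => // f1 r1 f2 r2 <- <-.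
  rewrite -[RHS]/(harm R N.+1 * x t) /y /= -mulr_suml; congr (_ * _).
  rewrite /u /harm -(sum_rot _ (fun j => (j.+1%:R : R)^-1) (l t)).
  by apply: eq_bigr => k _; rewrite addnC.
have ml' k i (c : R) : measurable
    (level_set x (c * ((i + k) %% N.+1).+1%:R) `&` [set t | l t = i]).
  rewrite (_ : _ `&` _ = level_set x (c * ((i + k) %% N.+1).+1%:R) `&`
      (I01 `&` [set t | l t = i])).
    by apply: measurableI => //; exact: measurable_level_set.
  by rewrite setIA; congr (_ `&` _); rewrite setIidl// => t [].
have qy k (c : R) : 0 < c -> c * lev (y k) c <= expR a * r * harm R N.+1 / N.+1%:R.
  move=> c0; have ca : 0 < c / expR a by rewrite divr_gt0// expR_gt0.
  (* On label [i] the level set of [y k] at [c] is that of [x] at a multiple of [c], and every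
     multiple from 1 to [N.+1] occurs for exactly one label. *)
  have h1 : lev (y k) c <= \sum_(i < N.+1) lev x ((i.+1)%:R * (c / expR a)) / N.+1%:R.
    rewrite -(sum_rot _ (fun j => lev x (j.+1%:R * (c / expR a)) / N.+1%:R) k).
    pose F i := level_set x (c * ((i + k) %% N.+1).+1%:R) `&` [set t | l t = i].
    apply: (@le_trans _ _ (vol (\big[setU/set0]_(i < N.+1) F i))).
      apply: le_vol.
      - by apply: measurable_level_set; exact: weakL1_measurable.
      - by apply: bigsetU_measurable => i _; exact: ml'.
      - move=> t [[It /= ct] _]; rewrite -bigcup_mkord; exists (l t) => /=.
          by rewrite ltnS.
        split => //; split => //=; move: ct; rewrite normrM gtr0_norm// /u.
        by rewrite mulrC ltr_pdivlMr// ltr0n.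
    apply: (le_trans (vol_bigsetU_le _ (fun i => ml' k i c))).
    apply: ler_sum => i _; apply: (le_trans (vl i _ _ _)).
    - by rewrite -ltnS.
    - by rewrite mulr_gt0// ltr0n.
    - by rewrite [c * _]mulrC -mulrA.
  apply: (le_trans (ler_wpM2l (ltW c0) h1)).
  rewrite -mulr_suml mulrA ler_pM2r ?invr_gt0 ?ltr0n//.
  rewrite -[X in X * _](divfK (lt0r_neq0 (expR_gt0 a))).
  rewrite mulrAC mulrC -mulrA ler_pM2l ?expR_gt0//.
  have := hx _ ca; rewrite /levsum -mulr_sumr => /le_trans; apply.
  by rewrite ler_wpM2r ?(ltW H0)// ltW.
have ry k : rho (y k) <= expR a * r * harm R N.+1 / N.+1%:R.
  apply: rho_le_quasinorm; last exact: qy.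
  by rewrite divr_gt0 ?mulr_gt0 ?expR_gt0// ltr0n.
have := rho_sum (fun k : 'I_N.+1 => y k); rewrite yx rhoZ gtr0_norm//.
move=> /le_trans/(_ (ler_sum _ (fun (k : 'I_N.+1) _ => ry k))).
rewrite sumr_const card_ord -[_ *+ _]mulr_natr divfK ?pnatr_eq0// mulrC.
by rewrite ler_pM2r.
Qed.

End Rotation.
(** * Assembling functions on disjoint intervals *)

Section Affine.
Variable R : realType.
Local Notation I01 := (`[0%R, 1%R]%classic : set R).
Local Notation mu := (@lebesgue_measure R).
Variables (s d : R).
Hypothesis d0 : 0 < d.

Definition rescale (t : R) : R := (t - s) / d.

Lemma measurable_rescale : measurable_fun setT rescale.
Proof.
by apply: measurable_funM => //; apply: measurable_funB.
Qed.

(** The image measure under [rescale], divided by [d], agrees with Lebesgue measure on half-open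
    intervals and so equals it by uniqueness. *)
Lemma lebesgue_measure_rescale (A : set R) : measurable A ->
  mu (rescale @^-1` A) = (d%:E * mu A)%E.
Proof.
move=> mA; have dE : (0 <= d^-1)%R by rewrite invr_ge0 ltW.
pose m := mscale (NngNum dE)
  (pushforward mu (rescale : measurableTypeR R -> measurableTypeR R)).
have -> : mu A = m measurable_rescale A.
  rewrite /m; apply: lebesgue_measure_unique => // _ [[a b] _ <-] /=.
  rewrite /m /mscale/= /pushforward.
  have -> : rescale @^-1` `]a, b]%classic = `]a * d + s, b * d + s]%classic.
    apply/seteqP; split => t /=; rewrite !in_itv/= /rescale ltr_pdivlMr// ler_pdivrMr//;
      by rewrite ltrBrDr lerBlDr.
  rewrite !lebesgue_measure_itv/= !lte_fin ltrD2r ltr_pM2r//; case: ifP => _.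
    by rewrite -!EFinB -EFinM; congr EFin; field; rewrite gt_eqF.
  by rewrite mule0.
by rewrite /m /mscale/= /pushforward muleA -EFinM divff ?gt_eqF// mul1e.
Qed.

Hypotheses (s0 : 0 <= s) (sd : s + d <= 1).

Lemma rescale_I01 t : I01 (rescale t) <-> s <= t <= s + d.
Proof.
by rewrite /= in_itv/= /rescale ler_pdivlMr// mul0r subr_ge0 ler_pdivrMr// mul1r lerBlDl.
Qed.

Lemma rescale_sub t : I01 (rescale t) -> I01 t.
Proof.
move=> /rescale_I01/andP[st ts]; rewrite /= in_itv/= (le_trans s0 st).
exact: le_trans sd.
Qed.

Lemma measurable_rescale_preimage (A : set R) :
  measurable A -> measurable (rescale @^-1` A).
Proof. by move=> mA; rewrite -[X in measurable X]setTI; exact: measurable_rescale. Qed.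

Lemma vol_rescale (A : set R) : measurable A -> A `<=` I01 ->
  vol (rescale @^-1` A) = d * vol A.
Proof.
move=> mA AI; apply: EFin_inj; rewrite EFinM -!volE//.
  rewrite (setIidl AI) -lebesgue_measure_rescale//.
  by rewrite setIidl// => t At; apply: rescale_sub; exact: AI.
exact: measurable_rescale_preimage.
Qed.

End Affine.

(** * Packing a sequence of functions into a single one *)

Section Glue.
Variables (R : realType) (N : nat -> nat) (B : nat -> R).
Local Notation I01 := (`[0%R, 1%R]%classic : set R).
Local Notation mu := (@lebesgue_measure R).
Hypotheses (N0 : forall k, (0 < N k)%N) (B1 : forall k, 1 <= B k).

(* Block [k] lies in [tau k.+1, tau k] and consists of [N k] intervals of length
   [del k], separated by gaps. The factor [(4 ^+ k.+1 * B k)^-1] in [tauS] makes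
   all later blocks negligible at the heights reached by block [k]. *)
Definition tau k : R := \prod_(i < k) (4 ^+ i.+2 * (N i)%:R * B i)^-1.
Definition del k : R := tau k / (4 * (N k)%:R).
Definition loc k i : R := tau k.+1 + 2 * i%:R * del k.

Let B0 k : 0 < B k. Proof. exact: lt_le_trans (B1 k). Qed.
Let NR0 k : 0 < (N k)%:R :> R. Proof. by rewrite ltr0n. Qed.

Lemma tau_gt0 k : 0 < tau k.
Proof.
rewrite /tau; apply: prodr_gt0 => i _; rewrite invr_gt0; apply: mulr_gt0 => //.
by apply: mulr_gt0 => //; exact: exprn_gt0.
Qed.

Lemma del_gt0 k : 0 < del k.
Proof. by rewrite divr_gt0 ?tau_gt0// mulr_gt0. Qed.

Lemma tauS k : tau k.+1 = del k / (4 ^+ k.+1 * B k).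
Proof.
rewrite /del /tau big_ord_recr/= -[RHS]mulrA -invfM; congr (_ * _^-1).
by rewrite [in LHS]exprS; ring.
Qed.

Lemma tauS_le k : tau k.+1 <= del k / 4.
Proof.
rewrite tauS ler_pM2l ?del_gt0// lef_pV2 ?posrE//; last first.
  by rewrite mulr_gt0// exprn_gt0.
rewrite exprS -mulrA ler_peMr// mulr_ege1//.
by rewrite exprn_ege1// ler1n.
Qed.

(** The intervals start at [tau k.+1 <= del k / 4] and, with the gaps, fill fewer than [2 N k]
    lengths [del k], whereas [tau k] is [4 N k] such lengths. *)
Lemma block_end k i : (i < N k)%N -> loc k i + del k < tau k.
Proof.
move=> iN; rewrite /loc; have h := tauS_le k; have d0 := del_gt0 k.
have E : tau k = 4 * (N k)%:R * del k.
  by rewrite /del mulrCA divff ?mulr1// mulf_neq0// gt_eqF.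
have : (i.+1%:R : R) <= (N k)%:R by rewrite ler_nat.
rewrite -natr1 => h2; rewrite E.
have : (i%:R + 1) * del k <= (N k)%:R * del k by rewrite ler_pM2r.
have : 1 * del k <= (N k)%:R * del k by rewrite ler_pM2r// ler1n.
nra.
Qed.

Lemma loc_ge k i : tau k.+1 <= loc k i.
Proof. rewrite /loc lerDl; apply: mulr_ge0; first exact: mulr_ge0.
exact/ltW/del_gt0. Qed.

Lemma tau_nincr m k : (m <= k)%N -> tau k <= tau m.
Proof.
move=> /subnKC <-; elim: (k - m)%N => [|n ih]; first by rewrite addn0.
rewrite addnS (le_trans _ ih)// (le_trans (loc_ge _ 0))//.
by rewrite (le_trans _ (ltW (block_end (N0 _))))// lerDl ltW ?del_gt0.
Qed.

Lemma tau_le1 k : tau k <= 1.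
Proof. by have := tau_nincr (leq0n k); rewrite {2}/tau big_ord0. Qed.

Lemma loc_ge0 k i : 0 <= loc k i.
Proof. by rewrite (le_trans _ (loc_ge _ _))// ltW ?tau_gt0. Qed.

Lemma loc_end_le1 k i : (i < N k)%N -> loc k i + del k <= 1.
Proof. by move=> iN; rewrite (le_trans (ltW (block_end iN)))// tau_le1. Qed.

Definition piece (t : R) (ki : nat * nat) : Prop :=
  (ki.2 < N ki.1)%N /\ I01 (rescale (loc ki.1 ki.2) (del ki.1) t).

Lemma pieceP t k i : piece t (k, i) <->
  (i < N k)%N /\ loc k i <= t <= loc k i + del k.
Proof.
by split=> -[iN] /=; rewrite /piece/= => h; split => //; move: h;
  rewrite -/(I01 _) (rescale_I01 _ (del_gt0 k)).
Qed.

(** Blocks are separated by the points [tau k], and intervals within a block by gaps of length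
    [del k]. Hence even the closed intervals are disjoint and [assemble] reads off one value
    only. *)
Lemma piece_uniq t ki ki' : piece t ki -> piece t ki' -> ki = ki'.
Proof.
case: ki ki' => k i [k' i'] /pieceP[iN /andP[h1 h2]] /pieceP[iN' /andP[h1' h2']].
have lt k1 k2 i1 i2 : (i1 < N k1)%N -> (i2 < N k2)%N -> loc k1 i1 <= t ->
    t <= loc k2 i2 + del k2 -> (k2 <= k1)%N.
  move=> n1 n2 t1 t2; rewrite leqNgt; apply/negP => k12.
  have := le_lt_trans (le_trans t1 t2) (block_end n2).
  by rewrite ltNge (le_trans (tau_nincr k12))// loc_ge.
have kk : k = k'.
  by apply/eqP; rewrite eqn_leq (lt k' k i' i)// (lt k k' i i').
subst k'; congr pair.
have lti i1 i2 : loc k i1 <= t -> t <= loc k i2 + del k -> (i1 <= i2)%N.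
  move=> t1 t2; rewrite leqNgt; apply/negP => i12.
  have := le_trans t1 t2; rewrite /loc -addrA lerD2l.
  have : (i2.+1%:R : R) <= i1%:R by rewrite ler_nat.
  rewrite -natr1 => h; have d0 := del_gt0 k.
  have : (i2%:R + 1) * del k <= i1%:R * del k by rewrite ler_pM2r.
  lra.
by apply/eqP; rewrite eqn_leq !lti.
Qed.

(* The factor [(del k * i.+1)^-1] makes the copies of [v k] a discrete version of
   [v k] times [1 / y]; this spreads [v k] so much that only its L1 norm counts. *)
Definition assemble (v : nat -> R -> R) (t : R) : R :=
  let ki := xget (0%N, 0%N) (piece t) in
  if `[< piece t ki >] then
    v ki.1 (rescale (loc ki.1 ki.2) (del ki.1) t) / (del ki.1 * ki.2.+1%:R)
  else 0.

Lemma assembleE v t k i : piece t (k, i) ->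
  assemble v t = v k (rescale (loc k i) (del k) t) / (del k * i.+1%:R).
Proof.
move=> pt; rewrite /assemble; case: xgetP => [ki -> pki|/(_ (k, i))//].
by rewrite asboolT// (piece_uniq pki pt).
Qed.

Lemma assemble0 v t : (forall k i, ~ piece t (k, i)) -> assemble v t = 0.
Proof.
move=> h; rewrite /assemble asboolF//; case: (xget _ _) => k i; exact: h.
Qed.

Lemma assembleP v t : assemble v t = 0 \/ exists k i, piece t (k, i).
Proof.
have [[[k i] pt]|h] := pselect (exists ki, piece t ki); first by right; exists k, i.
by left; apply: assemble0 => k i pt; apply: h; exists (k, i).
Qed.

Lemma measurable_assemble v : (forall k, measurable_fun I01 (v k)) ->
  measurable_fun I01 (assemble v).
Proof.
move=> mv _ Y mY.
pose P k i := rescale (loc k i) (del k) @^-1` I01.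
pose Q k i := rescale (loc k i) (del k) @^-1`
  (I01 `&` (fun y => v k y / (del k * i.+1%:R)) @^-1` Y).
have mP k i : measurable (P k i).
  by apply: measurable_rescale_preimage; exact: measurable_I01.
have mQ k i : measurable (Q k i).
  apply: measurable_rescale_preimage.
  have mw : measurable_fun I01 (fun y => v k y / (del k * i.+1%:R)).
    by apply: measurable_funM => //; exact: mv.
  exact: (mw (@measurable_I01 R) _ mY).
have -> : I01 `&` assemble v @^-1` Y =
    \bigcup_k \bigcup_(i in [set i | (i < N k)%N]) Q k i `|`
    (if `[< Y 0 >] then I01 `\` \bigcup_k \bigcup_(i in [set i | (i < N k)%N]) P k i
     else set0).
  apply/seteqP; split => t.
    move=> [It Yt]; have [[[k i] pt]|h] := pselect (exists ki, piece t ki).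
      left; exists k => //; exists i; first by case: pt.
      by case: (pt) => /= iN Ii; split => //=; rewrite -(assembleE v pt).
    have g0 : assemble v t = 0 by apply: assemble0 => k i pt; apply: h; exists (k, i).
    right; move: Yt; rewrite /= g0 => Y0; rewrite asboolT//; split => //.
    by move=> [k _ [i iN pt]]; apply: h; exists (k, i).
  case.
    move=> [k _ [i iN [Ii Yt]]]; have pt : piece t (k, i) by split.
    split; last by rewrite /= (assembleE v pt).
    exact: (rescale_sub (del_gt0 k) (loc_ge0 k i) (loc_end_le1 iN) Ii).
  case: asboolP => // Y0 [It h]; split => //=; rewrite assemble0// => k i [iN pt].
  by apply: h; exists k => //; exists i.
apply: measurableU.
  by apply: bigcup_measurable => k _; apply: bigcup_measurable => i _; exact: mQ.
case: ifP => // _; apply: measurableD; first exact: measurable_I01.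
by apply: bigcup_measurable => k _; apply: bigcup_measurable => i _; exact: mP.
Qed.

Lemma vol_piece_level v k i (c : R) : (i < N k)%N -> measurable_fun I01 (v k) ->
  vol (rescale (loc k i) (del k) @^-1` level_set (v k) c) = del k * lev (v k) c.
Proof.
move=> iN mv; apply: vol_rescale; [exact: del_gt0|exact: loc_ge0|
  exact: loc_end_le1|exact: measurable_level_set|by move=> t []].
Qed.

Section Levels.
Variable v : nat -> R -> R.
Hypothesis mv : forall k, measurable_fun I01 (v k).

Let Lk k c i := rescale (loc k i) (del k) @^-1` level_set (v k) (c * (del k * i.+1%:R)).

Let mLk k c i : measurable (Lk k c i).
Proof. by apply: measurable_rescale_preimage; exact: measurable_level_set. Qed.

Let di0 k i : 0 < del k * i.+1%:R. Proof. by rewrite mulr_gt0// del_gt0. Qed.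

(** At height [c] only block [k0] counts: earlier blocks do not exceed [c], and later ones lie in an
    interval of length [tau k0.+1]. *)
Lemma lev_assemble_le k0 (c : R) : 0 < c ->
  (forall k y, (k < k0)%N -> I01 y -> `|v k y| <= c * del k) ->
  lev (assemble v) c <=
    \sum_(i < N k0) del k0 * lev (v k0) (c * (del k0 * i.+1%:R)) + tau k0.+1.
Proof.
move=> c0 hk0.
have mU : measurable (\big[setU/set0]_(i < N k0) Lk k0 c i).
  by apply: bigsetU_measurable => i _; exact: mLk.
have mT : measurable (`]-oo, (tau k0.+1)]%classic : set R) by exact: measurable_itv.
apply: (@le_trans _ _ (vol ((\big[setU/set0]_(i < N k0) Lk k0 c i) `|`
    `]-oo, (tau k0.+1)]%classic))).
  apply: le_vol; [|exact: measurableU|].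
    by apply: measurable_level_set; exact: measurable_assemble.
  move=> t [[It /= ct] _].
  have [g0|[k [i pt]]] := assembleP v t.
    by move: ct; rewrite g0 normr0 ltNge ltW.
  have [kk0|kk0|kk0] := ltngtP k k0.
  - move: ct; rewrite (assembleE v pt) normrM normfV (gtr0_norm (di0 k i)) ltr_pdivlMr//.
    have := hk0 _ _ kk0 pt.2; rewrite /= => h1 h2; have := lt_le_trans h2 h1.
    by rewrite ltr_pM2l// gtr_pMr ?del_gt0// (ltr_nat R _ 1) ltnS ltn0.
  - right; have /pieceP[iN /andP[_ te]] := pt; rewrite /= in_itv/=.
    by rewrite (le_trans te)// (le_trans (ltW (block_end iN)))// tau_nincr.
  - left; subst k0; rewrite -bigcup_mkord; exists i; first by case: pt.
    split; first by case: pt.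
    move: ct; rewrite /= (assembleE v pt) normrM normfV (gtr0_norm (di0 k i)).
    by rewrite ltr_pdivlMr.
apply: (@le_trans _ _ (vol (\big[setU/set0]_(i < N k0) Lk k0 c i) +
    vol `]-oo, (tau k0.+1)]%classic)).
  rewrite -lee_fin EFinD -!volE//; last exact: measurableU.
  by rewrite setIUl; apply: measureU2; exact: measurable_capI01.
apply: lerD.
  rewrite (le_trans (vol_bigsetU_le _ (mLk k0 c)))//.
  by apply: ler_sum => i _; rewrite vol_piece_level.
rewrite -lee_fin -volE//; apply: (@le_trans _ _ (mu `[0, (tau k0.+1)]%classic)).
  apply: le_measure; rewrite ?inE//; first exact: measurable_capI01.
  by move=> t []; rewrite /= !in_itv/= => -> /andP[->].
by rewrite lebesgue_measure_itv/= lte_fin tau_gt0 oppr0 adde0.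
Qed.

Lemma lev_assemble_ge k (c : R) :
  \sum_(i < N k) del k * lev (v k) (c * (del k * i.+1%:R)) <= lev (assemble v) c.
Proof.
pose F i := if (i < N k)%N then Lk k c i else set0.
have mF i : measurable (F i) by rewrite /F; case: ifP => // _; exact: mLk.
have tF : trivIset setT F.
  move=> i j _ _ [t []]; rewrite /F; case: ifP => // iN; case: ifP => // jN.
  move=> [Ii _] [Ij _]; have pi : piece t (k, i) by split.
  have pj : piece t (k, j) by split.
  by have [] := piece_uniq pi pj.
rewrite (_ : \sum_(i < _) _ = \sum_(i < N k) vol (F i)); last first.
  by apply: eq_bigr => i _; rewrite /F ltn_ord vol_piece_level.
rewrite -vol_bigsetU//; apply: le_vol.
- by apply: bigsetU_measurable => i _; exact: mF.
- by apply: measurable_level_set; exact: measurable_assemble.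
- move=> t [+ It]; rewrite -bigcup_mkord => -[i /= iN]; rewrite /F iN.
  move=> [Ii ct]; split => //=; have pt : piece t (k, i) by split.
  by rewrite (assembleE v pt) normrM normfV (gtr0_norm (di0 k i)) ltr_pdivlMr.
Qed.

(** The share of block [k] in the level sum of the assembled function. *)
Definition block_sum M (eta : R) k : R := \sum_(j < M)
  eta * \sum_(i < N k) del k * lev (v k) (j.+1%:R * eta * (del k * i.+1%:R)).

Lemma levsum_assemble_ge M eta k : 0 < eta -> block_sum M eta k <= levsum (assemble v) M eta.
Proof.
move=> e0; apply: ler_sum => j _; rewrite ler_wpM2l ?(ltW e0)//.
exact: lev_assemble_ge.
Qed.

(** Let [k0] be the first block from [K] on with [eta * del k0 < kap * B k0]; if there is none, the
    function stays below [eta] and the level sum vanishes. Earlier blocks do not exceed [eta], and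
    later ones contribute at most [M * eta * tau k0.+1], which by [tauS] and the choice of [k0] is
    at most [kap * M / 4 ^+ K]. So never more than one block matters. *)
Lemma levsum_assemble_le M (eta kap D : R) K : 0 < eta -> 0 <= kap -> 0 <= D ->
  (forall k y, `|v k y| <= kap * B k) ->
  (forall k y, (k < K)%N -> v k y = 0) ->
  (forall k, (K <= k)%N -> block_sum M eta k <= D) ->
  levsum (assemble v) M eta <= D + kap * M%:R / 4 ^+ K.
Proof.
move=> e0 kap0 D0 vB vK bD.
have K0 : 0 <= kap * M%:R / 4 ^+ K by rewrite !mulr_ge0// invr_ge0 exprn_ge0.
have [ex|nex] := pselect (exists k, (K <= k)%N && (eta * del k < kap * B k)); last first.
  rewrite (_ : levsum _ _ _ = 0) ?addr_ge0// /levsum big1// => j _.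
  rewrite lev_eq0 ?mulr0// => t _; have [->|[k [i pt]]] := assembleP v t.
    by rewrite normr0 mulr_ge0// ltW.
  rewrite (assembleE v pt) normrM normfV (gtr0_norm (di0 k i)) ler_pdivrMr//.
  apply: (@le_trans _ _ (eta * del k)).
    have [kK|Kk] := ltnP k K; first by rewrite vK// normr0 mulr_ge0// ltW// del_gt0.
    rewrite (le_trans (vB _ _))// leNgt; apply/negP => h; apply: nex; exists k.
    by rewrite Kk.
  have -> : j.+1%:R * eta * (del k * i.+1%:R) = eta * del k * (j.+1 * i.+1)%:R.
    by rewrite natrM; ring.
  have ed : 0 <= eta * del k by rewrite mulr_ge0 ?ltW// del_gt0.
  by rewrite (ler_peMr ed)// ler1n.
case: (ex_minnP ex) => k0 /andP[Kk0 hk0] k0min.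
apply: (@le_trans _ _ (block_sum M eta k0 + M%:R * (eta * tau k0.+1))).
  rewrite /levsum /block_sum mulr_natl.
  rewrite -[M in _ *+ M]card_ord -sumr_const -big_split/=.
  apply: ler_sum => j _; rewrite -mulrDr ler_wpM2l ?(ltW e0)//.
  apply: lev_assemble_le; first by rewrite mulr_gt0.
  move=> k y kk0 _; apply: (@le_trans _ _ (eta * del k)).
    have [kK|Kk] := ltnP k K; first by rewrite vK// normr0 mulr_ge0// ltW// del_gt0.
    rewrite (le_trans (vB _ _))// leNgt; apply/negP => h.
    by have := k0min k; rewrite Kk h leqNgt kk0 => /(_ isT).
  rewrite ler_pM2r ?del_gt0// ler_peMl ?(ltW e0)//.
  by rewrite -[1]/(1%:R) ler_nat.
rewrite lerD ?bD// [leRHS]mulrAC mulrC ler_wpM2r//.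
rewrite tauS mulrA ler_pdivrMr; last by rewrite mulr_gt0// exprn_gt0.
rewrite (le_trans (ltW hk0))// -[leRHS]mulrA ler_wpM2l// mulrA ler_peMl ?(ltW (B0 _))//.
rewrite mulrC ler_pdivlMr ?exprn_gt0// mul1r ler_weXn2l ?ler1n//.
exact: leqW.
Qed.

End Levels.
End Glue.
(** Take for [nu m] the largest [n <= m] with [P n m]; the bound by [m] ensures that a maximum
    exists. *)
Lemma diagonal_selection (P : nat -> nat -> Prop) : (forall m, P 0%N m) ->
  (forall n, exists m0, forall m, (m0 <= m)%N -> P n m) ->
  exists nu : nat -> nat, (forall m, P (nu m) m) /\
    (forall n, exists m0, forall m, (m0 <= m)%N -> (n <= nu m)%N).
Proof.
move=> P0 Pn.
have /choice[nu hnu] m : exists n, P n m /\ forall n', (n' <= m)%N -> P n' m -> (n' <= n)%N.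
  have ex : exists n, (n <= m)%N && `[< P n m >] by exists 0%N; rewrite asboolT.
  have ub n : (n <= m)%N && `[< P n m >] -> (n <= m)%N by case/andP.
  case: (ex_maxnP ex ub) => n /andP[nm /asboolP Pnm] nmax; exists n; split=> // n' n'm Pn'.
  by apply: nmax; rewrite n'm asboolT.
exists nu; split=> [m|n]; first by case: (hnu m).
have [m0 hm0] := Pn n; exists (maxn m0 n) => m; rewrite geq_max => /andP[m0m nm].
by case: (hnu m) => _; apply => //; exact: hm0.
Qed.

(** * Assembling windows and estimating rho of the result *)

Section Operator.
Variable R : realType.
Implicit Types (f g x : weakL1 R) (v w : nat -> R -> R).
Local Notation I01 := (`[0%R, 1%R]%classic : set R).

(* With [harm (copies m) >= harm m ^ 2] the [harm m] that is due to the height of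
   the window itself is negligible when it is compared with the copies. *)
Definition copies m : nat := s2val (cid2 (harm_unbounded (harm R m ^+ 2))).

Lemma copies_gt0 m : (0 < copies m)%N.
Proof. exact: (s2valP (cid2 (harm_unbounded (harm R m ^+ 2)))). Qed.

Lemma harm_copies m : harm R m ^+ 2 <= harm R (copies m).
Proof. exact: (s2valP' (cid2 (harm_unbounded (harm R m ^+ 2)))). Qed.

(* Each [k] codes a window [pos k < |f| <= cap k = lvl k * pos k]; for a given
   level all positions occur. *)
Definition window_index k : nat * nat := odflt (0%N, 0%N) (unpickle k).
Definition lvl k : nat := (window_index k).1.+1.
Definition pos k : nat := (window_index k).2.+1.
Definition cap k : R := (lvl k)%:R * (pos k)%:R.
Definition ncop k : nat := copies (lvl k).

Lemma window_surj m n : exists k, lvl k = m.+1 /\ pos k = n.+1.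
Proof. by exists (pickle (m, n)); rewrite /lvl /pos /window_index pickleK. Qed.

Lemma ncop_gt0 k : (0 < ncop k)%N. Proof. exact: copies_gt0. Qed.

Lemma cap_ge1 k : 1 <= cap k.
Proof. by rewrite /cap mulr_ege1// ler1n. Qed.

Lemma harm_lvl k : 1 <= harm R (lvl k). Proof. exact: harm_ge1. Qed.

Lemma harm_lvl_gt0 k : 0 < harm R (lvl k). Proof. exact: harm_gt0. Qed.

Local Notation gl := (assemble ncop cap).
Local Notation delta := (del ncop cap).

(** The bound by [cap k] controls the interaction of the blocks, and the bound on the L1 norms
    controls each single block; together they put the assembled function into weak L1. *)
Definition admissible v : Prop :=
  [/\ forall k, measurable_fun I01 (v k),
      exists2 kap, 0 <= kap & forall k y, `|v k y| <= kap * cap k &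
      exists2 C, 0 <= C & forall k, L1n (v k) <= C].

Lemma admissible_bounded v k : admissible v -> bounded_meas (v k).
Proof. by case=> mv [kap _ vk] _; split=> //; exists (kap * cap k). Qed.

(** The double sum over heights [j] and copies [i] depends on the product of the two only. Summing
    first over either of them gives harmonic combinations of level sums of [v k], hence the two
    bounds [harm M] and [harm (ncop k)] times the L1 norm. *)
Lemma block_sum_levsum v M (eta : R) k : 0 < eta ->
  block_sum ncop cap v M eta k =
  \sum_(j < M) (j.+1%:R)^-1 * levsum (v k) (ncop k) (j.+1%:R * (eta * delta k)).
Proof.
move=> e0; apply: eq_bigr => j _; rewrite /levsum !mulr_sumr; apply: eq_bigr => i _.
rewrite !mulrA mulVf ?pnatr_eq0// mul1r; congr (_ * lev _ _); ring.
Qed.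

Lemma block_sum_exchange v M (eta : R) k : 0 < eta ->
  block_sum ncop cap v M eta k =
  \sum_(i < ncop k) (i.+1%:R)^-1 * levsum (v k) M (i.+1%:R * (eta * delta k)).
Proof.
move=> e0; rewrite /block_sum.
under eq_bigr do rewrite mulr_sumr.
rewrite exchange_big/=; apply: eq_bigr => i _; rewrite /levsum mulr_sumr.
apply: eq_bigr => j _.
rewrite !mulrA mulVf ?pnatr_eq0// mul1r; congr (_ * lev _ _); ring.
Qed.

Let delta_gt0 k : 0 < delta k := del_gt0 ncop_gt0 cap_ge1 k.

Lemma block_sum_le_harm v M (eta : R) k : 0 < eta -> bounded_meas (v k) ->
  block_sum ncop cap v M eta k <= harm R M * L1n (v k).
Proof.
move=> e0 mv; rewrite block_sum_levsum// /harm mulr_suml; apply: ler_sum => j _.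
by rewrite ler_wpM2l ?invr_ge0// levsum_le_L1n// mulr_gt0// mulr_gt0.
Qed.

Lemma block_sum_le_copies v M (eta : R) k : 0 < eta -> bounded_meas (v k) ->
  block_sum ncop cap v M eta k <= harm R (ncop k) * L1n (v k).
Proof.
move=> e0 mv; rewrite block_sum_exchange// /harm mulr_suml; apply: ler_sum => j _.
by rewrite ler_wpM2l ?invr_ge0// levsum_le_L1n// mulr_gt0// mulr_gt0.
Qed.

Lemma assemble_weakL1 v : admissible v -> gl v \in @weakL1_pred R.
Proof.
move=> av; have [mv [kap kap0 vk] [C C0 vC]] := av.
have mg := measurable_assemble ncop_gt0 cap_ge1 mv.
apply/weakL1_predP; split=> //.
apply: (@le_lt_trans _ _ (C + kap)%:E); last exact: ltry.
apply/(weak_quasinorm_lev _ mg) => c c0.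
(* With a single step, [M = 1], the level sum is [c * lev c], so its bound is a bound on the
   quasinorm. *)
have := @levsum_assemble_le R ncop cap ncop_gt0 cap_ge1 v mv 1 c kap C 0%N c0 kap0 C0 vk.
rewrite /levsum big_ord_recl big_ord0 addr0 mul1r expr0 divr1 mulr1; apply => //.
move=> k _; rewrite (le_trans (block_sum_le_harm _ _ (admissible_bounded k av)))//.
by rewrite harm1 mul1r.
Qed.

(** The default 0 does not occur for admissible [v], by [assemble_weakL1]. *)
Definition assembleW v : weakL1 R := insubd 0 (gl v).

Lemma assembleWE v t : admissible v -> assembleW v t = gl v t.
Proof. by move=> /assemble_weakL1 h; rewrite /assembleW insubdK. Qed.

(** The level sums are at most [b] for every [M], whereas [harm M] is unbounded. *)
Lemma rho_bounded x (b : R) : (forall t, `|x t| <= b) -> rho x = 0.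
Proof.
move=> xb; apply/eqP; rewrite eq_le rho_ge0 andbT; apply/ler_addgt0Pr => e e0.
rewrite add0r; have [M M0 hM] := harm_unbounded (b / e).
have mx : bounded_meas x by split; [exact: weakL1_measurable|exists b].
have b0 : 0 <= b by rewrite (le_trans _ (xb 0)).
apply: (rho_le_levsum M0 (ltW e0)) => eta eta0.
rewrite (le_trans (levsum_le_L1n _ mx eta0))//.
apply: (@le_trans _ _ (b * L1n (\1_I01 : R -> R))).
  apply: L1n_leZ => //; first exact: bounded_meas_indic.
  by move=> t It; rewrite indicE mem_set// normr1 mulr1.
rewrite L1n_indic// (@le_trans _ _ b)//; first by rewrite ler_piMr// vol_le1.
by rewrite mulrC -ler_pdivrMr.
Qed.

(** At each point [assemble] multiplies one value of the sequence by a nonnegative factor, so it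
    commutes with positively homogeneous operations. *)
Lemma assemble_op (op : R -> R -> R) v w t : op 0 0 = 0 ->
  (forall c a b, 0 <= c -> op (a * c) (b * c) = op a b * c) ->
  gl (fun k y => op (v k y) (w k y)) t = op (gl v t) (gl w t).
Proof.
move=> op0 opc; have [h|h] := pselect (exists ki, piece ncop cap t ki).
  case: h => -[k i] pt; rewrite !(assembleE ncop_gt0 cap_ge1 _ pt) opc//.
  by rewrite invr_ge0 mulr_ge0// ltW.
by rewrite !assemble0// => k i pt; apply: h; exists (k, i).
Qed.

Lemma assembleWB v w : admissible v -> admissible w ->
  admissible (fun k y => v k y - w k y) ->
  assembleW v - assembleW w = assembleW (fun k y => v k y - w k y).
Proof.
move=> av aw avw; apply: weakL1_ext => t; rewrite assembleWE//.
rewrite (assemble_op (op := fun a b => a - b)) ?subrr//; last first.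
  by move=> c a b _; rewrite mulrBl.
by rewrite -!assembleWE.
Qed.

Lemma admissibleB v w : admissible v -> admissible w ->
  admissible (fun k y => v k y - w k y).
Proof.
move=> av aw; have [mv [kap kap0 vk] [C C0 vC]] := av.
have [mw [kap' kap'0 wk] [C' C'0 wC]] := aw.
have m k : measurable_fun I01 (fun y => v k y - w k y).
  by apply: measurable_funB.
have b k y : `|v k y - w k y| <= (kap + kap') * cap k.
  by rewrite (le_trans (ler_normB _ _))// mulrDl lerD.
split => //; first by exists (kap + kap') => //; rewrite addr_ge0.
exists (C + C') => [|k]; first by rewrite addr_ge0.
apply: (@le_trans _ _ (1 * L1n (v k) + 1 * L1n (w k))).
  apply: L1n_le2 => //; first by split=> //; exists ((kap + kap') * cap k).
  - exact: admissible_bounded.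
  - exact: admissible_bounded.
  - by move=> t _; rewrite !mul1r ler_normB.
by rewrite !mul1r lerD.
Qed.

Definition restrict (P : pred nat) v : nat -> R -> R :=
  fun k y => if P k then v k y else 0.

Lemma admissible_restrict P v : admissible v -> admissible (restrict P v).
Proof.
move=> av; have [mv [kap kap0 vk] [C C0 vC]] := av; split.
- by move=> k; rewrite /restrict; case: (P k).
- exists kap => // k y; rewrite /restrict; case: (P k) => //.
  by rewrite normr0 mulr_ge0// (le_trans _ (cap_ge1 k)).
- exists C => // k; rewrite /restrict; case: (P k) => //.
  have m0 : bounded_meas (fun _ : R => 0 : R).
    by split => //; exists 0 => t; rewrite normr0.
  rewrite (le_trans (@L1n_leZ R _ 0 (v k) m0 (lexx _) (admissible_bounded k av) _))//.
    by move=> t _; rewrite normr0 mul0r.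
  by rewrite mul0r.
Qed.

(* A finite number of blocks is bounded and does not count. The blocks of small
   level have few copies, so that their level sums stay bounded while [harm M]
   tends to infinity. *)
Lemma rho_assembleW_le v (s : R) : admissible v -> 0 <= s ->
  (forall e, 0 < e -> exists m0, forall k, (m0 <= lvl k)%N -> L1n (v k) <= s + e) ->
  rho (assembleW v) <= s.
Proof.
move=> av s0 hs; have [mv [kap kap0 vk] [C C0 vC]] := av.
apply/ler_addgt0Pr => e e0.
(* One third of [e] is spent on the blocks of level at least [m0], one on the blocks of lower level
   through the choice of [M], and one on the interaction of blocks through the choice of [K]. *)
have e3 : 0 < e / 3 by rewrite divr_gt0.
have [m0 hm0] := hs _ e3.
pose Nmax := \max_(m < m0) copies m.
have [M M0 hM] := harm_unbounded (harm R Nmax * C / (e / 3)).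
have HM : 1 <= harm R M by exact: harm_ge1.
have [K hK] : exists K, kap * M%:R / 4 ^+ K <= e / 3.
  have [K KM] : exists K : nat, kap * M%:R / (e / 3) <= K%:R.
    by exists (Num.truncn (kap * M%:R / (e / 3))).+1; rewrite ltW// truncnS_gt.
  exists K; rewrite ler_pdivrMr ?exprn_gt0// [e / 3 * _]mulrC -ler_pdivrMr//.
  apply: (le_trans KM); rewrite -natrX ler_nat.
  by rewrite ltnW// ltn_expl.
pose P : pred nat := fun k => (K <= k)%N.
have aP := admissible_restrict P av.
have aC := admissible_restrict (predC P) av.
have split_G : assembleW v = assembleW (restrict P v) + assembleW (restrict (predC P) v).
  apply: weakL1_ext => t.
  rewrite -[RHS]/(assembleW (restrict P v) t + assembleW (restrict (predC P) v) t) !assembleWE//.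
  rewrite -(assemble_op (op := fun a b => a + b)) ?addr0//; last first.
    by move=> c a b _; rewrite mulrDl.
  congr (assemble _ _ _ t); apply/funext => k; apply/funext => y.
  by rewrite /restrict /=; case: (P k); rewrite ?addr0 ?add0r.
have low : rho (assembleW (restrict (predC P) v)) = 0.
  apply: (@rho_bounded _ (\sum_(k < K) kap * cap k / delta k)) => t.
  have S0 (k : 'I_K) : 0 <= kap * cap k / delta k.
    by rewrite divr_ge0 ?(ltW (delta_gt0 _))// mulr_ge0// (le_trans _ (cap_ge1 k)).
  rewrite assembleWE//; have [->|[k [i pt]]] := assembleP ncop cap (restrict (predC P) v) t.
    by rewrite normr0 sumr_ge0.
  rewrite (assembleE ncop_gt0 cap_ge1 _ pt) /restrict /= /P -ltnNge.
  case: ifP => [kK|_]; last by rewrite mul0r normr0 sumr_ge0.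
  rewrite (bigD1 (Ordinal kK))//= ler_wpDr ?sumr_ge0//.
  have d1 : 0 < delta k * i.+1%:R by rewrite mulr_gt0.
  rewrite normrM normfV (gtr0_norm d1) ler_pM ?invr_ge0 ?(ltW d1)//.
  by rewrite lef_pV2 ?posrE// ler_peMr ?(ltW (delta_gt0 k))// ler1n.
rewrite split_G (le_trans (lseminormD (rho_seminorm R) _ _))// !rho_seminormE low addr0.
have se0 : 0 <= s + e by rewrite addr_ge0// ltW.
apply: (rho_le_levsum M0 se0) => eta eta0.
have [mP [_ _ _] _] := aP.
pose D := (s + e / 3) * harm R M + e / 3 * harm R M.
have D0 : 0 <= D by rewrite addr_ge0// mulr_ge0 ?harm_ge0// ?addr_ge0// ltW.
have Pk k y : `|restrict P v k y| <= kap * cap k.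
  rewrite /restrict; case: ifP => // _.
  by rewrite normr0 mulr_ge0// (le_trans _ (cap_ge1 k)).
have P0 k y : (k < K)%N -> restrict P v k y = 0.
  by move=> kK; rewrite /restrict /P leqNgt kK.
have := @levsum_assemble_le R ncop cap ncop_gt0 cap_ge1 _ mP M eta kap D K eta0 kap0 D0 Pk P0.
have -> : levsum (gl (restrict P v)) M eta = levsum (assembleW (restrict P v)) M eta.
  by congr levsum; apply/funext => t; rewrite assembleWE.
move=> h; apply: (le_trans (h _)); last first.
  have hh : e / 3 <= e / 3 * harm R M by rewrite ler_peMr// ltW.
  have -> : (s + e) * harm R M = D + e / 3 * harm R M by rewrite /D; field.
  by rewrite lerD2l (le_trans hK).
move=> k Kk; have -> : block_sum ncop cap (restrict P v) M eta k = block_sum ncop cap v M eta k.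
  rewrite /block_sum; do 2![apply: eq_bigr => ? _; congr (_ * _)].
  by congr lev; apply/funext => y; rewrite /restrict /P Kk.
have bk := admissible_bounded k av.
have eH : 0 <= e / 3 * harm R M by rewrite mulr_ge0 ?harm_ge0// ltW.
have [m0k|km0] := leqP m0 (lvl k).
  rewrite (le_trans (block_sum_le_harm _ eta0 bk))// /D ler_wpDr//.
  by rewrite mulrC ler_wpM2r ?harm_ge0// hm0.
rewrite (le_trans (block_sum_le_copies _ eta0 bk))// /D ler_wpDl//.
  by rewrite mulr_ge0 ?harm_ge0// addr_ge0// ltW.
rewrite (@le_trans _ _ (harm R Nmax * C))//; last first.
  by rewrite [leRHS]mulrC -ler_pdivrMr.
rewrite ler_pM ?harm_ge0 ?L1n_ge0// le_harm// /Nmax.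
exact: (leq_bigmax_cond (Ordinal km0)).
Qed.

End Operator.
(** * The isometry of the normed envelope and its completion *)

Section Truncation.
Variable R : realType.

Implicit Types (f g h x : weakL1 R) (v w : nat -> R -> R).
Local Notation I01 := (`[0%R, 1%R]%classic : set R).

Definition tr (p q a : R) : R := if p < `|a| <= q then a else 0.

Lemma tr_le p q a : 0 <= q -> `|tr p q a| <= q.
Proof. by move=> q0; rewrite /tr; case: ifP => [/andP[]//|_]; rewrite normr0. Qed.

Lemma tr_dist p q a : 0 <= p -> `|a| <= q -> `|tr p q a - a| <= p.
Proof.
move=> p0 aq; rewrite /tr aq andbT; case: ltP => ap; first by rewrite subrr normr0.
by rewrite sub0r normrN.
Qed.

Lemma tr_eq0 p q a : `|a| <= p -> tr p q a = 0.
Proof. by rewrite /tr leNgt => /negPf ->. Qed.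

(** Covers linear combinations, maximum and minimum at once, so that linearity and preservation of
    the lattice operations have a common proof. *)
Definition lip_homogeneous (L : R) (op : R -> R -> R) : Prop :=
  [/\ 0 <= L,
      forall v w : R -> R, measurable_fun I01 v -> measurable_fun I01 w ->
        measurable_fun I01 (fun t : R => op (v t) (w t)),
      forall a b a' b', `|op a b - op a' b'| <= L * (`|a - a'| + `|b - b'|) &
      forall c a b, 0 <= c -> op (a * c) (b * c) = op a b * c].

Lemma lip_homogeneous00 L op : lip_homogeneous L op -> op 0 0 = 0.
Proof. by case=> _ _ _ /(_ 0 0 0 (lexx _)); rewrite !mulr0. Qed.

(* The truncation commutes with [op] up to an error near the two ends [p] and [q],
   where a weak L1 function has bounded mass. *)
Lemma tr_op L op (p q a b : R) : lip_homogeneous L op -> 0 <= p -> p <= q ->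
  `|tr p q (op a b) - op (tr p q a) (tr p q b)| <=
  (1 + 2 * L) * (p * (p < (L + 1) * (`|a| + `|b|))%R%:R +
                 q * (q < (L + 1) * (`|a| + `|b|))%R%:R).
Proof.
move=> opL p0 pq; have op00 := lip_homogeneous00 opL; have [L0 _ lip _] := opL.
have q0 : 0 <= q by exact: le_trans pq.
have na := normr_ge0 a; have nb := normr_ge0 b.
set h := (L + 1) * _.
have ah : `|a| <= h by rewrite /h; nra.
have bh : `|b| <= h by rewrite /h; nra.
have oh : `|op a b| <= h.
  by have := lip a b 0 0; rewrite op00 !subr0 => /le_trans; apply; rewrite /h; nra.
have L21 : 0 <= 1 + 2 * L by rewrite addr_ge0// mulr_ge0.
have [hp|ph] := leP h p.
  rewrite !tr_eq0 ?op00 ?subr0 ?normr0//; last 3 first.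
  - exact: le_trans hp.
  - exact: le_trans hp.
  - exact: le_trans hp.
  by rewrite mulr_ge0// addr_ge0// mulr_ge0.
rewrite mulr1; have [hq|qh] := leP h q.
  rewrite mulr0 addr0.
  have h1 := tr_dist p0 (le_trans oh hq).
  have h2 := tr_dist p0 (le_trans ah hq); have h3 := tr_dist p0 (le_trans bh hq).
  rewrite -(subrK (op a b) (tr p q (op a b))) -addrA (le_trans (ler_normD _ _))//.
  have h4 := lip a b (tr p q a) (tr p q b).
  rewrite [`|a - _|]distrC [`|b - _|]distrC in h4.
  have : L * (`|tr p q a - a| + `|tr p q b - b|) <= L * (p + p).
    by rewrite ler_wpM2l// lerD.
  lra.
rewrite mulr1 (le_trans (ler_normB _ _))//.
have h1 := tr_le p (op a b) q0.
have h2 := tr_le p a q0; have h3 := tr_le p b q0.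
have h4 := lip (tr p q a) (tr p q b) 0 0; rewrite op00 !subr0 in h4.
have : L * (`|tr p q a| + `|tr p q b|) <= L * (q + q) by rewrite ler_wpM2l// lerD.
have : 0 <= L * p by rewrite mulr_ge0.
lra.
Qed.

Definition trunc f k (t : R) : R :=
  tr (pos k)%:R (cap R k) (f t) / harm R (lvl k).

Let cap0 k : 0 <= cap R k. Proof. exact: le_trans (cap_ge1 R k). Qed.

Let pos_cap k : (pos k)%:R <= cap R k.
Proof. by rewrite /cap ler_peMl// ler1n. Qed.

Let H0 k : 0 < harm R (lvl k). Proof. exact: harm_gt0. Qed.

Let iH0 k : 0 <= (harm R (lvl k))^-1. Proof. by rewrite invr_ge0 ltW. Qed.

Lemma trunc_le f k t : `|trunc f k t| <= cap R k.
Proof.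
rewrite /trunc normrM normfV (gtr0_norm (H0 k)) ler_pdivrMr//.
by rewrite (le_trans (tr_le _ _ (cap0 k)))// ler_peMr// harm_lvl.
Qed.

Lemma measurable_tr f (p q : R) : measurable_fun I01 (fun t => tr p q (f t)).
Proof.
have mf := weakL1_measurable f.
pose A := level_set f p `\` level_set f q.
have mA : measurable A by apply: measurableD; exact: measurable_level_set.
have : measurable_fun I01 (fun t => \1_A t * f t).
  by apply: measurable_funM => //; exact: measurable_indic.
apply: eq_measurable_fun => t; rewrite inE => It; rewrite /tr indicE.
case: ifP => [/andP[pf fq]|h].
  rewrite mem_set ?mul1r//; split; first by split.
  by case=> _ /=; apply/negP; rewrite -leNgt.
rewrite memNset ?mul0r// => -[[_ /= pf] fq]; move: h; rewrite pf/=.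
by move=> /negbT; rewrite -ltNge => qf; apply: fq; split.
Qed.

Lemma measurable_trunc f k : measurable_fun I01 (trunc f k).
Proof. by apply: measurable_funM => //; exact: measurable_tr. Qed.

Lemma bounded_trunc f k : bounded_meas (trunc f k).
Proof. by split; [exact: measurable_trunc|exists (cap R k) => t; exact: trunc_le]. Qed.

(** Up to the factor [harm (lvl k)] the window is dominated by the function bounded in [rho_lt_cut];
    the constant there becomes negligible for high levels. *)
Lemma L1n_trunc f (r : R) : rho f < r -> exists2 C, 0 <= C &
  forall k, L1n (trunc f k) <= r + C / harm R (lvl k).
Proof.
move=> /rho_lt_cut[C C0 hC]; exists C => // k.
have mf := weakL1_measurable f.
have := hC (pos k)%:R (lvl k) (ltr0n R (pos k)) isT; rewrite -/(cap R k) => h.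
apply: (@le_trans _ _ ((harm R (lvl k))^-1 *
    L1n (cut f (cap R k) (level_set f (pos k)%:R)))).
  apply: L1n_leZ => //; first exact: bounded_trunc.
    by apply: bounded_meas_cut => //; exact: measurable_level_set.
  move=> t It; rewrite /trunc normrM normfV (gtr0_norm (H0 k)) mulrC ler_wpM2l//.
  rewrite [leRHS]ger0_norm ?cut_ge0// /cut indicE /tr.
  case: ifP => [/andP[pf fq]|_]; last by rewrite normr0 mulr_ge0// le_min normr_ge0 cap0.
  by rewrite mem_set// mul1r (min_idPl fq).
rewrite (le_trans (ler_wpM2l (iH0 k) h))// mulrDr mulrCA mulVf ?gt_eqF// mulr1.
by rewrite [C / _]mulrC.
Qed.

Lemma admissible_trunc f : admissible (trunc f).
Proof.
split; first exact: measurable_trunc.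
  by exists 1 => // k y; rewrite mul1r; exact: trunc_le.
have [|C C0 hC] := @L1n_trunc f (rho f + 1); first by rewrite ltrDl.
exists (rho f + 1 + C) => [|k]; first by rewrite !addr_ge0// rho_ge0.
by rewrite (le_trans (hC k))// lerD2l ler_pdivrMr// ler_peMr// harm_lvl.
Qed.

Definition defect (op : R -> R -> R) h f g k (t : R) : R :=
  trunc h k t - op (trunc f k t) (trunc g k t).

(** By [tr_op] the error lives at the two ends of the window, where the weak L1 function [u] has
    mass at most [q] each. Division by [harm (lvl k)] makes it vanish for high levels. *)
Lemma L1n_defect L op f g h : lip_homogeneous L op ->
  (forall t, h t = op (f t) (g t)) ->
  admissible (defect op h f g) /\ exists2 C, 0 <= C &
  forall k, L1n (defect op h f g k) <= C / harm R (lvl k).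
Proof.
move=> opL hE; have [L0 mop lip hom] := opL.
pose u : weakL1 R := (L + 1) *: (vabs f + vabs g).
have uE t : u t = (L + 1) * (`|f t| + `|g t|).
  by rewrite -!weakL1_absE.
have un t : `|u t| = u t.
  by rewrite ger0_norm// uE mulr_ge0// addr_ge0.
have [q q0 hq] := weak_bound u.
have L21 : 0 <= 1 + 2 * L by rewrite addr_ge0// mulr_ge0.
have op00 := lip_homogeneous00 opL.
have mE k : measurable_fun I01 (defect op h f g k).
  apply: measurable_funB; first exact: measurable_trunc.
  by apply: mop; exact: measurable_trunc.
have dE k t : `|defect op h f g k t| <= (1 + 2 * L) / harm R (lvl k) *
    ((pos k)%:R * ((pos k)%:R < `|u t|)%R%:R + cap R k * (cap R k < `|u t|)%R%:R).
  rewrite /defect /trunc hom// -mulrBl normrM normfV (gtr0_norm (H0 k)).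
  rewrite -mulrA [_^-1 * _]mulrC mulrA ler_wpM2r// un uE hE.
  by apply: tr_op.
have dB k t : `|defect op h f g k t| <= (1 + 2 * L) * 2 * cap R k.
  apply: (le_trans (dE k t)).
  have S2 : (pos k)%:R * ((pos k)%:R < `|u t|)%R%:R +
      cap R k * (cap R k < `|u t|)%R%:R <= 2 * cap R k.
    rewrite [2 * _]mulr_natl mulr2n; apply: lerD; case: (_ < _); rewrite ?mulr1 ?mulr0//.
  apply: (@le_trans _ _ ((1 + 2 * L) * (2 * cap R k))); last by rewrite mulrA.
  have S0 : 0 <= (1 + 2 * L) / harm R (lvl k) by rewrite mulr_ge0.
  apply: (le_trans (ler_wpM2l S0 S2)); rewrite ler_wpM2r//; first by rewrite mulr_ge0.
  by rewrite ler_piMr// invf_le1// harm_lvl.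
have bE k : bounded_meas (defect op h f g k).
  by split => //; exists ((1 + 2 * L) * 2 * cap R k).
have mu := weakL1_measurable u.
have dL k : L1n (defect op h f g k) <= (1 + 2 * L) * (2 * q) / harm R (lvl k).
  have cp0 : 0 < cap R k by apply: lt_le_trans (cap_ge1 R k).
  have LH : 0 <= (1 + 2 * L) / harm R (lvl k) by rewrite mulr_ge0.
  apply: (@le_trans _ _ (
     ((1 + 2 * L) / harm R (lvl k) * (pos k)%:R) * L1n (\1_(level_set u (pos k)%:R)) +
     ((1 + 2 * L) / harm R (lvl k) * cap R k) * L1n (\1_(level_set u (cap R k))))).
    apply: L1n_le2 => //; try by rewrite mulr_ge0.
    - by apply: bounded_meas_indic; exact: measurable_level_set.
    - by apply: bounded_meas_indic; exact: measurable_level_set.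
    - by move=> t It; rewrite (le_trans (dE k t))// mulrDr !mulrA !indic_level_set.
  rewrite !L1n_indic_level_set// -!(mulrA ((1 + 2 * L) / _)) -mulrDr.
  rewrite [leRHS]mulrAC ler_wpM2l// [2 * _]mulr_natl mulr2n.
  by apply: lerD; apply: hq => //; rewrite ltr0n.
split.
  split => //; first by exists ((1 + 2 * L) * 2) => //; rewrite mulr_ge0.
  exists ((1 + 2 * L) * (2 * q)) => [|k]; first by rewrite !mulr_ge0.
  rewrite (le_trans (dL k))// ler_pdivrMr// ler_peMr// ?mulr_ge0//.
  exact: harm_lvl.
by exists ((1 + 2 * L) * (2 * q)) => //; rewrite !mulr_ge0.
Qed.

Definition winmap f : weakL1 R := assembleW (trunc f).

Lemma small_over_harm (C e : R) : 0 <= C -> 0 < e ->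
  exists m0, forall k, (m0 <= lvl k)%N -> C / harm R (lvl k) <= e.
Proof.
move=> C0 e0; have [m0 m00 hm] := harm_unbounded (C / e).
exists m0 => k mk; rewrite ler_pdivrMr// mulrC -ler_pdivrMr//.
by rewrite (le_trans hm)// le_harm.
Qed.

(** The difference is assembled from the defects, whose L1 norms tend to zero as the level grows. *)
Lemma rho_winmap_op L op f g h (z : weakL1 R) : lip_homogeneous L op ->
  (forall t, h t = op (f t) (g t)) -> (forall t, z t = op (winmap f t) (winmap g t)) ->
  rho (winmap h - z) = 0.
Proof.
move=> opL hE zE; have [ad [C C0 dC]] := L1n_defect opL hE.
have [_ _ _ hom] := opL.
have -> : winmap h - z = assembleW (defect op h f g).
  apply: weakL1_ext => t; rewrite -[LHS]/(winmap h t - z t) zE.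
  rewrite !assembleWE//; try exact: admissible_trunc.
  rewrite -(assemble_op _ _ _ (lip_homogeneous00 opL) hom).
  rewrite -(assemble_op (op := fun a b => a - b)) ?subrr// => c a b _.
  by rewrite mulrBl.
apply/eqP; rewrite eq_le rho_ge0 andbT; apply: rho_assembleW_le => // e e0.
have [m0 hm0] := small_over_harm C0 e0; exists m0 => k mk.
by rewrite add0r (le_trans (dC k))// hm0.
Qed.

Lemma lip_lin (a : R) : lip_homogeneous (`|a| + 1) (fun s t => a * s + t).
Proof.
split; first by rewrite addr_ge0.
- move=> v w mv mw; apply: measurable_funD => //.
  by apply: measurable_funM.
- move=> s t s' t'; rewrite opprD addrACA -mulrBr (le_trans (ler_normD _ _))//.
  have := normr_ge0 a; have := normr_ge0 (s - s'); have := normr_ge0 (t - t').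
  rewrite normrM; nra.
- by move=> c s t _; rewrite mulrDl mulrA.
Qed.

Lemma lip_max : lip_homogeneous 1 Num.max.
Proof.
split => // [v w mv mw|x y x' y'|c x y c0]; [exact: measurable_maxr| |by rewrite maxr_pMl].
rewrite mul1r; have := normr_ge0 (x - x'); have := normr_ge0 (y - y').
have := ler_norm (x - x'); have := ler_norm (y - y').
have := ler_norm (x' - x); have := ler_norm (y' - y).
rewrite [`|x' - x|]distrC [`|y' - y|]distrC ler_norml.
rewrite /Num.max => h1 h2 h3 h4 h5 h6.
by case: ltP => h7; case: ltP => h8; apply/andP; split; lra.
Qed.

Lemma lip_min : lip_homogeneous 1 Num.min.
Proof.
split => // [v w mv mw|x y x' y'|c x y c0]; [exact: measurable_minr| |by rewrite minr_pMl].
rewrite mul1r; have := normr_ge0 (x - x'); have := normr_ge0 (y - y').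
have := ler_norm (x - x'); have := ler_norm (y - y').
have := ler_norm (x' - x); have := ler_norm (y' - y).
rewrite [`|x' - x|]distrC [`|y' - y|]distrC ler_norml.
rewrite /Num.min => h1 h2 h3 h4 h5 h6.
by case: ltP => h7; case: ltP => h8; apply/andP; split; lra.
Qed.

Lemma L1n_truncB f g (r : R) : rho (f - g) < r -> exists2 C, 0 <= C &
  forall k, L1n (fun t => trunc f k t - trunc g k t) <= r + C / harm R (lvl k).
Proof.
move=> /L1n_trunc[C C0 hC].
(* The operation is [- s + t] applied to [g] and [f]; its defect compares the window of [f - g] with
   the difference of the windows. *)
have [|ad [C' C'0 dC]] := @L1n_defect _ _ g f (f - g) (lip_lin (-1)).
  by move=> t; rewrite mulN1r addrC.
exists (C + C') => [|k]; first by rewrite addr_ge0.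
have bd : bounded_meas (fun t => trunc f k t - trunc g k t).
  exact: (admissible_bounded k (admissibleB (admissible_trunc f) (admissible_trunc g))).
apply: (@le_trans _ _ (1 * L1n (trunc (f - g) k) +
    1 * L1n (defect (fun s t => -1 * s + t) (f - g) g f k))).
  apply: L1n_le2 => //; [exact: bounded_trunc|exact: admissible_bounded|].
  move=> t _; rewrite !mul1r /defect mulN1r [- _ + _]addrC.
  set a := trunc f k t - _; rewrite -{1}(subKr (trunc (f - g) k t) a).
  exact: ler_normB.
by rewrite !mul1r mulrDl addrA lerD.
Qed.

Lemma rho_winmap_le f : rho (winmap f) <= rho f.
Proof.
apply: rho_assembleW_le; [exact: admissible_trunc|exact: rho_ge0|move=> e e0].
have e2 : 0 < e / 2 by rewrite divr_gt0.
have [|C C0 hC] := @L1n_trunc f (rho f + e / 2); first by rewrite ltrDl.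
have [m0 hm0] := small_over_harm C0 e2; exists m0 => k mk.
by rewrite (le_trans (hC k))// [in leRHS](splitr e) addrA lerD2l hm0.
Qed.

(** Block [k] alone forces the level sums of [winmap f] to be large, which bounds each window of [f]
    by [r * harm (lvl k)] up to a constant independent of [k]. Since every level sum of [f] is
    nearly the mass of a window, [rho_le_levsum] concludes. *)
Lemma rho_winmap_ge f : rho f <= rho (winmap f).
Proof.
apply/ler_addgt0Pr => e e0; pose r := rho (winmap f) + e / 2.
have r0 : 0 <= r by rewrite addr_ge0 ?rho_ge0// divr_ge0// ltW.
have [C C0 hC] := @rho_lt_cut _ (winmap f) r (ltac:(by rewrite ltrDl divr_gt0)).
have [q q0 hq] := weak_bound f.
have mf := weakL1_measurable f.
have mwf := weakL1_measurable (winmap f).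
have window k : harm R (lvl k) * L1n (trunc f k) <= r * harm R (lvl k) + (r + C + q).
  have d0 := del_gt0 (ncop_gt0 R) (cap_ge1 R) k.
  set dl := del (ncop R) (cap R) k in d0 *.
  set m := lvl k; set n := (pos k)%:R : R; set N := ncop R k; set u := trunc f k.
  have N0 : (0 < N)%N := ncop_gt0 R k.
  have NR0 : (0 : R) < N%:R by rewrite ltr0n.
  have Hm := harm_lvl R k; have Hm0 := harm_lvl_gt0 R k; rewrite -/m in Hm Hm0.
  (* For the [i]-th copy the step becomes [s = (i / N) (n / harm m)]. It is at most [n / harm m], a
     lower bound for the nonzero values of [|u|], while [m N] such steps reach the upper bound
     [cap R k / harm R m] of [|u|]. *)
  pose eta := n / (harm R m * dl * N%:R).
  have n0 : 0 < n by rewrite ltr0n.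
  have eta0 : 0 < eta by rewrite divr_gt0// mulr_gt0// mulr_gt0.
  have mN0 : (0 < m * N)%N by rewrite muln_gt0 N0.
  have bu := bounded_trunc f k.
  have up : block_sum (ncop R) (cap R) (trunc f) (m * N) eta k <= r * harm R (m * N) + C.
    apply: (le_trans (levsum_assemble_ge (ncop_gt0 R) (cap_ge1 R) (measurable_trunc f) _ k eta0)).
    have -> : levsum (assemble (ncop R) (cap R) (trunc f)) (m * N) eta =
        levsum (winmap f) (m * N) eta.
      by congr levsum; apply/funext => t; rewrite assembleWE//; exact: admissible_trunc.
    by rewrite (le_trans (levsum_le_cut _ mwf eta0))// hC.
  (* The bottom step lost for each copy costs at most [n / harm m * lev f n], hence at most
     [q / harm m]. *)
  have low : harm R N * (L1n u - q / harm R m) <=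
      block_sum (ncop R) (cap R) (trunc f) (m * N) eta k.
    rewrite block_sum_exchange// [X in X * _ <= _]/harm mulr_suml; apply: ler_sum => i _.
    rewrite ler_wpM2l ?invr_ge0// lerBlDl.
    set s := i.+1%:R * (eta * dl).
    have s0 : 0 < s by rewrite mulr_gt0// mulr_gt0.
    have sE : s = i.+1%:R / N%:R * (n / harm R m).
      by rewrite /s /eta; field; rewrite !gt_eqF.
    have sn : s <= n / harm R m.
      rewrite sE; apply: ler_piMl; first by rewrite divr_ge0// ltW.
      by rewrite ler_pdivrMr// mul1r ler_nat.
    have us t : `|u t| <= (m * N).+1%:R * s.
      apply: (@le_trans _ _ (cap R k / harm R m)).
        rewrite /u /trunc normrM normfV (gtr0_norm Hm0) ler_wpM2r ?invr_ge0 ?(ltW Hm0)//.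
        exact: tr_le.
      apply: (@le_trans _ _ ((m * N)%:R * s)).
        have -> : (m * N)%:R * s = i.+1%:R * (cap R k / harm R m).
          rewrite sE natrM /cap -/m -/n; field.
          by rewrite !gt_eqF.
        by rewrite ler_peMl ?divr_ge0 ?(ltW Hm0)// ler1n.
      by rewrite ler_wpM2r ?(ltW s0)// ler_nat.
    apply: (le_trans (L1n_le_levsum bu s0 us)); rewrite lerD2r.
    apply: (@le_trans _ _ (n / harm R m * lev f n)).
      rewrite ler_pM ?(ltW s0) ?lev_ge0//; apply: le_lev => //.
        exact: measurable_trunc.
      move=> t _; rewrite /u /trunc normr_gt0 mulf_eq0 negb_or => /andP[+ _].
      by rewrite /tr; case: ifP => [/andP[]//|]; rewrite eqxx.
    by rewrite mulrAC ler_wpM2r ?invr_ge0 ?(ltW Hm0)// hq.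
  have HN := harm_copies R m; rewrite -/(ncop R k) -/N in HN.
  have Hmul := harm_mul_le R N (ltn0Sn _ : (0 < m)%N).
  have HN0 : 0 < harm R N by exact: harm_gt0.
  have zq : q / harm R m * harm R m = q by rewrite divfK// gt_eqF.
  rewrite -(ler_pM2l HN0).
  set Lu := L1n u in low *; set z := q / harm R m in low zq.
  (* After multiplication by [harm m], the unwanted terms [r * harm m ^ 2] and [C * harm m] are
     absorbed by [harm N], which is at least [harm m ^ 2]. *)
  have h1 : (harm R N * (Lu - z)) * harm R m <= (r * (harm R m + harm R N) + C) * harm R m.
    rewrite ler_wpM2r ?(ltW Hm0)// (le_trans low)// (le_trans up)// lerD2r.
    by rewrite ler_wpM2l.
  have h2 : r * harm R m ^+ 2 <= r * harm R N by rewrite ler_wpM2l.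
  have HmN : harm R m <= harm R N.
    by rewrite (le_trans _ HN)// expr2 ler_peMr// ltW.
  have h3 : C * harm R m <= C * harm R N by rewrite ler_wpM2l.
  have -> : harm R N * (harm R m * Lu) =
      (harm R N * (Lu - z)) * harm R m + harm R N * (z * harm R m) by ring.
  rewrite zq; apply: (le_trans (lerD h1 (lexx _))).
  rewrite expr2 in h2.
  have -> : harm R N * (r * harm R m + (r + C + q)) =
    r * (harm R m * harm R N) + r * harm R N + C * harm R N + harm R N * q by ring.
  have -> : (r * (harm R m + harm R N) + C) * harm R m =
    r * (harm R m * harm R N) + r * (harm R m * harm R m) + C * harm R m by ring.
  lra.
(* The three summands bound the mass between [eta] and the integer at which the window starts, the
   error of [window], and the mass above [M eta]. *)
pose C' := (q + 1) + (r + C + q) + q.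
have [M M0 hM] := harm_unbounded (C' / (e / 2)).
have re : r + e / 2 = rho (winmap f) + e.
  by rewrite /r -addrA -splitr.
rewrite -re; apply: (rho_le_levsum M0); first by rewrite addr_ge0// divr_ge0// ltW.
move=> eta eta0; apply: (le_trans (levsum_le_cut M mf eta0)).
(* Windows start at integers only; this one has ratio [M] and starts at the first integer above
   [eta], which is at most [eta + 1]. *)
have [k [lk pk]] := window_surj M.-1 (Num.truncn eta).
rewrite prednK// in lk.
have Meta0 : 0 < M%:R * eta by rewrite mulr_gt0// ltr0n.
have le1 : (Num.truncn eta)%:R <= eta by rewrite truncn_le// ltW.
have lt1 : eta < (Num.truncn eta).+1%:R by rewrite truncnS_gt.
have wk := window k; rewrite lk in wk.
have HM0 : 0 < harm R M by exact: harm_gt0.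
apply: (@le_trans _ _ ((eta + 1) * lev f eta + harm R M * L1n (trunc f k) +
    M%:R * eta * lev f (M%:R * eta))).
  rewrite -!L1n_indic_level_set//.
  apply: L1n_le3; rewrite ?addr_ge0 ?(ltW eta0) ?(ltW HM0) ?(ltW Meta0)//.
  - by apply: bounded_meas_cut => //; [exact: measurable_level_set|exact: ltW].
  - by apply: bounded_meas_indic; exact: measurable_level_set.
  - exact: bounded_trunc.
  - by apply: bounded_meas_indic; exact: measurable_level_set.
  move=> t It; rewrite ger0_norm ?cut_ge0 ?(ltW Meta0)// !indic_level_set//.
  rewrite /cut indicE.
  have A0 : 0 <= harm R M * `|trunc f k t| by rewrite mulr_ge0// ltW.
  have [et|te] := ltP eta `|f t|; last first.
    rewrite memNset; last by case=> _ /=; apply/negP; rewrite -leNgt.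
    by rewrite mul0r mulr0 add0r addr_ge0// mulr_ge0// ltW.
  rewrite mem_set; last by split.
  rewrite mul1r mulr1; have [Mt|tM] := ltP (M%:R * eta) `|f t|.
    rewrite mulr1 lerDr.
    by rewrite addr_ge0// addr_ge0// ltW.
  rewrite mulr0 addr0.
  have [tn|nt] := leP `|f t| (Num.truncn eta).+1%:R.
    rewrite ler_wpDr// (le_trans tn)// -natr1 lerD2r//.
  rewrite ler_wpDl ?addr_ge0 ?(ltW eta0)//.
  rewrite /trunc /tr pk nt lk /cap lk pk.
  have -> : `|f t| <= M%:R * (Num.truncn eta).+1%:R.
    by rewrite (le_trans tM)// ler_wpM2l// ltW.
  by rewrite normrM normfV (gtr0_norm HM0) mulrCA divff ?mulr1// gt_eqF.
have h1 : (eta + 1) * lev f eta <= q + 1.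
  by rewrite mulrDl mul1r lerD// ?hq// lev_le1.
have h2 := hq _ Meta0.
have h3 : C' <= e / 2 * harm R M.
  by rewrite [leRHS]mulrC -ler_pdivrMr ?divr_gt0.
rewrite mulrDl; rewrite /C' in h3; lra.
Qed.

End Truncation.

(** * Extension of an isometry to the completion *)

Section Extension.
Variables (R : realType) (V W : normedLatticeType R) (T0 : V -> W).
Hypothesis T0_iso : isometric_lattice_isomorphism_into T0.
Hypothesis T0_cvg : forall u : cauchySeq V, cvgn (fun n => T0 (u n)).

Lemma cvg_vjoin (a b : nat -> W) (x y : W) : a @ \oo --> x -> b @ \oo --> y ->
  (fun n => vjoin (a n) (b n)) @ \oo --> vjoin x y.
Proof.
move=> ax bY; apply/cvgrPdist_le => e e0.
have e2 : 0 < e / 2 by rewrite divr_gt0.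
near=> n; rewrite (le_trans (norm_vjoinB _ _ _ _))// [leRHS]splitr lerD//.
  by near: n; exact: cvgr_dist_le.
by near: n; exact: cvgr_dist_le.
Unshelve. all: by end_near. Qed.

Definition extension (x : completion V) : W :=
  limn (fun n => T0 (qrepr x n)).

Lemma T0B x y : T0 (x - y) = T0 x - T0 y.
Proof.
by have [lin _ _ _] := T0_iso; rewrite addrC -scaleN1r lin scaleN1r addrC.
Qed.

(** Two Cauchy sequences with the same class differ by a null sequence, whose image under the
    isometry is null; so the limit does not depend on the representative. *)
Lemma cvg_extension (u : cauchySeq V) :
  (fun n => T0 (u n)) @ \oo --> extension (qpi (limnorm_seminorm V) u).
Proof.
set q := qrepr (qpi (limnorm_seminorm V) u).
have cq : (fun n => T0 (q n)) @ \oo --> extension (qpi (limnorm_seminorm V) u).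
  exact: T0_cvg.
have d0 : (fun n => `|(q - u) n|) @ \oo --> (0 : R).
  rewrite -(qpi_repr (limnorm_seminorm V) u); exact: is_cvg_limnorm.
apply/cvgrPdist_le => e e0; have e2 : 0 < e / 2 by rewrite divr_gt0.
near=> n; rewrite (le_trans (ler_distD (T0 (q n)) _ _))// [leRHS]splitr lerD//.
  by near: n; exact: cvgr_dist_le.
have [_ nT _ _] := T0_iso; rewrite -T0B nT -cauchySeqN -cauchySeqD.
have -> : `|(q - u) n| = `|0 - `|(q - u) n| | by rewrite sub0r normrN normr_id.
by near: n; exact: cvgr_dist_le.
Unshelve. all: by end_near. Qed.

Lemma extension_isometric : isometric_lattice_isomorphism_into extension.
Proof.
have [lin nT jT mT] := T0_iso.
have E (u : cauchySeq V) (y : W) : (fun n => T0 (u n)) @ \oo --> y ->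
    extension (qpi (limnorm_seminorm V) u) = y.
  move=> uy; rewrite -(cvg_lim (@norm_hausdorff _ W) uy).
  by apply/esym/(cvg_lim (@norm_hausdorff _ W)); exact: cvg_extension.
have C := cvg_extension.
split=> [a x y|x|x y|x y].
- rewrite -(qreprK x) -(qreprK y) -qpi_scale -qpiD; apply: E.
  rewrite (_ : (fun n => _) = (fun n => a *: T0 (qrepr x n) + T0 (qrepr y n))).
    by apply: cvgD; [apply: cvgZr; exact: C|exact: C].
  by apply/funext => n; rewrite cauchySeqD cauchySeqZ lin.
- rewrite -(qreprK x) norm_qpi.
  apply: (etrans (esym (cvg_lim (@norm_hausdorff _ R^o) (cvg_norm (C _))))).
  apply: (cvg_lim (@norm_hausdorff _ R^o)).
  rewrite (_ : (fun n => _) = (fun n => `|qrepr x n|)); first exact: is_cvg_limnorm.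
  by apply/funext => n; rewrite /= nT.
- rewrite -(qreprK x) -(qreprK y) -[vjoin _ _](qpi_join (limnorm_seminorm V)); apply: E.
  rewrite (_ : (fun n => _) = (fun n => vjoin (T0 (qrepr x n)) (T0 (qrepr y n)))).
    by apply: cvg_vjoin; exact: C.
  by apply/funext => n; rewrite -jT.
- rewrite -(qreprK x) -(qreprK y) -[vmeet _ _ in LHS](qpi_meet (limnorm_seminorm V)); apply: E.
  rewrite (_ : (fun n => _) =
    (fun n => - vjoin (- T0 (qrepr x n)) (- T0 (qrepr y n)))).
    by rewrite vmeetE; apply: cvgN; apply: cvg_vjoin; apply: cvgN; exact: C.
  by apply/funext => n; rewrite -vmeetE -mT.
Qed.

End Extension.

(** * The isometry of the envelope and convergence along Cauchy sequences *)

Section Embedding.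
Variable R : realType.
Implicit Types f g : weakL1 R.
Local Notation p := (rho_seminorm R).
Local Notation W := (normed_envelope R).

(** [winmap] is linear up to functions on which [rho] vanishes, so this reduces to [rho_winmap_le];
    it makes [envmap] independent of representatives. *)
Lemma rho_winmapB f g : rho (winmap f - winmap g) <= rho (f - g).
Proof.
have h : rho (winmap (f - g) - (winmap f - winmap g)) = 0.
  by apply: (@rho_winmap_op R _ _ g f _ _ (lip_lin (-1))) => t; rewrite mulN1r addrC.
have E : winmap f - winmap g =
    winmap (f - g) - (winmap (f - g) - (winmap f - winmap g)) by rewrite subKr.
rewrite E (le_trans (lseminormD p _ _))// (lseminormN p) !rho_seminormE h addr0.
exact: rho_winmap_le.
Qed.

Definition envmap (x : W) : W := qpi p (winmap (qrepr x)).

Lemma envmap_pi f : envmap (qpi p f) = qpi p (winmap f).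
Proof.
apply/qpiP/le_anti; rewrite (lseminorm_ge0 p) andbT.
by rewrite (le_trans (rho_winmapB _ _))// -rho_seminormE qpi_repr.
Qed.

Lemma envmap_isometric : isometric_lattice_isomorphism_into envmap.
Proof.
split=> [a x y|x|x y|x y].
- rewrite -(qreprK x) -(qreprK y) -qpi_scale -qpiD !envmap_pi -qpi_scale -qpiD.
  by apply/qpiP; apply: (rho_winmap_op (lip_lin a)).
- rewrite -(qreprK x) envmap_pi !norm_qpi; apply/le_anti.
  by rewrite rho_winmap_le rho_winmap_ge.
- rewrite -(qreprK x) -(qreprK y) -[vjoin _ _ in LHS](qpi_join p) !envmap_pi -[RHS](qpi_join p).
  by apply/qpiP; apply: (rho_winmap_op (lip_max R)).
- rewrite -(qreprK x) -(qreprK y) -[vmeet _ _ in LHS](qpi_meet p) !envmap_pi -[RHS](qpi_meet p).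
  by apply/qpiP; apply: (rho_winmap_op (lip_min R)).
Qed.

(** Completeness of the target is replaced by an explicit limit: at level [m] it uses the windows of
    the term with index [nu m]. As [rho] of an assembled function sees high levels only, the limit
    is compared with a fixed term where [nu] is already large. *)
Lemma envmap_cvg (u : cauchySeq W) : cvgn (fun n => envmap (u n)).
Proof.
have /cauchy_predP uc := cauchySeqP u.
pose F n : weakL1 R := qrepr (u n).
have rF i j : rho (F i - F j) = `|u i - u j|.
  by rewrite -(qreprK (u i)) -(qreprK (u j)) -qpiN -qpiD norm_qpi.
pose d a b k (t : R) := trunc (F a) k t - trunc (F b) k t.
(* From level [m] on, the windows of the first terms, up to index [n], are as close in L1 as the
   terms are in [rho], up to [1 / n.+1]. *)
pose P n m := forall a b k, (a <= n)%N -> (b <= n)%N -> (m <= lvl k)%N ->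
  L1n (d a b k) <= rho (F a - F b) + n.+1%:R^-1.
have inv0 n : 0 < n.+1%:R^-1 :> R by rewrite invr_gt0 ltr0n.
have [nu [Pnu nu_oo]] : exists nu : nat -> nat, (forall m, P (nu m) m) /\
    (forall n, exists m0, forall m, (m0 <= m)%N -> (n <= nu m)%N).
  apply: diagonal_selection => [m a b k|n].
    rewrite !leqn0 => /eqP -> /eqP -> _.
    have b0 : bounded_meas (d 0%N 0%N k).
      exact: (admissible_bounded k (admissibleB (admissible_trunc _) (admissible_trunc _))).
    rewrite (le_trans (@L1n_leZ R _ 0 _ b0 (lexx _) b0 _))//.
      by move=> t _; rewrite mul0r /d subrr normr0.
    by rewrite mul0r addr_ge0 ?rho_ge0// ltW.
  have e2 : 0 < n.+1%:R^-1 / 2 :> R by rewrite divr_gt0.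
  have /choice[mm hmm] (ab : nat * nat) : exists m, forall k, (m <= lvl k)%N ->
      L1n (d ab.1 ab.2 k) <= rho (F ab.1 - F ab.2) + n.+1%:R^-1.
    have [|C C0 hC] := @L1n_truncB R (F ab.1) (F ab.2)
        (rho (F ab.1 - F ab.2) + n.+1%:R^-1 / 2); first by rewrite ltrDl.
    have [m0 hm0] := small_over_harm C0 e2; exists m0 => k mk.
    rewrite (le_trans (hC k))// [in leRHS](splitr n.+1%:R^-1) addrA lerD2l.
    exact: hm0.
  (* Finitely many pairs of indices are involved, so the largest of their thresholds serves all of
     them. *)
  exists (\max_(a < n.+1) \max_(b < n.+1) mm (a : nat, b : nat)) => m hm a b k an bn mk.
  apply: (hmm (a, b)); rewrite (leq_trans _ mk)// (leq_trans _ hm)//.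
  rewrite -ltnS in an; rewrite -ltnS in bn.
  apply: (leq_trans _ (leq_bigmax (Ordinal an))).
  exact: (leq_bigmax (F := fun b : 'I_n.+1 => mm (a, b : nat)) (Ordinal bn)).
pose v k := trunc (F (nu (lvl k))) k.
have av : admissible v.
  split; first by move=> k; exact: measurable_trunc.
    by exists 1 => // k y; rewrite mul1r; exact: trunc_le.
  have [N hN] := uc 1 ltr01.
  (* A bound for the distances of all terms to the first one; it gives the uniform L1 bound that
     admissibility demands. *)
  pose D := \sum_(i < N) `|u i - u 0%N| + (1 + `|u N - u 0%N|).
  have S0 : 0 <= \sum_(i < N) `|u i - u 0%N| by rewrite sumr_ge0.
  have hD i : rho (F i - F 0%N) <= D.
    rewrite rF /D; have [iN|Ni] := ltnP i N.
      rewrite ler_wpDr ?addr_ge0// (bigD1 (Ordinal iN))//= lerDl.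
      by rewrite sumr_ge0.
    rewrite ler_wpDl// (le_trans (ler_distD (u N) _ _))// lerD2r ltW//.
    by apply: hN.
  have D0 : 0 <= D by rewrite addr_ge0// addr_ge0.
  have [_ _ [C C0 hC]] := admissible_trunc (F 0%N).
  exists (D + 1 + C) => [|k]; first by rewrite !addr_ge0.
  apply: (@le_trans _ _ (1 * L1n (d (nu (lvl k)) 0%N k) + 1 * L1n (trunc (F 0%N) k))).
    apply: L1n_le2 => //; [exact: bounded_trunc| |exact: bounded_trunc|].
      exact: (admissible_bounded k (admissibleB (admissible_trunc _) (admissible_trunc _))).
    by move=> t _; rewrite !mul1r /d /v -{1}(subrK (trunc (F 0%N) k t) (trunc _ _ _)) ler_normD.
  rewrite !mul1r lerD// (le_trans (Pnu (lvl k) _ _ k (leqnn _) (leq0n _) (leqnn _)))//.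
  by rewrite lerD// invf_le1// ler1n.
apply/cvg_ex; exists (qpi p (assembleW v)); apply/cvgrPdist_le => e e0.
have [J hJ] := uc e e0; exists J => // a /= Ja.
rewrite /envmap -qpiN -qpiD norm_qpi rho_seminormE.
have aF := admissible_trunc (F a).
rewrite [X in rho X](_ : _ = assembleW (fun k t => v k t - trunc (F a) k t)); last first.
  by rewrite -assembleWB//; exact: admissibleB.
apply: rho_assembleW_le; [exact: admissibleB|exact: ltW|move=> e' e'0].
have [n' hn'] : exists n', n'.+1%:R^-1 <= e'.
  exists (Num.truncn e'^-1); rewrite invf_ple ?posrE// ltW// truncnS_gt//.
(* From level [m0] on, [nu] is at least [a], so that [P] applies to the pair; at least [J], so that
   the terms are within [e]; and at least [n'], so that the error is below [e']. *)
have [m0 hm0] := nu_oo (maxn (maxn a J) n'); exists m0 => k mk.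
have := hm0 _ mk; rewrite !geq_max => /andP[/andP[an Jn] nn].
rewrite (le_trans (Pnu (lvl k) _ _ k (leqnn _) an (leqnn _)))// lerD//.
  by rewrite rF ltW// hJ.
by rewrite (le_trans _ hn')// lef_pV2 ?posrE// ler_nat ltnS.
Qed.

End Embedding.

Theorem theorem5 (R : realType) :
  exists T : banach_envelope R -> normed_envelope R,
    isometric_lattice_isomorphism_into T.
Proof.
exists (extension (@envmap R)).
exact: (extension_isometric (envmap_isometric R) (@envmap_cvg R)).
Qed.
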